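(* Let $\Omega_1\subset\mathbb{C}^{d_1}$ and $\Omega_2\subset\mathbb{C}^{d_2}$ be bounded convex domains with $C^{1,\alpha}$ boundaries (for some $\alpha\in(0,1]$). If $\Omega_2$ is $\mathbb{C}$-strictly convex, then every isometric embedding $f:(\Omega_1,K_{\Omega_1})\to(\Omega_2,K_{\Omega_2})$ extends to a continuous map $\overline f:\overline{\Omega_1}\to\overline{\Omega_2}$.
   Context: $K_\Omega$ is the Kobayashi distance on $\Omega$. An isometric embedding is a map with $K_{\Omega_2}(f(p),f(q))=K_{\Omega_1}(p,q)$ for all $p,q\in\Omega_1$ (not assumed holomorphic). A convex domain $\Omega$ is $\mathbb{C}$-strictly convex if every supporting complex hyperplane intersects $\partial\Omega$ at exactly one point; when $\partial\Omega$ is $C^1$ this is equivalent to $T_x^{\mathbb{C}}\partial\Omega\cap\partial\Omega=\{x\}$ for every $x\in\partial\Omega$, where $T_x^{\mathbb{C}}\partial\Omega$ is the complex affine hyperplane tangent to $\partial\Omega$ at $x$. *)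

(* Defs.v *)
From HB Require Import structures.
From mathcomp Require Import all_boot all_order all_algebra.
From mathcomp Require Import complex.
From mathcomp Require Import all_classical all_reals all_analysis.

Set Implicit Arguments.
Unset Strict Implicit.
Unset Printing Implicit Defensive.

Import Order.TTheory GRing.Theory Num.Theory.
Import numFieldNormedType.Exports.

Local Open Scope classical_set_scope.
Local Open Scope ring_scope.

(* [R[i]^o] is the alias of [R[i]] that carries the topology of the modulus and
   the structure of a normed module over itself, so that differentiability of
   functions defined on it is complex differentiability. *)
Notation Cplx R := (R[i]^o)%type.
Notation Cvec R d := ('rV[Cplx R]_d).

(* On 'rV[C]_d the library's topology is the product topology of C^d. *)

Definition domain (R : realType) (d : nat) (Omega : set (Cvec R d)) : Prop :=
  [/\ open Omega, connected Omega & Omega !=set0].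

(* In [convex_set] the coefficients range over the lambda : R[i] such that
   0 <= lambda <= 1; the order of R[i] forces them to be real, so this is real
   convexity. *)
Definition bounded_convex_domain (R : realType) (d : nat)
    (Omega : set (Cvec R d)) : Prop :=
  [/\ domain Omega, bounded_set Omega & convex_set Omega].

Definition boundary (T : topologicalType) (A : set T) : set T :=
  closure A `\` interior A.

Definition C1alpha_on (R : realType) (V : normedModType R) (alpha : R)
    (U : set V) (r : V -> R^o) : Prop :=
  (forall x, U x -> differentiable r x) /\
  exists M : R, forall x y h, U x -> U y ->
    `|'d r x h - 'd r y h| <= M * `|x - y| `^ alpha * `|h|.

(* Local defining functions with nonvanishing differential. *)
Definition C1alpha_boundary (R : realType) (V : normedModType R) (alpha : R)
    (A : set V) : Prop :=
  forall x, boundary A x -> exists (U : set V) (r : V -> R^o),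
    [/\ open_nbhs x U, C1alpha_on alpha U r,
        forall y, U y -> exists h, 'd r y h != 0 &
        A `&` U = [set y | r y < 0] `&` U].

(* C^d seen as the real normed space R^d * R^d. *)
Definition complexify (R : realType) (d : nat) (v : 'rV[R]_d * 'rV[R]_d) :
    Cvec R d :=
  \row_j (Complex (v.1 ord0 j) (v.2 ord0 j) : Cplx R).

Definition has_C1alpha_boundary (R : realType) (d : nat) (alpha : R)
    (Omega : set (Cvec R d)) : Prop :=
  C1alpha_boundary alpha (@complexify R d @^-1` Omega).

Definition complex_hyperplane (R : realType) (d : nat) (H : set (Cvec R d)) :
    Prop :=
  exists (a : 'cV[Cplx R]_d) (c : Cplx R),
    a != 0 /\ H = [set z | (z *m a) ord0 ord0 = c].

Definition supporting_complex_hyperplane (R : realType) (d : nat)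
    (Omega H : set (Cvec R d)) : Prop :=
  [/\ complex_hyperplane H, H `&` boundary Omega !=set0 & H `&` Omega = set0].

Definition C_strictly_convex (R : realType) (d : nat) (Omega : set (Cvec R d)) :
    Prop :=
  convex_set Omega /\
  forall H, supporting_complex_hyperplane Omega H ->
    exists x, H `&` boundary Omega = [set x].

Definition unit_disc (R : realType) : set (Cplx R) := [set z | `|z| < 1].

(* The Poincare distance artanh |(a - b) / (1 - a * conj b)|. *)
Definition poincare (R : realType) (a b : Cplx R) : R :=
  let t := complex.Re `|((a - b) / (1 - a * conjc b) : R[i])| in
  ln ((1 + t) / (1 - t)) / 2.

Definition holomorphic_disc (R : realType) (d : nat) (Omega : set (Cvec R d))
    (phi : Cplx R -> Cvec R d) : Prop :=
  (forall z, unit_disc z -> derivable phi z 1) /\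
  (forall z, unit_disc z -> Omega (phi z)).

(* [L] is the length of a finite chain of holomorphic discs joining [p] to [q]:
   the i-th disc [phi i] takes [a i] to [x i] and [b i] to [x i.+1]. *)
Definition disc_chain_length (R : realType) (d : nat) (Omega : set (Cvec R d))
    (p q : Cvec R d) (L : R) : Prop :=
  exists (n : nat) (x : nat -> Cvec R d) (phi : nat -> Cplx R -> Cvec R d)
    (a b : nat -> Cplx R),
    [/\ x 0%N = p, x n = q,
        forall i, (i < n)%N ->
          [/\ holomorphic_disc Omega (phi i), unit_disc (a i), unit_disc (b i),
              phi i (a i) = x i & phi i (b i) = x i.+1] &
        L = \sum_(i < n) poincare (a i) (b i)].

Definition kobayashi (R : realType) (d : nat) (Omega : set (Cvec R d))
    (p q : Cvec R d) : \bar R :=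
  ereal_inf [set L%:E | L in disc_chain_length Omega p q].

Definition kobayashi_isometric_embedding (R : realType) (d1 d2 : nat)
    (Omega1 : set (Cvec R d1)) (Omega2 : set (Cvec R d2))
    (f : Cvec R d1 -> Cvec R d2) : Prop :=
  (forall p, Omega1 p -> Omega2 (f p)) /\
  (forall p q, Omega1 p -> Omega1 q ->
     kobayashi Omega2 (f p) (f q) = kobayashi Omega1 p q).

(* Main.v *)
(* Write (p|q) for the Gromov product of the Kobayashi distance K based at o, and
   t(p) for the parameter in p = x + t (o - x) with x on the boundary. Supporting
   complex hyperplanes and the Schwarz-Pick lemma (into a half-plane) give
   K(p, o) >= 1/2 log 1/t(p); the C^{1,alpha} regularity gives the matching upper
   bound up to an additive constant, and more precisely a path of length
   1/2 log(e / t(p)) + O(1) from p to depth e. Hence (p|q) tends to infinity when p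
   and q tend to the same boundary point. If p and q tend to distinct boundary points
   of a C-strictly convex domain, a chain of discs joining them must pass through a
   point where both supporting functionals are bounded below, so (p|q) stays bounded.
   An isometric embedding preserves Gromov products, so f(p) has only one cluster
   point as p tends to a boundary point. Since discs are only assumed complex
   differentiable, Schwarz's lemma is derived from Goursat's theorem. *)
Require Import Defs.
From HB Require Import structures.
From mathcomp Require Import all_boot all_order all_algebra.
From mathcomp Require Import complex ring lra.
From mathcomp Require Import all_classical all_reals all_analysis.

Import Order.TTheory GRing.Theory Num.Theory.
Import numFieldNormedType.Exports.

Local Open Scope classical_set_scope.
Local Open Scope ring_scope.

(** * Goursat's theorem *)

Section Goursat.
Context {R : realType}.
Implicit Types (f g : R -> R) (U V : R -> R -> R).

(** Only additive errors in the distance are harmless: an error in the factor 1/2 of 1/2 log 1/t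
    would grow without bound near the boundary and spoil every comparison of Gromov products. Discs
    of radius proportional to the depth lose in that factor, so depth is halved inside discs much
    larger than the depth, at cost (ln 2)/2 plus a summable term.

    Supporting functionals are followed through their modulus, not their real part. The zero set of
    the modulus is a complex hyperplane, which is all that C-strict convexity controls; the real
    tangent hyperplane may meet the boundary in a large set.

    Distances are infima in the extended reals. Every estimate is therefore put in one of two forms,
    the existence of one chain of length at most M or a lower bound M for all chains, and the
    isometry is used only to compare a statement of one form with a statement of the other.

    Of complex analysis only the equality of circular means is extracted from Goursat's theorem; it
    already excludes the strict maxima that the maximum principle has to exclude. *)

Definition itg f a b : R := \int[@lebesgue_measure R]_(x in `[a, b]) f x.

Definition cts_on f a b := forall x, a <= x <= b -> {for x, continuous f}.

Lemma cts_onS f a b a' b' : a <= a' -> b' <= b -> cts_on f a b ->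
  cts_on f a' b'.
Proof.
move=> aa bb cf x /andP[ax xb]; apply: cf.
by rewrite (le_trans aa ax) (le_trans xb bb).
Qed.

Lemma itg_integrable f a b : cts_on f a b ->
  (@lebesgue_measure R).-integrable `[a, b] (EFin \o f).
Proof.
move=> cf; apply: continuous_compact_integrable; first exact: segment_compact.
apply: continuous_in_subspaceT => x.
by rewrite inE /= in_itv /= => xab; exact: cf.
Qed.

Lemma itg_split f (a b c : R) : a <= b -> b <= c -> cts_on f a c ->
  itg f a c = itg f a b + itg f b c.
Proof.
move=> ab bc cf; rewrite /itg.
have ic := itg_integrable _ _ _ cf.
have /eqP := Rintegral_itvB (x := b) ic ab bc.
rewrite subr_eq addrC => /eqP ->.
congr (_ + _).
by rewrite Rintegral_itv_obnd_cbnd //; apply: integrableS ic => //; apply: subset_itvr.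
Qed.

Lemma itgB f g a b : cts_on f a b -> cts_on g a b ->
  itg (fun x => f x - g x) a b = itg f a b - itg g a b.
Proof. by move=> cf cg; apply: RintegralB => //; exact: itg_integrable. Qed.

Lemma le_itg f g a b : cts_on f a b -> cts_on g a b ->
  (forall x, a <= x <= b -> f x <= g x) -> itg f a b <= itg g a b.
Proof.
by move=> cf cg fg; apply: le_Rintegral => //; exact: itg_integrable.
Qed.

Lemma itg_cst (k a b : R) : a <= b -> itg (fun=> k) a b = k * (b - a).
Proof.
move=> ab; rewrite /itg Rintegral_cst //; congr (_ * _).
by rewrite /= lebesgue_measure_itv /= lte_fin; case: ltgtP ab => // -> _; rewrite subrr.
Qed.

Lemma cts_on_cst (k a b : R) : cts_on (fun=> k) a b.
Proof. by move=> x _; exact: cvg_cst. Qed.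

Lemma itg_near_cst f (k e a b : R) : a <= b -> cts_on f a b ->
  (forall x, a <= x <= b -> `|f x - k| <= e) ->
  `|itg f a b - k * (b - a)| <= e * (b - a).
Proof.
move=> ab cf fk; rewrite ler_distl -mulrBl -mulrDl -!itg_cst //.
apply/andP; split; apply: le_itg => //; try exact: cts_on_cst.
- by move=> x /fk; rewrite ler_distl => /andP[].
- by move=> x /fk; rewrite ler_distl => /andP[].
Qed.

(* Half of the Cauchy-Riemann equations, d_x U = d_y V (both are p), suffices for
   the circulation below to vanish. *)
Definition conj_diff U V x y := exists p q r : R, forall e, 0 < e ->
  exists2 d, 0 < d & forall s t, `|s| < d -> `|t| < d ->
  `|U (x + s) (y + t) - U x y - (p * s + q * t)| <= e * (`|s| + `|t|) /\
  `|V (x + s) (y + t) - V x y - (r * s + p * t)| <= e * (`|s| + `|t|).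

Lemma near_dist_lt (x d : R) : 0 < d -> \forall y \near x, `|y - x| < d.
Proof. by move=> d0; exists d => //= y; rewrite /ball_ /= distrC. Qed.

Lemma little_o_continuous f (x k : R) :
  (exists2 d, 0 < d & forall s, `|s| < d -> `|f (x + s) - f x - k * s| <= `|s|) ->
  {for x, continuous f}.
Proof.
move=> [d d0 H]; apply/cvgrPdist_le => e e0.
have M0 : 0 < 1 + `|k| by rewrite ltr_pwDl.
near=> y.
have yd : `|y - x| < d by near: y; exact: near_dist_lt.
have ye : `|y - x| < e / (1 + `|k|).
  by near: y; apply: near_dist_lt; exact: divr_gt0.
have := H _ yd; rewrite [x + _]addrC subrK => Hy.
rewrite distrC -(subrK (k * (y - x)) (f y - f x)).
apply: le_trans (ler_normD _ _) _; rewrite normrM.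
move: ye; rewrite ltr_pdivlMr // => ye.
apply: le_trans (ltW ye); rewrite [leRHS]mulrDr mulr1 [`|k| * _]mulrC.
by rewrite lerD2r.
Unshelve. all: by end_near. Qed.

Lemma conj_diff_cts U V x y : conj_diff U V x y ->
  [/\ {for x, continuous (U^~ y)}, {for x, continuous (V^~ y)},
      {for y, continuous (U x)} & {for y, continuous (V x)}].
Proof.
move=> [p [q [r /(_ 1 ltr01)[d d0 H]]]].
have n0 : `|0 : R| < d by rewrite normr0.
split; [apply: (little_o_continuous _ _ p) | apply: (little_o_continuous _ _ r)
  | apply: (little_o_continuous _ _ q) | apply: (little_o_continuous _ _ p)];
  exists d => // s sd.
- by have [] := H s 0 sd n0; rewrite mulr0 !addr0 normr0 addr0 mul1r.
- by have [_] := H s 0 sd n0; rewrite mulr0 !addr0 normr0 addr0 mul1r.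
- by have [] := H 0 s n0 sd; rewrite mulr0 !addr0 normr0 !add0r mul1r.
- by have [_] := H 0 s n0 sd; rewrite mulr0 !addr0 normr0 !add0r mul1r.
Qed.

Lemma one_of_four_large (S a1 a2 a3 a4 : R) : S <= a1 + a2 + (a3 + a4) ->
  S <= 4 * a1 \/ S <= 4 * a2 \/ S <= 4 * a3 \/ S <= 4 * a4.
Proof.
move=> H; have [|h1] := leP S (4 * a1); first by left.
have [|h2] := leP S (4 * a2); first by right; left.
have [|h3] := leP S (4 * a3); first by right; right; left.
right; right; right; lra.
Qed.

Section box.
Variables (U V : R -> R -> R) (a b c d : R).
Hypotheses (UV : forall x y, a <= x <= b -> c <= y <= d -> conj_diff U V x y).

(** This is the integral of V dx + U dy along the boundary, that is, the imaginary part of the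
    contour integral of U + iV. *)
Definition circulation x1 x2 y1 y2 :=
  itg (V^~ y1) x1 x2 - itg (V^~ y2) x1 x2 + (itg (U x2) y1 y2 - itg (U x1) y1 y2).

Lemma cts_onUx x : a <= x <= b -> cts_on (U x) c d.
Proof. by move=> xab y ycd; have [] := conj_diff_cts _ _ _ _ (UV x y xab ycd). Qed.

Lemma cts_onVy y : c <= y <= d -> cts_on (V^~ y) a b.
Proof. by move=> ycd x xab; have [] := conj_diff_cts _ _ _ _ (UV x y xab ycd). Qed.

Lemma circulation_splitx x1 x2 x3 y1 y2 : a <= x1 -> x1 <= x2 -> x2 <= x3 ->
  x3 <= b -> c <= y1 -> y1 <= y2 -> y2 <= d ->
  circulation x1 x3 y1 y2 = circulation x1 x2 y1 y2 + circulation x2 x3 y1 y2.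
Proof.
move=> ? ? ? ? ? ? ?; rewrite /circulation.
rewrite (itg_split (V^~ y1) x1 x2 x3) ?(itg_split (V^~ y2) x1 x2 x3) //.
- by ring.
- by apply: cts_onS (cts_onVy _ _) => //; lra.
- by apply: cts_onS (cts_onVy _ _) => //; lra.
Qed.

Lemma circulation_splity x1 x2 y1 y2 y3 : a <= x1 -> x1 <= x2 -> x2 <= b ->
  c <= y1 -> y1 <= y2 -> y2 <= y3 -> y3 <= d ->
  circulation x1 x2 y1 y3 = circulation x1 x2 y1 y2 + circulation x1 x2 y2 y3.
Proof.
move=> ? ? ? ? ? ? ?; rewrite /circulation.
rewrite (itg_split (U x1) y1 y2 y3) ?(itg_split (U x2) y1 y2 y3) //.
- by ring.
- by apply: cts_onS (cts_onUx _ _) => //; lra.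
- by apply: cts_onS (cts_onUx _ _) => //; lra.
Qed.

(** The affine part of (U, V) at (x, y) contributes [- p * h * w] on the horizontal sides and
    [p * w * h] on the vertical ones, which cancel. Only the remainder is left, of size
    [e * (w + h)] on a contour of length comparable to [w + h]. *)
Lemma circulation_small x y e : a <= x <= b -> c <= y <= d -> 0 < e ->
  exists2 r, 0 < r & forall x1 y1 w h,
    a <= x1 -> x1 + w <= b -> c <= y1 -> y1 + h <= d ->
    x1 <= x <= x1 + w -> y1 <= y <= y1 + h -> w < r -> h < r ->
    `|circulation x1 (x1 + w) y1 (y1 + h)| <= e * (w + h) ^+ 2.
Proof.
move=> xab ycd e0.
have [p [q [r H]]] := UV x y xab ycd.
have [|D D0 HD] := H (e / 2); first by lra.
exists D => // x1 y1 w h ax1 x1b cy1 y1d xx yy wD hD.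
have near : forall u v, `|u - x| <= w -> `|v - y| <= h ->
    `|U u v - U x y - (p * (u - x) + q * (v - y))| <= e / 2 * (w + h) /\
    `|V u v - V x y - (r * (u - x) + p * (v - y))| <= e / 2 * (w + h).
  move=> u v ux vy.
  have [] := HD (u - x) (v - y) (le_lt_trans ux wD) (le_lt_trans vy hD).
  rewrite ![_ + (_ - _)]addrC !subrK => h1 h2.
  have b1 : e / 2 * (`|u - x| + `|v - y|) <= e / 2 * (w + h).
    by apply: ler_wpM2l; [rewrite divr_ge0 // ltW | exact: lerD].
  by split; [exact: le_trans h1 b1 | exact: le_trans h2 b1].
have dx : forall u, x1 <= u <= x1 + w -> `|u - x| <= w.
  by move=> u; move: xx; clear -UV => ? ?; rewrite ler_norml; lra.
have dy : forall u, y1 <= u <= y1 + h -> `|u - y| <= h.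
  by move=> u; move: yy; clear -UV => ? ?; rewrite ler_norml; lra.
have w0 : 0 <= w by move: xx; clear -UV; lra.
have h0 : 0 <= h by move: yy; clear -UV; lra.
have cV1 : cts_on (V^~ y1) x1 (x1 + w).
  by apply: cts_onS (cts_onVy _ _) => //; move: cy1 y1d h0; clear -UV; lra.
have cV2 : cts_on (V^~ (y1 + h)) x1 (x1 + w).
  by apply: cts_onS (cts_onVy _ _) => //; move: cy1 y1d h0; clear -UV; lra.
have cU1 : cts_on (U x1) y1 (y1 + h).
  by apply: cts_onS (cts_onUx _ _) => //; move: ax1 x1b w0; clear -UV; lra.
have cU2 : cts_on (U (x1 + w)) y1 (y1 + h).
  by apply: cts_onS (cts_onUx _ _) => //; move: ax1 x1b w0; clear -UV; lra.
have IV : `|itg (fun s => V s y1 - V s (y1 + h)) x1 (x1 + w) - (- p * h) * (x1 + w - x1)|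
    <= e * (w + h) * (x1 + w - x1).
  apply: itg_near_cst; first by rewrite lerDl.
    by move=> s sx; apply: cvgB; [exact: cV1 | exact: cV2].
  move=> s sx.
  have [|_] := near s y1 (dx _ sx); first by apply: dy; rewrite lexx lerDl.
  have [|_] := near s (y1 + h) (dx _ sx); first by apply: dy; rewrite lexx lerDl andbT.
  by clear -UV; rewrite !ler_norml; lra.
have IU : `|itg (fun t => U (x1 + w) t - U x1 t) y1 (y1 + h) - (p * w) * (y1 + h - y1)|
    <= e * (w + h) * (y1 + h - y1).
  apply: itg_near_cst; first by rewrite lerDl.
    by move=> s sx; apply: cvgB; [exact: cU2 | exact: cU1].
  move=> t ty.
  have [||+ _] := near (x1 + w) t; [by apply: dx; rewrite lexx lerDl andbT | exact: dy |].
  have [||+ _] := near x1 t; [by apply: dx; rewrite lexx lerDl | exact: dy |].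
  by clear -UV; rewrite !ler_norml; lra.
rewrite itgB // in IV; rewrite itgB // in IU.
rewrite /circulation.
have -> : e * (w + h) ^+ 2 = e * (w + h) * (x1 + w - x1) + e * (w + h) * (y1 + h - y1).
  by ring.
apply: le_trans (lerD IV IU); apply: le_trans (ler_normD _ _).
by rewrite le_eqVlt; apply/orP; left; apply/eqP; congr (Num.norm _); ring.
Qed.

Lemma circulation_quarter w h (P : R * R) : 0 <= w -> 0 <= h ->
  a <= P.1 -> P.1 + w <= b -> c <= P.2 -> P.2 + h <= d ->
  exists Q : R * R,
  [/\ P.1 <= Q.1, Q.1 + w / 2 <= P.1 + w, P.2 <= Q.2 , Q.2 + h / 2 <= P.2 + h &
    `|circulation P.1 (P.1 + w) P.2 (P.2 + h)| <=
    4 * `|circulation Q.1 (Q.1 + w / 2) Q.2 (Q.2 + h / 2)| ].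
Proof.
case: P => x y /= w0 h0 ax xb cy yd.
have -> : circulation x (x + w) y (y + h) =
   (circulation x (x + w / 2) y (y + h / 2) +
   circulation x (x + w / 2) (y + h / 2) (y + h / 2 + h / 2)) +
   (circulation (x + w / 2) (x + w / 2 + w / 2) y (y + h / 2) +
   circulation (x + w / 2) (x + w / 2 + w / 2) (y + h / 2) (y + h / 2 + h / 2)).
  have -> : x + w = x + w / 2 + w / 2 by lra.
  have -> : y + h = y + h / 2 + h / 2 by lra.
  rewrite (circulation_splitx x (x + w / 2) (x + w / 2 + w / 2)); try lra.
  rewrite (circulation_splity x _ y (y + h / 2) (y + h / 2 + h / 2)); try lra.
  by rewrite (circulation_splity _ _ y (y + h / 2) (y + h / 2 + h / 2)); lra.
set c1 := circulation _ _ _ _; set c2 := circulation x _ _ _.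
set c3 := circulation _ _ _ _; set c4 := circulation _ _ _ _.
have T : `|c1 + c2 + (c3 + c4)| <= `|c1| + `|c2| + (`|c3| + `|c4|).
  by apply: le_trans (ler_normD _ _) (lerD (ler_normD _ _) (ler_normD _ _)).
have [h1|[h1|[h1|h1]]] := one_of_four_large _ _ _ _ _ T.
- by exists (x, y); split=> //=; move: w0 h0; clear -UV; lra.
- by exists (x, y + h / 2); split=> //=; move: w0 h0; clear -UV; lra.
- by exists (x + w / 2, y); split=> //=; move: w0 h0; clear -UV; lra.
- by exists (x + w / 2, y + h / 2); split=> //=; move: w0 h0; clear -UV; lra.
Qed.

(** Quartering n times loses at most a factor 4^n, while the square of the size of the box gains
    exactly 4^n; [circulation_small] at the common point of the boxes then makes the circulation
    arbitrarily small. *)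
Lemma goursat : a <= b -> c <= d -> circulation a b c d = 0.
Proof.
move=> ab cd.
pose w n := (b - a) / 2 ^+ n; pose h n := (d - c) / 2 ^+ n.
have w0 n : 0 <= w n by rewrite divr_ge0 // ?exprn_ge0 // subr_ge0.
have h0 n : 0 <= h n by rewrite divr_ge0 // ?exprn_ge0 // subr_ge0.
have wS n : w n.+1 = w n / 2 by rewrite /w exprS invfM mulrA mulrAC.
have hS n : h n.+1 = h n / 2 by rewrite /h exprS invfM mulrA mulrAC.
pose inbox n (P : R * R) := [/\ a <= P.1, P.1 + w n <= b, c <= P.2 & P.2 + h n <= d].
(* The property is conditional on [inbox], so that the choice is total and the sequence [P] can be
   defined by recursion before its invariant [bP] is proved. *)
have step n P : {Q | inbox n P -> [/\ P.1 <= Q.1, Q.1 + w n.+1 <= P.1 + w n, P.2 <= Q.2 ,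
    Q.2 + h n.+1 <= P.2 + h n & `|circulation P.1 (P.1 + w n) P.2 (P.2 + h n)| <=
    4 * `|circulation Q.1 (Q.1 + w n.+1) Q.2 (Q.2 + h n.+1)| ] }.
  apply: cid; have [bP|nP] := pselect (inbox n P); last by exists P.
  have [p1 p2 p3 p4] := bP.
  by have [Q HQ] := circulation_quarter _ _ P (w0 n) (h0 n) p1 p2 p3 p4;
    exists Q => _; rewrite wS hS.
pose P := fix P n := if n is m.+1 then sval (step m (P m)) else (a, c).
have bP n : inbox n (P n).
  elim: n => [|n IH].
    by split => /=; rewrite ?lexx // /w /h expr0 divr1; lra.
  have [q1 q2 q3 q4 _] := svalP (step n (P n)) IH.
  have [p1 p2 p3 p4] := IH.
  by split; [exact: le_trans p1 q1 | exact: le_trans q2 p2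
    | exact: le_trans p3 q3 | exact: le_trans q4 p4].
have nest m n : (m <= n)%N -> [/\ (P m).1 <= (P n).1, (P n).1 + w n <= (P m).1 + w m,
    (P m).2 <= (P n).2 & (P n).2 + h n <= (P m).2 + h m].
  elim: n => [|n IH]; first by rewrite leqn0 => /eqP ->.
  rewrite leq_eqVlt => /orP[/eqP -> //|]; rewrite ltnS => /IH[i1 i2 i3 i4].
  have [q1 q2 q3 q4 _] := svalP (step n (P n)) (bP n).
  by split; [exact: le_trans i1 q1 | exact: le_trans q2 i2
    | exact: le_trans i3 q3 | exact: le_trans q4 i4].
have cross m n : (P m).1 <= (P n).1 + w n /\ (P m).2 <= (P n).2 + h n.
  have [mn|/ltnW nm] := leqP m n.
    have [i1 _ i3 _] := nest _ _ mn; have := w0 n; have := h0 n; lra.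
  by have [_ i2 _ i4] := nest _ _ nm; have := w0 m; have := h0 m; lra.
(* By [cross], every left end lies below every right end, so the supremum of the left ends lies in
   all the boxes. *)
pose x := sup (range (fun n => (P n).1)); pose y := sup (range (fun n => (P n).2)).
have xP n : (P n).1 <= x <= (P n).1 + w n.
  apply/andP; split.
    apply: ub_le_sup; last by exists n.
    by exists ((P 0%N).1 + w 0%N) => _ [k _ <-]; have [] := cross k 0%N.
  by apply: ge_sup => [|_ [k _ <-]]; [exists (P 0%N).1; exists 0%N | have [] := cross k n].
have yP n : (P n).2 <= y <= (P n).2 + h n.
  apply/andP; split.
    apply: ub_le_sup; last by exists n.
    by exists ((P 0%N).2 + h 0%N) => _ [k _ <-]; have [] := cross k 0%N.
  by apply: ge_sup => [|_ [k _ <-]]; [exists (P 0%N).2; exists 0%N | have [] := cross k n].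
have xab : a <= x <= b.
  by have := xP 0%N; rewrite /= /w expr0 divr1; lra.
have ycd : c <= y <= d.
  by have := yP 0%N; rewrite /= /h expr0 divr1; lra.
have grow n : `|circulation a b c d| <=
    4 ^+ n * `|circulation (P n).1 ((P n).1 + w n) (P n).2 ((P n).2 + h n)|.
  elim: n => [|n IH].
    by rewrite /= expr0 mul1r /w /h expr0 !divr1 ![_ + (_ - _)]addrC !subrK.
  have [_ _ _ _ q5] := svalP (step n (P n)) (bP n).
  apply: le_trans IH _; rewrite exprSr -mulrA; exact: ler_wpM2l.
apply/eqP; rewrite -normr_le0; apply/ler_addgt0Pl => e e0; rewrite addr0.
(* The summand 1 keeps the divisor positive for a degenerate box. *)
pose T := (b - a + (d - c)) ^+ 2 + 1.
have T0 : 0 < T by rewrite ltr_wpDl // sqr_ge0.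
have [r r0 Hr] := circulation_small x y (e / T) xab ycd (divr_gt0 e0 T0).
have [n nr] : exists n, w n < r /\ h n < r.
  have cv k : (k / 2 ^+ n : R) @[n --> \oo] --> (0 : R).
    rewrite -[X in _ --> X](mulr0 k); apply: cvgMr.
    under eq_fun do rewrite -exprVn.
    by apply: cvg_expr; rewrite normfV ger0_norm // invf_lt1 // ltr1n.
  have nw k : \forall n \near \oo, k / 2 ^+ n < r.
    have /cvgrPdist_lt /(_ _ r0) := cv k; apply: filterS => n.
    by rewrite sub0r normrN; apply: le_lt_trans; exact: ler_norm.
  have : \forall n \near \oo, w n < r /\ h n < r by near=> n; split; near: n; exact: nw.
  by move=> /filter_ex.
have [b1 b2 b3 b4] := bP n; have [n1 n2] := nr.
apply: le_trans (grow n) _.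
have p4 : 0 <= (4 : R) ^+ n by rewrite exprn_ge0.
apply: le_trans (ler_wpM2l p4 (Hr _ _ _ _ b1 b2 b3 b4 (xP n) (yP n) n1 n2)) _.
have -> : 4 ^+ n * (e / T * (w n + h n) ^+ 2) = e * ((T - 1) / T).
  have e4 : (4 : R) ^+ n = (2 ^+ n) ^+ 2.
    by rewrite -exprM mulnC exprM; congr (_ ^+ _); ring.
  have u0 : (2 : R) ^+ n != 0 by rewrite expf_neq0 // pnatr_eq0.
  have Tn : T != 0 by rewrite gt_eqF.
  have TE : T - 1 = (b - a + (d - c)) ^+ 2 by rewrite /T addrK.
  rewrite TE e4 /w /h.
  by move: (2 ^+ n) u0 T Tn {T0 TE Hr} => u u0 T Tn; field; rewrite Tn.
by rewrite ler_piMr ?(ltW e0) // ler_pdivrMr //; lra.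
Unshelve. all: by end_near. Qed.

End box.
End Goursat.

(** * The Schwarz-Pick lemma *)

Import Normc.

(** * Modulus, real part and imaginary part *)

Section ComplexModulus.
Context {R : realType}.
Implicit Types (x y : R) (z w : R[i]).

Local Notation nm := (@normc R).

Lemma nmC x : nm x%:C%C = `|x|.
Proof. by rewrite /= expr0n /= addr0 sqrtr_sqr. Qed.

Lemma nm_ge0 z : 0 <= nm z.
Proof. by case: z => a b /=; exact: sqrtr_ge0. Qed.

Lemma normcC z : `|z| = (nm z)%:C%C.
Proof. by case: z. Qed.

Lemma Re_norm z : complex.Re `|z| = nm z.
Proof. by rewrite normcC. Qed.

Lemma nmD z w : nm (z + w) <= nm z + nm w.
Proof. exact: le_normcD. Qed.

Lemma nmN z : nm (- z) = nm z.
Proof. exact: normcN. Qed.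

Lemma nm_distC z w : nm (z - w) = nm (w - z).
Proof. by rewrite -nmN opprB. Qed.

Lemma nm0 : nm 0 = 0. Proof. exact: normc0. Qed.

Lemma nm1 : nm 1 = 1. Proof. exact: normc1. Qed.

Lemma nm_eq0 z : (nm z == 0) = (z == 0).
Proof.
by apply/eqP/eqP => [/eq0_normc //|->]; exact: nm0.
Qed.

Lemma nm_gt0 z : (0 < nm z) = (z != 0).
Proof. by rewrite lt_def nm_ge0 nm_eq0 andbT. Qed.

Lemma nmJ z : nm (conjc z) = nm z.
Proof. by case: z => a b /=; rewrite sqrrN. Qed.

Lemma nm_sq z : nm z ^+ 2 = complex.Re z ^+ 2 + complex.Im z ^+ 2.
Proof. by case: z => a b /=; rewrite sqr_sqrtr // addr_ge0 ?sqr_ge0. Qed.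

Lemma Re_nm z : `|complex.Re z| <= nm z.
Proof.
by rewrite -(ler_pXn2r (_ : 0 < 2)%N) ?nnegrE ?nm_ge0 // nm_sq real_normK ?num_real // lerDl sqr_ge0.
Qed.

Lemma Im_nm z : `|complex.Im z| <= nm z.
Proof.
by rewrite -(ler_pXn2r (_ : 0 < 2)%N) ?nnegrE ?nm_ge0 // nm_sq real_normK ?num_real // lerDr sqr_ge0.
Qed.

Lemma nm_ReIm z : nm z <= `|complex.Re z| + `|complex.Im z|.
Proof.
rewrite -(ler_pXn2r (_ : 0 < 2)%N) ?nnegrE ?nm_ge0 ?addr_ge0 // nm_sq sqrrD.
by rewrite !real_normK ?num_real // lerD2r lerDl mulrn_wge0 // mulr_ge0.
Qed.

Lemma cReD z w : complex.Re (z + w) = complex.Re z + complex.Re w.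
Proof. by case: z; case: w. Qed.
Lemma cImD z w : complex.Im (z + w) = complex.Im z + complex.Im w.
Proof. by case: z; case: w. Qed.
Lemma cReN z : complex.Re (- z) = - complex.Re z.
Proof. by case: z. Qed.
Lemma cImN z : complex.Im (- z) = - complex.Im z.
Proof. by case: z. Qed.
Lemma cReM z w : complex.Re (z * w) =
  complex.Re z * complex.Re w - complex.Im z * complex.Im w.
Proof. by case: z; case: w. Qed.
Lemma cImM z w : complex.Im (z * w) =
  complex.Re z * complex.Im w + complex.Im z * complex.Re w.
Proof. by case: z; case: w => a b c d /=. Qed.
Definition ReImE := (cReD, cImD, cReN, cImN, cReM, cImM).

End ComplexModulus.

(** * Complex derivatives and circular means in logarithmic coordinates *)

Section ComplexDerivative.
Context {R : realType}.
Local Notation nm := (@normc R).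
Implicit Types (g : R[i] -> R[i]) (z w l : R[i]).

Definition cderiv g z l := forall e, 0 < e -> exists2 d, 0 < d &
  forall h, nm h < d -> nm (g (z + h) - g z - l * h) <= e * nm h.

Definition ccont g z := forall e, 0 < e -> exists2 d, 0 < d &
  forall w, nm (w - z) < d -> nm (g w - g z) <= e.

End ComplexDerivative.

Section Polar.
Context {R : realType}.
Local Notation nm := (@normc R).
Implicit Types (g : R[i] -> R[i]) (x y s t : R).

(** The exponential of x + iy. Circles around 0 become vertical segments, so a rectangle compares
    the means over two circles. *)
Definition polar x y : R[i] := Complex (expR x * cos y) (expR x * sin y).

Lemma polarD x s y t : polar (x + s) (y + t) = polar x y * polar s t.
Proof.
apply/eqP; rewrite eq_complex cReM cImM /= expRD cosD sinD.
by apply/andP; split; apply/eqP; ring.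
Qed.

Lemma nm_polar x y : nm (polar x y) = expR x.
Proof.
rewrite /polar /= !exprMn -mulrDr cos2Dsin2 mulr1 sqrtr_sqr ger0_norm // expR_ge0.
Qed.

Lemma is_derive_little_o (f : R -> R) x k : is_derive x 1 f k ->
  forall e, 0 < e -> exists2 d, 0 < d &
  forall s, `|s| < d -> `|f (x + s) - f x - k * s| <= e * `|s|.
Proof.
move=> [df <-] e e0.
have : h^-1 *: (f (h *: (1 : R) + x) - f x) @[h --> 0^'] --> 'D_1 f x by exact: df.
move=> /cvgrPdist_le /(_ e e0) /nbhs_ballP [d /= d0 H].
exists d => // s sd.
have [->|s0] := eqVneq s 0; first by rewrite addr0 subrr mulr0 subr0 normr0 mulr0.
have := H s; rewrite /ball /= sub0r normrN => /(_ sd s0).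
rewrite /= -[s *: 1]/(s * 1) mulr1 [s + x]addrC distrC => H1.
rewrite -ler_pdivrMr ?normr_gt0 // -normfV -normrM.
apply: le_trans H1; rewrite le_eqVlt; apply/orP; left; apply/eqP; congr (Num.norm _).
rewrite /GRing.scale /=; field; exact: s0.
Qed.

Lemma polar_little_o e : 0 < e -> exists2 d, 0 < d &
  forall s t, `|s| < d -> `|t| < d ->
  nm (polar s t - 1 - Complex s t) <= e * (`|s| + `|t|).
Proof.
(* The bound 1/2 keeps [expR s] below 2; the error terms then add up to at most
   [e1 * |s| + 5 * e1 * |t|], which e/8 absorbs. *)
move=> e0; pose e1 := Num.min (e / 8) (1 / 2).
have e10 : 0 < e1 by rewrite lt_min; apply/andP; split; lra.
have e1e : e1 <= e / 8 by rewrite ge_min lexx.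
have e12 : e1 <= 1 / 2 by rewrite ge_min lexx orbT.
have [d1 d10 H1] := is_derive_little_o _ _ _ (is_derive_expR 0) _ e10.
have [d2 d20 H2] := is_derive_little_o _ _ _ (is_derive_cos 0) _ e10.
have [d3 d30 H3] := is_derive_little_o _ _ _ (is_derive_sin 0) _ e10.
exists (Num.min (Num.min d1 d2) (Num.min d3 (e1 / 2))).
  by rewrite !lt_min d10 d20 d30 /=; lra.
move=> s t; rewrite !lt_min => /andP[/andP[s1 s2] /andP[s3 s4]].
move=> /andP[/andP[t1 t2] /andP[t3 t4]].
have := H1 s s1; rewrite add0r expR0 mul1r => h1.
have := H2 t t2; rewrite add0r cos0 sin0 oppr0 mul0r subr0 => h2.
have := H3 t t3; rewrite add0r sin0 cos0 mul1r subr0 => h3.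
have es : `|expR s - 1| <= e1.
  rewrite -(subrK s (expR s - 1)); apply: le_trans (ler_normD _ _) _.
  apply: le_trans (lerD h1 (ltW s4)) _.
  have : e1 * `|s| <= 1 / 2 * (e1 / 2).
    by apply: ler_pM => //; lra.
  lra.
have es2 : `|expR s| <= 2.
  by rewrite ger0_norm ?expR_ge0 //; move: es; rewrite ler_norml => /andP[_ ?]; lra.
apply: le_trans (nm_ReIm _) _; rewrite !ReImE /=.
have -> : expR s * cos t + - 1 - s = (expR s - 1 - s) + expR s * (cos t - 1) by ring.
have -> : expR s * sin t + - 0 - t = expR s * (sin t - t) + (expR s - 1) * t by ring.
have b1 : `|expR s * (cos t - 1)| <= 2 * (e1 * `|t|) by rewrite normrM; apply: ler_pM.
have b2 : `|expR s * (sin t - t)| <= 2 * (e1 * `|t|) by rewrite normrM; apply: ler_pM.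
have b3 : `|(expR s - 1) * t| <= e1 * `|t| by rewrite normrM; apply: ler_wpM2r.
apply: le_trans (lerD (ler_normD _ _) (ler_normD _ _)) _.
have c1 : e1 * `|s| <= e / 8 * `|s| by apply: ler_wpM2r.
have c2 : e1 * `|t| <= e / 8 * `|t| by apply: ler_wpM2r.
have : 0 <= e * `|s| by rewrite mulr_ge0 // ltW.
have : 0 <= e * `|t| by rewrite mulr_ge0 // ltW.
lra.
Qed.

Lemma cderiv_polar g x y l : cderiv g (polar x y) l ->
  conj_diff (fun x y => complex.Re (g (polar x y)))
            (fun x y => complex.Im (g (polar x y))) x y.
Proof.
move=> dg; set E := polar x y; set k := l * E.
(* By the chain rule [k] is the derivative of g o exp; the three numbers are the entries of
   multiplication by [k] as a real matrix. *)
exists (complex.Re k), (- complex.Im k), (complex.Im k) => e e0.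
pose M := expR x; have M0 : 0 < M by exact: expR_gt0.
pose L := nm l + 1; have L0 : 0 < L by rewrite ltr_wpDl // nm_ge0.
have eM : 0 < e / (4 * M) by rewrite divr_gt0 // mulr_gt0.
have eLM : 0 < e / (2 * L * M) by rewrite divr_gt0 // !mulr_gt0.
have [D D0 HD] := dg _ eM.
have [d1 d10 H1] := polar_little_o _ eLM.
have [d2 d20 H2] := polar_little_o _ ltr01.
exists (Num.min (Num.min d1 d2) (D / (4 * M))).
  by rewrite !lt_min d10 d20 /= divr_gt0 // mulr_gt0.
move=> s t; rewrite !lt_min => /andP[/andP[s1 s2] s3] /andP[/andP[t1 t2] t3].
have h1 := H1 s t s1 t1; have h2 := H2 s t s2 t2.
set st := Complex s t in h1 h2; set P := polar s t in h1 h2.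
set n := `|s| + `|t| in h1 h2 *.
have n0 : 0 <= n by rewrite addr_ge0.
have nst : nm st <= n by exact: nm_ReIm.
have P1 : nm (P - 1) <= 2 * n.
  rewrite -(subrK st (P - 1)); apply: le_trans (nmD _ _) _; lra.
pose h := E * (P - 1).
have nh : nm h <= M * (2 * n).
  by rewrite normcM nm_polar; apply: ler_wpM2l => //; exact: ltW.
have nhD : nm h < D.
  apply: le_lt_trans nh _; move: s3 t3; rewrite !ltr_pdivlMr ?mulr_gt0 //.
  by rewrite /n; nra.
have Eh : polar (x + s) (y + t) = E + h.
  by rewrite polarD /h mulrBr mulr1 -/E -/P addrC subrK.
have key : nm (g (polar (x + s) (y + t)) - g E - k * st) <= e * n.
  rewrite Eh -(subrK (l * h) (_ - g E)) -addrA; apply: le_trans (nmD _ _) _.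
  have -> : l * h - k * st = l * E * (P - 1 - st) by rewrite /k /h; ring.
  have b1 := HD h nhD.
  have b2 : nm (l * E * (P - 1 - st)) <= e / 2 * n.
    rewrite !normcM nm_polar.
    apply: (@le_trans _ _ (nm l * M * (e / (2 * L * M) * n))).
      by apply: ler_wpM2l => //; rewrite mulr_ge0 ?nm_ge0 // ltW.
    have -> : nm l * M * (e / (2 * L * M) * n) = (nm l / L) * (e / 2 * n).
      by field; rewrite !gt_eqF.
    apply: ler_piMl; first by rewrite mulr_ge0 // divr_ge0 // ltW.
    by rewrite ler_pdivrMr // mul1r lerDl.
  have b3 : e / (4 * M) * nm h <= e / 2 * n.
    apply: le_trans (ler_wpM2l (ltW eM) nh) _.
    by rewrite le_eqVlt; apply/orP; left; apply/eqP; field; rewrite gt_eqF.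
  by have := lerD (le_trans b1 b3) b2; rewrite -mulrDl -splitr.
have kst : k * st = Complex (complex.Re k * s - complex.Im k * t)
                            (complex.Im k * s + complex.Re k * t).
  by apply/eqP; rewrite eq_complex !ReImE /=; apply/andP; split; apply/eqP; ring.
split.
- apply: le_trans key; apply: le_trans (Re_nm _); rewrite kst !ReImE /=.
  by rewrite mulNr.
- by apply: le_trans key; apply: le_trans (Im_nm _); rewrite kst !ReImE /=.
Qed.

(* Goursat's theorem for g o polar on [x, x1] * [0, 2 pi] equates the circular
   means of Re g, and the means tend to Re (g 0) as the radius tends to 0. *)
Lemma no_quadratic_max g rho eps : 0 < rho -> 0 < eps ->
  (forall z, 0 < nm z -> nm z < rho -> exists l, cderiv g z l) -> ccont g 0 ->
  (forall z, nm z < rho -> complex.Re (g z) - complex.Re (g 0) <= - eps * nm z ^+ 2) ->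
  False.
Proof.
move=> rho0 eps0 dg cg mx.
pose U x y := complex.Re (g (polar x y)).
pose V x y := complex.Im (g (polar x y)).
pose x1 := ln (rho / 2).
have r20 : 0 < rho / 2 by lra.
have ex1 : expR x1 = rho / 2 by rewrite lnK // posrE.
have UV x y : x <= x1 -> conj_diff U V x y.
  move=> xx1; have [||l dl] := dg (polar x y).
  - by rewrite nm_polar expR_gt0.
  - by rewrite nm_polar (@le_lt_trans _ _ (rho / 2)) -?ex1 ?ler_expR // ex1; lra.
  - exact: cderiv_polar dl.
(* [e] is half of the drop on the outer circle: the outer mean is at most Re (g 0) - 2e, while
   continuity at 0 makes the inner one at least Re (g 0) - e. *)
have e0 : 0 < eps * (rho / 2) ^+ 2 / 2 by rewrite divr_gt0 // mulr_gt0 // exprn_gt0.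
set e := _ / 2 in e0.
have [d d0 Hd] := cg e e0.
pose x0 := Num.min x1 (ln (d / 2)).
have x01 : x0 <= x1 by rewrite ge_min lexx.
have ex0 : expR x0 < d.
  apply: (@le_lt_trans _ _ (d / 2)); last by lra.
  have d20 : d / 2 \is Num.pos by rewrite posrE; lra.
  by rewrite -(lnK d20) ler_expR ge_min lexx orbT.
have pi0 : (0 : R) <= pi *+ 2 by rewrite mulrn_wge0 // pi_ge0.
have cUx x : x <= x1 -> cts_on (U x) 0 (pi *+ 2).
  by move=> xx1 y _; have [] := conj_diff_cts _ _ _ _ (UV x y xx1).
have := @goursat _ U V x0 x1 0 (pi *+ 2) _ x01 pi0.
(* The sides at heights 0 and 2 pi carry the same values, so the horizontal part of the circulation
   vanishes and the two circular means agree. *)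
have per : (fun x => V x (pi *+ 2)) = (fun x => V x 0).
  by apply/funext => x; rewrite /V /polar cos2pi sin2pi cos0 sin0.
rewrite /circulation per subrr add0r => G.
have /eqP : itg (U x1) 0 (pi *+ 2) - itg (U x0) 0 (pi *+ 2) = 0.
  by apply: G => x y /andP[_ xx1] _; exact: UV.
rewrite subr_eq0 => /eqP A01.
have A1 : itg (U x1) 0 (pi *+ 2) <= (complex.Re (g 0) - 2 * e) * (pi *+ 2 - 0).
  rewrite -(itg_cst _ _ _ pi0).
  apply: (le_itg _ _ _ _ (cUx x1 (lexx _)) (cts_on_cst _ _ _)) => y _.
  have x1r : nm (polar x1 y) < rho by rewrite nm_polar ex1; move: rho0; clear; lra.
  have := mx _ x1r; rewrite nm_polar ex1 /U /e; clear; lra.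
have A0 : (complex.Re (g 0) - e) * (pi *+ 2 - 0) <= itg (U x0) 0 (pi *+ 2).
  rewrite -(itg_cst _ _ _ pi0).
  apply: (le_itg _ _ _ _ (cts_on_cst _ _ _) (cUx x0 x01)) => y _.
  have := Hd (polar x0 y); rewrite subr0 nm_polar => /(_ ex0) H.
  have := le_trans (Re_nm _) H; rewrite !ReImE ler_norml /U; clear; lra.
move: A0; rewrite -A01 => A0; have := le_trans A0 A1.
have pi1 : 0 < pi *+ 2 - 0 :> R by rewrite subr0 mulrn_wgt0 // pi_gt0.
by rewrite (ler_pM2r pi1); move: e0; clear; lra.
Qed.

End Polar.

(** * The topology of the complex plane with real radii *)

Section ComplexTopology.
Context {R : realType}.
Local Notation nm := (@normc R).
Implicit Types (z w : Cplx R) (P : set (Cplx R)).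

(** Balls of [Cplx R] have radii in [R[i]], whose positive elements are real; here they are replaced
    by radii in [R]. *)
Lemma nbhs_cplxP z P :
  nbhs z P <-> exists2 d : R, 0 < d & forall w, nm (w - z) < d -> P w.
Proof.
split=> [/nbhs_ballP[e /= e0 H]|[d d0 H]].
  have ee : e = (nm e)%:C%C by rewrite -normcC gtr0_norm.
  exists (nm e); first by rewrite nm_gt0 gt_eqF.
  move=> w wz; apply: H; rewrite /ball /= distrC normcC ee ltcR.
  exact: wz.
apply/nbhs_ballP; exists d%:C%C; first by rewrite /= ltcR.
by move=> w; rewrite /ball /= distrC normcC ltcR; exact: H.
Qed.

Lemma continuous_cplxP (T : topologicalType) (f : T -> Cplx R) (x : T) :
  {for x, continuous f} <->
  forall e : R, 0 < e -> \forall y \near x, nm (f y - f x) < e.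
Proof.
split=> [cf e e0|H].
  by apply: (cf [set w | nm (w - f x) < e]); apply/nbhs_cplxP; exists e.
by move=> P /nbhs_cplxP[e e0 He]; apply: filterS (H e e0) => y; exact: He.
Qed.

Lemma continuous_realP (T : topologicalType) (f : T -> R) (x : T) :
  {for x, continuous f} <->
  forall e : R, 0 < e -> \forall y \near x, `|f y - f x| < e.
Proof.
split=> [/cvgrPdist_lt cf e /cf|H]; first by apply: filterS => y; rewrite distrC.
by apply/cvgrPdist_lt => e /H; apply: filterS => y; rewrite distrC.
Qed.

Lemma continuous_Complex :
  continuous ((fun p => Complex p.1 p.2) : R * R -> Cplx R).
Proof.
move=> [a b]; apply/continuous_cplxP => e e0.
have e2 : 0 < e / 2 by lra.
have h1 := near_dist_lt a _ e2; have h2 := near_dist_lt b _ e2.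
near=> q; apply: le_lt_trans (nm_ReIm _) _ => /=.
rewrite [e]splitr; apply: ltrD; near: q.
- exact: (cvg_fst h1).
- exact: (cvg_snd h2).
Unshelve. all: by end_near. Qed.

Lemma continuous_Re : continuous (fun z : Cplx R => complex.Re z : R).
Proof.
move=> z; apply/continuous_realP => e e0; apply/nbhs_cplxP; exists e => // w wz.
by apply: le_lt_trans wz; have := Re_nm (w - z); rewrite !ReImE.
Qed.

Lemma continuous_nm : continuous (fun z : Cplx R => nm z : R).
Proof.
move=> z; apply/continuous_realP => e e0; apply/nbhs_cplxP; exists e => // w wz.
apply: le_lt_trans wz; rewrite ler_norml.
have := nmD z (w - z); have := nmD w (z - w).
rewrite ![_ + (_ - _)]addrC !subrK nm_distC; lra.
Qed.

Lemma compact_disc (r : R) : compact [set z : Cplx R | nm z <= r].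
Proof.
pose K : set (R * R) := `[- r, r]%classic `*` `[- r, r]%classic.
have cK : compact K by apply: compact_setX; exact: segment_compact.
apply: (@subclosed_compact _ _ ((fun p : R * R => Complex p.1 p.2 : Cplx R) @` K)).
- have := closed_comp (fun z _ => continuous_nm z) (@closed_le R r).
  by apply.
- apply: continuous_compact => //; apply: continuous_subspaceT.
  exact: continuous_Complex.
- move=> z /= zr; exists (complex.Re z, complex.Im z); last by case: z {zr}.
  by split; rewrite /= in_itv /= -ler_norml; [move: (Re_nm z)|move: (Im_nm z)] => /le_trans; exact.
Qed.

End ComplexTopology.

(** * Continuity and complex differentiability of field-valued functions *)

Section FieldContinuity.
Context {K : numFieldType} {T : topologicalType}.
Implicit Types (f g : T -> K) (x : T).

Lemma ctsI (x : T) : {for x, continuous id}.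
Proof. exact: cvg_id. Qed.
Lemma cts_near (U : topologicalType) (f g : T -> U) x :
  (\forall y \near x, f y = g y) -> {for x, continuous g} -> {for x, continuous f}.
Proof.
move=> fg cg; have fgx := nbhs_singleton fg.
rewrite /prop_for /continuous_at fgx; apply: cvg_trans cg.
by apply: near_eq_cvg; apply: filterS fg => y.
Qed.
Lemma ctsC (k : K) x : {for x, continuous (fun=> k)}.
Proof. exact: cvg_cst. Qed.
Lemma ctsM f g x : {for x, continuous f} -> {for x, continuous g} ->
  {for x, continuous (fun y => f y * g y)}.
Proof. exact: cvgM. Qed.
Lemma ctsD f g x : {for x, continuous f} -> {for x, continuous g} ->
  {for x, continuous (fun y => f y + g y)}.
Proof. exact: cvgD. Qed.
Lemma ctsN f x : {for x, continuous f} -> {for x, continuous (fun y => - f y)}.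
Proof. exact: cvgN. Qed.
Lemma ctsV f x : f x != 0 -> {for x, continuous f} ->
  {for x, continuous (fun y => (f y)^-1)}.
Proof. exact: cvgV. Qed.
End FieldContinuity.

Section CplxDiff.
Context {K : numFieldType}.
Implicit Types (f g : K -> K) (z w : K).

(* Caratheodory's form of complex differentiability. *)
Definition cdiff f z := exists2 q : K -> K, {for z, continuous q} &
  \forall w \near z, f w - f z = q w * (w - z).

Lemma cdiff_continuous f z : cdiff f z -> {for z, continuous f}.
Proof.
move=> [q cq fq].
have c1 : {for z, continuous (fun w => q w * (w - z) + f z)}.
  apply: ctsD; last exact: ctsC.
  by apply: ctsM => //; apply: ctsD; [exact: ctsI | exact: ctsC].
apply: (cts_near _ _ _ _ _ c1).
by apply: filterS fq => w <-; rewrite subrK.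
Qed.

Lemma cdiff_near f g z : (\forall w \near z, f w = g w) -> cdiff g z -> cdiff f z.
Proof.
move=> fg [q cq H]; exists q => //; have fgz := nbhs_singleton fg.
by apply: filterS2 fg H => w -> <-; rewrite fgz.
Qed.

Lemma cdiff_cst (k : K) z : cdiff (fun=> k) z.
Proof.
exists (fun=> 0); first exact: ctsC.
by near=> w; rewrite subrr mul0r.
Unshelve. all: by end_near. Qed.

Lemma cdiff_id z : cdiff id z.
Proof.
exists (fun=> 1); first exact: ctsC.
by near=> w; rewrite mul1r.
Unshelve. all: by end_near. Qed.

Lemma cdiffD f g z : cdiff f z -> cdiff g z -> cdiff (fun w => f w + g w) z.
Proof.
move=> [p cp fp] [q cq gq]; exists (fun w => p w + q w); first exact: ctsD.
by apply: filterS2 fp gq => w fw gw; rewrite mulrDl -fw -gw; ring.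
Qed.

Lemma cdiffM f g z : cdiff f z -> cdiff g z -> cdiff (fun w => f w * g w) z.
Proof.
move=> df dg; have cf := cdiff_continuous _ _ df.
case: df dg => [p cp fp] [q cq gq].
exists (fun w => p w * g z + f w * q w).
  by apply: ctsD; apply: ctsM => //; exact: ctsC.
apply: filterS2 fp gq => w fw gw.
have -> : (p w * g z + f w * q w) * (w - z) =
  p w * (w - z) * g z + f w * (q w * (w - z)) by ring.
by rewrite -fw -gw; ring.
Qed.

Lemma cdiffN f z : cdiff f z -> cdiff (fun w => - f w) z.
Proof.
move=> df; apply: cdiff_near (cdiffM _ _ _ (cdiff_cst (-1) z) df).
by near=> w; rewrite mulN1r.
Unshelve. all: by end_near. Qed.

Lemma cdiffB f g z : cdiff f z -> cdiff g z -> cdiff (fun w => f w - g w) z.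
Proof. by move=> df dg; apply: cdiffD => //; exact: cdiffN. Qed.

Lemma cdiff_comp f g z : cdiff f z -> cdiff g (f z) -> cdiff (g \o f) z.
Proof.
move=> df dg; have cf := cdiff_continuous _ _ df.
case: df dg => [p cp fp] [q cq gq]; exists (fun w => q (f w) * p w).
  by apply: ctsM => //; apply: (continuous_comp cf cq).
have gfq : \forall w \near z, g (f w) - g (f z) = q (f w) * (f w - f z).
  exact: (cf _ gq).
by apply: filterS2 fp gfq => w fw /= ->; rewrite fw mulrA.
Qed.

Lemma cdiffV f z : f z != 0 -> cdiff f z -> cdiff (fun w => (f w)^-1) z.
Proof.
move=> fz0 df; have cf := cdiff_continuous _ _ df.
case: df => [p cp fp]; exists (fun w => - p w * (f w)^-1 * (f z)^-1).
  apply: ctsM; last exact: ctsC.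
  by apply: ctsM; [exact: ctsN | exact: ctsV].
have fn0 : \forall w \near z, f w != 0.
  by have /cvgr_neq0 := cf; exact.
apply: filterS2 fp fn0 => w fw fw0.
apply: (mulIf fz0); apply: (mulIf fw0).
rewrite [RHS](_ : _ = - (p w * (w - z)) * ((f w)^-1 * f w) * ((f z)^-1 * f z)); last by ring.
by rewrite !mulVf // -fw !mulr1; field; rewrite fw0 fz0.
Qed.

Lemma cdiff_div f g z : g z != 0 -> cdiff f z -> cdiff g z ->
  cdiff (fun w => f w / g w) z.
Proof. by move=> gz df dg; apply: cdiffM => //; exact: cdiffV. Qed.

End CplxDiff.

(** * Maximum modulus and the lemmas of Schwarz and Schwarz-Pick *)

Section Schwarz.
Context {R : realType}.
Local Notation nm := (@normc R).
Implicit Types (f g h : Cplx R -> Cplx R) (z w : Cplx R).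

Lemma cdiff_cderiv f z : cdiff f z -> exists l, cderiv f z l.
Proof.
move=> [q cq /nbhs_cplxP [d1 d10 H1]]; exists (q z) => e e0.
have /continuous_cplxP /(_ e e0) /nbhs_cplxP [d d0 H] := cq.
exists (Num.min d d1); first by rewrite lt_min d0.
move=> h; rewrite lt_min => /andP[hd hd1].
have e1 : z + h - z = h by rewrite addrC addKr.
have -> : f (z + h) - f z = q (z + h) * h by rewrite H1 e1.
rewrite -mulrBl normcM; apply: ler_wpM2r; first exact: nm_ge0.
by apply: ltW; apply: H; rewrite e1.
Qed.

(** Rotating [z] onto the positive axis reduces the modulus to a real part. The inequality
    [nm c <= 1] leaves room for [c = 0] when [z = 0]. *)
Lemma phase z : exists c : Cplx R, nm c <= 1 /\ complex.Re (c * z) = nm z.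
Proof.
have [->|z0] := eqVneq z 0; first by exists 0; rewrite nm0 mul0r.
exists (conjc z * (nm z)^-1%:C%C).
have n0 : 0 < nm z by rewrite nm_gt0.
rewrite normcM nmJ nmC ger0_norm ?invr_ge0 ?nm_ge0 // mulfV ?gt_eqF //; split; first exact: lexx.
have : nm z * nm z = complex.Re z * complex.Re z + complex.Im z * complex.Im z.
  by have := nm_sq z; rewrite !expr2.
case: z z0 n0 => a b z0 n0; rewrite !ReImE /= => E.
have nn : Num.sqrt (a ^+ 2 + b ^+ 2) != 0 by rewrite gt_eqF.
apply: (mulIf nn); rewrite E; field; exact: nn.
Qed.

(* If Re (c h) + e |z|^2 had an interior maximum z0, then
   c h (z0 + z) + 2 e conj(z0) z would contradict no_quadratic_max. Differentiability
   is not assumed at 0, so that the lemma applies to h z = f z / z. *)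
Lemma max_modulus h (r B : R) : 0 < r ->
  (forall z, nm z <= r -> {for z, continuous h}) ->
  (forall z, 0 < nm z -> nm z < r -> cdiff h z) ->
  (forall z, nm z = r -> nm (h z) <= B) ->
  forall z, nm z <= r -> nm (h z) <= B.
Proof.
move=> r0 ch dh hB z1 z1r; apply/ler_addgt0Pl => e0 e00.
(* With this choice the quadratic term equals [e0] on the circle of radius [r]. *)
pose e := e0 / r ^+ 2.
have r20 : 0 < r ^+ 2 by rewrite exprn_gt0.
have ep : 0 < e by rewrite divr_gt0.
have [c [nc1 cz1]] := phase (h z1).
pose phi z := complex.Re (c * h z) + e * nm z ^+ 2.
have [z0 z0r zmax] : exists2 z0, z0 \in [set z : Cplx R | nm z <= r] &
    forall t, t \in [set z : Cplx R | nm z <= r] -> phi t <= phi z0.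
  apply: compact_EVT_max; [by exists z1 | exact: compact_disc |].
  apply: continuous_in_subspaceT => z; rewrite inE /= => zr.
  have c1 : {for z, continuous (fun z : Cplx R => complex.Re (c * h z) : R)}.
    apply: (continuous_comp (f := fun z => c * h z)).
      by apply: ctsM; [exact: ctsC | exact: ch].
    exact: continuous_Re.
  have c2 : {for z, continuous (fun z : Cplx R => e * nm z ^+ 2 : R)}.
    apply: (@ctsM R _ (fun=> e)); first exact: ctsC.
    by apply: (@ctsM R _ (fun z : Cplx R => nm z) (fun z : Cplx R => nm z)); exact: continuous_nm.
  exact: (@ctsD R _ _ _ _ c1 c2).
rewrite inE /= in z0r.
have phi1 : nm (h z1) <= phi z0.
  apply: le_trans (zmax z1 _); last by rewrite inE.
  by rewrite /phi cz1 lerDl mulr_ge0 ?sqr_ge0 // ltW.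
move: z0r; rewrite le_eqVlt => /orP[/eqP z0r|z0r].
  apply: le_trans phi1 _; rewrite /phi z0r /e divfK ?gt_eqF // addrC lerD2l.
  apply: le_trans (ler_norm _) _; apply: le_trans (Re_nm _) _.
  rewrite normcM; apply: le_trans (hB _ z0r).
  by rewrite ler_piMl ?nm_ge0.
exfalso.
(* The linear term matches the cross term of |z0 + z|^2 = |z0|^2 + 2 Re (conj(z0) z) + |z|^2, so
   maximality of [phi] at [z0] leaves exactly the drop -e |z|^2. *)
pose g z := c * h (z0 + z) + 2 * e%:C%C * conjc z0 * z : Cplx R.
(* The last condition keeps z0 + z away from 0, where [h] may fail to be differentiable. If z0 = 0
   the exceptional point is z = 0, which [no_quadratic_max] exempts as well. *)
have [rho [rho0 rhor rhoz]] : exists rho, [/\ 0 < rho, rho <= r - nm z0 & z0 != 0 -> rho <= nm z0].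
  have [->|z00] := eqVneq z0 0; first by exists r; rewrite nm0 subr0.
  exists (Num.min (r - nm z0) (nm z0)); rewrite lt_min subr_gt0 z0r nm_gt0 z00.
  by split => //; rewrite ge_min lexx ?orbT.
have inr z : nm z < rho -> nm (z0 + z) < r.
  by move=> zr; apply: le_lt_trans (nmD _ _) _; lra.
apply: (@no_quadratic_max R g rho e) => //.
- move=> z z_0 zr; apply: cdiff_cderiv; apply: cdiffD.
    apply: cdiffM; first exact: cdiff_cst.
    apply: (cdiff_comp (fun z => z0 + z) h).
      by apply: cdiffD; [exact: cdiff_cst | exact: cdiff_id].
    apply: dh; last exact: inr.
    rewrite nm_gt0; have [z00|z00] := eqVneq z0 0.
      by rewrite z00 add0r -nm_gt0.
    apply/eqP => /eqP; rewrite addrC addr_eq0 => /eqP zz.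
    by have := rhoz z00; rewrite -nmN -zz leNgt zr.
  by apply: cdiffM; [exact: cdiff_cst | exact: cdiff_id].
- move=> e1 e10.
  have : {for (0 : Cplx R), continuous g}.
    apply: ctsD; apply: ctsM; [exact: ctsC | | exact: ctsC | exact: ctsI].
    apply: (continuous_comp (f := fun z => z0 + z)).
      by apply: ctsD; [exact: ctsC | exact: ctsI].
    by apply: ch; rewrite addr0 ltW.
  move=> /continuous_cplxP /(_ e1 e10) /nbhs_cplxP [d d0 H].
  by exists d => // w wd; apply: ltW; exact: H.
- move=> z zr.
  have := zmax (z0 + z); rewrite inE /= => /(_ (ltW (inr z zr))).
  rewrite /phi /g addr0 mulr0 addr0 => H.
  have -> : complex.Re (c * h (z0 + z) + 2 * e%:C%C * conjc z0 * z) =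
     complex.Re (c * h (z0 + z)) + e * (nm (z0 + z) ^+ 2 - nm z0 ^+ 2 - nm z ^+ 2).
    rewrite cReD; congr (_ + _); rewrite !nm_sq.
    by case: (z0) => a b; case: z {zr H} => a' b' /=; ring.
  lra.
Qed.

Lemma schwarz f z : (forall z, nm z < 1 -> cdiff f z) -> f 0 = 0 ->
  (forall z, nm z < 1 -> nm (f z) <= 1) -> nm z < 1 -> nm (f z) <= nm z.
Proof.
move=> df f0 f1 z1.
have [z00|z0] := eqVneq z 0; first by rewrite z00 f0 lexx.
have [|q cq fq] := df 0; first by rewrite nm0 ltr01.
(* The Caratheodory slope [q 0] is the value that makes f z / z continuous at 0. *)
pose h z := if z == 0 then q 0 else f z / z.
have dh w : 0 < nm w -> nm w < 1 -> cdiff h w.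
  move=> w0 w1; apply: (@cdiff_near _ _ (fun w => f w / w)).
    apply/nbhs_cplxP; exists (nm w) => // u uw; rewrite /h ifN //.
    by apply: contraTneq uw => ->; rewrite sub0r nmN ltxx.
  by apply: cdiff_div; [rewrite -nm_gt0 | exact: df | exact: cdiff_id].
have ch w : nm w < 1 -> {for w, continuous h}.
  move=> w1; have [->|w0] := eqVneq w 0; last first.
    by apply: cdiff_continuous; apply: dh; rewrite ?nm_gt0.
  apply/continuous_cplxP => e e0.
  have /continuous_cplxP /(_ e e0) := cq.
  apply: filterS2 fq => u fu; rewrite {2}/h eqxx /h.
  case: eqP => [->|/eqP u0]; first by rewrite subrr.
  by move: fu; rewrite f0 !subr0 => ->; rewrite mulfK.
have key r : nm z < r -> r < 1 -> nm (h z) <= r^-1.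
  move=> zr r1; have r0 : 0 < r by apply: le_lt_trans (nm_ge0 _) zr.
  apply: (max_modulus h r _ r0 _ _ _ z (ltW zr)).
  - by move=> w wr; apply: ch; exact: le_lt_trans wr r1.
  - by move=> w w0 wr; apply: dh => //; exact: lt_trans wr r1.
  - move=> w wr; rewrite /h ifN -?nm_gt0 ?wr // normcM normcV wr.
    by rewrite ler_piMl ?invr_ge0 ?(ltW r0) // f1 // wr.
have hz : nm (h z) = nm (f z) / nm z by rewrite /h (negPf z0) normcM normcV.
have nz : 0 < nm z by rewrite nm_gt0.
rewrite -[leRHS]mul1r -ler_pdivrMr // -hz leNgt; apply/negP => h1.
(* Any radius below 1 that exceeds both |z| and 1/|h z| contradicts [key]; the midpoints to 1
   provide one. *)
pose r := Num.max ((nm z + 1) / 2) (((nm (h z))^-1 + 1) / 2).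
have hi : (nm (h z))^-1 < 1 by rewrite invf_lt1 //; lra.
have rz : nm z < r by rewrite lt_max; apply/orP; left; lra.
have r1 : r < 1 by rewrite gt_max; apply/andP; split; lra.
have rh : (nm (h z))^-1 < r by rewrite lt_max; apply/orP; right; lra.
have := key r rz r1; rewrite leNgt => /negP; apply.
rewrite -[ltRHS]invrK ltf_pV2 // posrE ?invr_gt0; last by lra.
by lra.
Qed.

(** The automorphism of the disc that takes 0 to [a]; its inverse is [mob (- a)]. *)
Definition mob (a z : Cplx R) : Cplx R := (z + a) / (1 + conjc a * z).

Lemma mob_den (a z : Cplx R) : nm a < 1 -> nm z < 1 -> 1 + conjc a * z != 0.
Proof.
move=> a1 z1; apply/eqP => /eqP; rewrite addr_eq0 => /eqP E.
have : nm (conjc a * z) < 1.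
  by rewrite normcM nmJ mulr_ilt1 ?nm_ge0.
by rewrite -nmN -E nm1 ltxx.
Qed.

Lemma mob_lt1 (a z : Cplx R) : nm a < 1 -> nm z < 1 -> nm (mob a z) < 1.
Proof.
move=> a1 z1; have D0 := mob_den a z a1 z1.
rewrite normcM normcV ltr_pdivrMr ?nm_gt0 // mul1r.
rewrite -(ltr_pXn2r (_ : 0 < 2)%N) ?nnegrE ?nm_ge0 // !nm_sq.
have a2 : nm a ^+ 2 < 1 by rewrite expr_lt1 // nm_ge0.
have z2 : nm z ^+ 2 < 1 by rewrite expr_lt1 // nm_ge0.
rewrite -subr_gt0.
have -> : complex.Re (1 + conjc a * z) ^+ 2 + complex.Im (1 + conjc a * z) ^+ 2
   - (complex.Re (z + a) ^+ 2 + complex.Im (z + a) ^+ 2) =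
   (1 - nm a ^+ 2) * (1 - nm z ^+ 2).
  by rewrite !nm_sq !ReImE; case: (a) => x y; case: (z) => x' y' /=; ring.
by rewrite mulr_gt0 // subr_gt0.
Qed.

Lemma mobN (a b : Cplx R) : nm a < 1 -> nm b < 1 -> mob a (mob (- a) b) = b.
Proof.
move=> a1 b1; have a1' : nm (- a) < 1 by rewrite nmN.
have D1 := mob_den (- a) b a1' b1.
have D2 := mob_den a _ a1 (mob_lt1 _ _ a1' b1).
apply: (mulIf D2); rewrite /mob divfK // ; apply: (mulIf D1).
have cN : conjc (- a) = - conjc a by case: (a).
rewrite cN in D1 *.
by field; exact: D1.
Qed.

Lemma cdiff_mob (a z : Cplx R) : nm a < 1 -> nm z < 1 -> cdiff (mob a) z.
Proof.
move=> a1 z1; apply: cdiff_div; first exact: mob_den.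
- by apply: cdiffD; [exact: cdiff_id | exact: cdiff_cst].
- by apply: cdiffD; [exact: cdiff_cst | apply: cdiffM; [exact: cdiff_cst | exact: cdiff_id]].
Qed.

(** Schwarz's lemma applies to g followed by the Cayley map w -> (w - g 0) / (w + conj (g 0)), which
    takes the right half-plane to the disc and g 0 to 0. The denominator is cleared to keep the
    conclusion polynomial. *)
Lemma schwarz_pick0 g z : (forall z, nm z < 1 -> cdiff g z) ->
  (forall z, nm z < 1 -> 0 < complex.Re (g z)) -> nm z < 1 ->
  nm (g z - g 0) <= nm z * nm (g z + conjc (g 0)).
Proof.
move=> dg g0 z1.
have n01 : nm (0 : Cplx R) < 1 by rewrite nm0.
have den w : nm w < 1 -> g w + conjc (g 0) != 0.
  move=> w1; apply/eqP => /(congr1 (@complex.Re R)); rewrite ReImE /=.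
  by have := g0 w w1; have := g0 0 n01; case: (g 0) => x y /= => ? ? ?; lra.
pose f w := (g w - g 0) / (g w + conjc (g 0)).
have := schwarz f z; rewrite normcM normcV ler_pdivrMr ?nm_gt0 ?den //.
apply=> //.
- move=> w w1; apply: cdiff_div; first exact: den.
  + by apply: cdiffB; [exact: dg | exact: cdiff_cst].
  + by apply: cdiffD; [exact: dg | exact: cdiff_cst].
- by rewrite /f subrr mul0r.
- move=> w w1; rewrite normcM normcV ler_pdivrMr ?nm_gt0 ?den // mul1r.
  rewrite -(ler_pXn2r (_ : 0 < 2)%N) ?nnegrE ?nm_ge0 // !nm_sq -subr_ge0.
  have := g0 w w1; have := g0 0 n01; rewrite !ReImE.
  case: (g 0) => x y; case: (g w) => x' y' /= p p'.
  have -> : (x' + x) ^+ 2 + (y' + - y) ^+ 2 - ((x' - x) ^+ 2 + (y' - y) ^+ 2) = 4 * x * x'.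
    by ring.
  by rewrite !mulr_ge0 // ltW.
Qed.

(* The pseudo-hyperbolic distance, the argument of artanh in poincare. *)
Definition pdist (a b : Cplx R) : R := nm ((a - b) / (1 - a * conjc b)).

Lemma nm_mobN (a b : Cplx R) : nm (mob (- a) b) = pdist a b.
Proof.
rewrite /pdist /mob !normcM !normcV nm_distC; congr (_ / _).
by rewrite -nmJ; congr nm; case: a => ? ?; case: b => ? ? /=; apply/eqP;
  rewrite eq_complex /=; apply/andP; split; apply/eqP; ring.
Qed.

Lemma schwarz_pick g a b : (forall z, nm z < 1 -> cdiff g z) ->
  (forall z, nm z < 1 -> 0 < complex.Re (g z)) -> nm a < 1 -> nm b < 1 ->
  nm (g b - g a) <= pdist a b * nm (g b + conjc (g a)).
Proof.
move=> dg g0 a1 b1.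
have na : nm (- a) < 1 by rewrite nmN.
have z1 := mob_lt1 _ _ na b1.
have := schwarz_pick0 (g \o mob a) (mob (- a) b) _ _ z1.
have m0 : mob a 0 = a by rewrite /mob add0r mulr0 addr0 divr1.
rewrite /= mobN // nm_mobN m0; apply.
- move=> w w1; apply: cdiff_comp; first exact: cdiff_mob.
  by apply: dg; exact: mob_lt1.
- by move=> w w1; apply: g0; exact: mob_lt1.
Qed.

End Schwarz.

(** * Lengths of chains of discs *)

Lemma ler_norm_entry (K : numFieldType) n (v : 'rV[K]_n) i : `|v ord0 i| <= `|v|.
Proof.
rewrite [leRHS]/Num.norm /= mx_normE -[leLHS]nngE num_le.
exact: (le_bigmax _ (fun ij => `|v ij.1 ij.2|%:nng) (ord0, i)).
Qed.

Section VectorNorm.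
Context {R : realType} {d : nat}.
Local Notation nm := (@normc R).
Local Notation V := (Cvec R d).
Implicit Types (u v w : V) (k : Cplx R).

(** The norm of a complex vector is an element of [R[i]] that happens to be real. *)
Definition vnorm v : R := complex.Re `|v|.

Lemma normvC v : `|v| = (vnorm v)%:C%C.
Proof. by rewrite /vnorm RRe_real ?ger0_real. Qed.

Lemma vnorm_ge0 v : 0 <= vnorm v.
Proof. by rewrite -ler0c -normvC. Qed.

Lemma vnormD v w : vnorm (v + w) <= vnorm v + vnorm w.
Proof. by rewrite -lecR rmorphD /= -!normvC; exact: ler_normD. Qed.

Lemma vnormZ k v : vnorm (k *: v) = nm k * vnorm v.
Proof. by apply: complexI; rewrite rmorphM /= -!normvC -normcC; exact: normrZ. Qed.

Lemma vnormN v : vnorm (- v) = vnorm v.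
Proof. by rewrite /vnorm normrN. Qed.

Lemma vnormB v w : vnorm (v - w) <= vnorm v + vnorm w.
Proof. by rewrite -(vnormN w); exact: vnormD. Qed.

Lemma vnorm_distC v w : vnorm (v - w) = vnorm (w - v).
Proof. by rewrite -vnormN opprB. Qed.

Lemma vnorm_distD u v w : vnorm (v - w) <= vnorm (v - u) + vnorm (u - w).
Proof. by apply: le_trans (vnormD _ _); rewrite addrA subrK. Qed.

Lemma vnorm0 : vnorm 0 = 0.
Proof. by rewrite /vnorm normr0. Qed.

Lemma vnorm_eq0 v : vnorm v = 0 -> v = 0.
Proof. by move=> v0; apply/eqP; rewrite -normr_eq0 normvC v0. Qed.

Lemma vnorm_gt0 v : v != 0 -> 0 < vnorm v.
Proof.
by move=> v0; rewrite lt_def vnorm_ge0 andbT; apply: contra_neq v0 => /vnorm_eq0.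
Qed.

Lemma vnorm_le v (e : R) : 0 <= e -> vnorm v <= e <-> forall i, nm (v ord0 i) <= e.
Proof.
move=> e0; split=> [H i|H].
  by apply: le_trans H; rewrite -lecR -normvC -normcC; exact: ler_norm_entry.
rewrite -lecR -normvC [leLHS]/Num.norm /=.
have [->|/mx_norm_neq0 [[i j] ->]] := eqVneq (mx_norm v) 0; first by rewrite ler0c.
by rewrite /= ord1 normcC lecR.
Qed.

Lemma nm_entry v i : nm (v ord0 i) <= vnorm v.
Proof. by have [+ _] := vnorm_le v (vnorm v) (vnorm_ge0 v); apply. Qed.

Lemma nbhs_vecP (x : V) (P : set V) :
  nbhs x P <-> exists2 e : R, 0 < e & forall y, vnorm (y - x) < e -> P y.
Proof.
split=> [/nbhs_normP[e /= e0 H]|[e e0 H]].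
  have ee : e = (nm e)%:C%C by rewrite -normcC gtr0_norm.
  exists (nm e); first by rewrite nm_gt0 gt_eqF.
  move=> y yx; apply: H; rewrite /= distrC normvC ee ltcR.
  exact: yx.
apply/(@nbhs_normP _ V); exists e%:C%C; first by rewrite /= ltcR.
by move=> y; rewrite /= distrC normvC ltcR; exact: H.
Qed.

Lemma open_vecP (O : set V) : open O <->
  forall x, O x -> exists2 e : R, 0 < e & forall y, vnorm (y - x) < e -> O y.
Proof.
rewrite openE; split=> [H x /H /nbhs_vecP //|H x /H Hx].
exact/nbhs_vecP.
Qed.

Lemma closure_vecP (O : set V) (x : V) : closure O x <->
  forall e : R, 0 < e -> exists2 y, O y & vnorm (y - x) < e.
Proof.
split=> [H e e0|H P /nbhs_vecP[e e0 He]].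
  have [|y [Oy yx]] := H [set y | vnorm (y - x) < e].
    by apply/nbhs_vecP; exists e.
  by exists y.
by have [y Oy yx] := H e e0; exists y; split => //; exact: He.
Qed.

Definition app (a : 'cV[Cplx R]_d) v : Cplx R := (v *m a) ord0 ord0.

Lemma appD a v w : app a (v + w) = app a v + app a w.
Proof. by rewrite /app mulmxDl mxE. Qed.

Lemma appN a v : app a (- v) = - app a v.
Proof. by rewrite /app mulNmx mxE. Qed.

Lemma appB a v w : app a (v - w) = app a v - app a w.
Proof. by rewrite appD appN. Qed.

Lemma appZ a k v : app a (k *: v) = k * app a v.
Proof. by rewrite /app -scalemxAl mxE. Qed.

Lemma app0 a : app a 0 = 0.
Proof. by rewrite /app mul0mx mxE. Qed.

Lemma nm_sum (I : finType) (F : I -> R[i]) : nm (\sum_i F i) <= \sum_i nm (F i).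
Proof.
elim/big_ind2: _ => [||//]; first by rewrite nm0.
by move=> x1 x2 y1 y2 h1 h2; apply: le_trans (nmD _ _) _; exact: lerD.
Qed.

Lemma nm_app a v : nm (app a v) <= (\sum_i nm (a i ord0)) * vnorm v.
Proof.
rewrite /app mxE; apply: le_trans (nm_sum _ _) _; rewrite mulr_suml; apply: ler_sum => i _.
by rewrite normcM mulrC; apply: ler_wpM2l; [exact: nm_ge0 | exact: nm_entry].
Qed.

(** The slope [q] is the difference quotient completed at [z] by [app a l]; it is continuous there
    because [app a] is Lipschitz with constant [S]. The constant [c] lets a supporting functional
    vanish at its boundary point. *)
Lemma derivable_app_cdiff (phi : Cplx R -> V) a (c z : Cplx R) : derivable phi z 1 ->
  @cdiff R[i] (fun w : Cplx R => app a (phi w) + c) z.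
Proof.
move=> dphi; set l := 'D_1 phi z.
have Hl : (h : Cplx R)^-1 *: (phi (h *: (1 : Cplx R) + z) - phi z) @[h --> (0 : Cplx R)^'] --> l by exact: dphi.
pose S := \sum_i nm (a i ord0).
have S0 : 0 <= S by apply: sumr_ge0 => i _; exact: nm_ge0.
pose q (w : Cplx R) : Cplx R := if w == z then app a l else (app a (phi w) - app a (phi z)) / (w - z).
exists q; last first.
  near=> w; rewrite /q; case: eqP => [->|/eqP wz]; first by rewrite !subrr mulr0.
  by rewrite divfK ?subr_eq0 //; ring.
apply/continuous_cplxP => e e0.
have S1 : 0 < S + 1 by rewrite ltr_wpDl.
have eS : 0 < e / (S + 1) by rewrite divr_gt0.
have : \forall h \near (0 : Cplx R)^', vnorm (h^-1 *: (phi (h *: (1 : Cplx R) + z) - phi z) - l) < e / (S + 1).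
  by apply: (Hl [set v | vnorm (v - l) < e / (S + 1)]); apply/nbhs_vecP; exists (e / (S + 1)).
move=> /nbhs_cplxP [D D0 HD]; apply/nbhs_cplxP; exists D => // w wz.
rewrite /q eqxx; case: eqP => [_|/eqP wz0]; first by rewrite subrr nm0.
have := HD (w - z); rewrite subr0 => /(_ wz); rewrite subr_eq0 => /(_ wz0).
have -> : (w - z) *: (1 : Cplx R) + z = w by rewrite /GRing.scale /= mulr1 subrK.
set v := _ *: _ => H.
have -> : (app a (phi w) - app a (phi z)) / (w - z) - app a l = app a (v - l).
  by rewrite appB /v appZ appB mulrC.
apply: le_lt_trans (nm_app _ _) _; rewrite -/S.
apply: (@le_lt_trans _ _ (S * (e / (S + 1)))); first by apply: ler_wpM2l => //; exact: ltW.
by rewrite mulrCA -[ltRHS]mulr1 ltr_pM2l // ltr_pdivrMr //; lra.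
Unshelve. all: by end_near. Qed.

End VectorNorm.

(** * Chains of discs and half-plane-valued functionals along them *)

Section Chains.
Context {R : realType} {d : nat}.
Local Notation nm := (@normc R).
Local Notation V := (Cvec R d).
Implicit Types (p q r : V) (Omega : set V) (L : R).

Lemma unit_disc_nm (z : Cplx R) : unit_disc z <-> nm z < 1.
Proof. by rewrite /unit_disc /= normcC ltcR. Qed.

Lemma poincareE (a b : Cplx R) :
  poincare a b = ln ((1 + pdist a b) / (1 - pdist a b)) / 2.
Proof. by rewrite /poincare Re_norm. Qed.

Lemma pdist_ge0 (a b : Cplx R) : 0 <= pdist a b.
Proof. exact: nm_ge0. Qed.

Lemma pdist_lt1 (a b : Cplx R) : nm a < 1 -> nm b < 1 -> pdist a b < 1.
Proof. by move=> a1 b1; rewrite -nm_mobN mob_lt1 ?nmN. Qed.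

Lemma pdistC (a b : Cplx R) : pdist a b = pdist b a.
Proof.
rewrite /pdist !normcM !normcV nm_distC; congr (_ / _); rewrite -nmJ; congr nm.
by case: a => ? ?; case: b => ? ? /=; apply/eqP; rewrite eq_complex /=; apply/andP;
  split; apply/eqP; ring.
Qed.

Lemma poincareC (a b : Cplx R) : poincare a b = poincare b a.
Proof. by rewrite !poincareE pdistC. Qed.

Lemma expR_poincare (a b : Cplx R) : nm a < 1 -> nm b < 1 ->
  expR (2 * poincare a b) = (1 + pdist a b) / (1 - pdist a b).
Proof.
move=> a1 b1; have t1 := pdist_lt1 a b a1 b1; have t0 := pdist_ge0 a b.
rewrite poincareE mulrC divfK ?pnatr_eq0 // lnK // posrE divr_gt0; lra.
Qed.

Lemma pdist_le_poincare (a b : Cplx R) : nm a < 1 -> nm b < 1 ->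
  pdist a b <= 2 * poincare a b.
Proof.
move=> a1 b1; have t1 := pdist_lt1 a b a1 b1; have t0 := pdist_ge0 a b.
rewrite -ler_expR expR_poincare //; set t := pdist a b in t0 t1 *.
rewrite ler_pdivlMr; last by lra.
apply: (@le_trans _ _ 1); last by lra.
have : 1 + (- t) <= expR (- t) by exact: expR_ge1Dx.
rewrite -(ler_pM2l (expR_gt0 t)) -expRD subrr expR0; exact.
Qed.

Lemma poincare_ge0 (a b : Cplx R) : nm a < 1 -> nm b < 1 -> 0 <= poincare a b.
Proof.
by move=> a1 b1; have := pdist_le_poincare a b a1 b1; have := pdist_ge0 a b; lra.
Qed.

(** The triangle inequality turns Schwarz-Pick into |g b| - |g a| <= t (|g b| + |g a|). The
    resulting factor is the exponential of twice the Poincare distance, so these bounds multiply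
    along a chain. *)
Lemma harnack_modulus (g : Cplx R -> Cplx R) (a b : Cplx R) :
  (forall z, nm z < 1 -> cdiff g z) ->
  (forall z, nm z < 1 -> 0 < complex.Re (g z)) -> nm a < 1 -> nm b < 1 ->
  nm (g b) <= nm (g a) * ((1 + pdist a b) / (1 - pdist a b)).
Proof.
move=> dg g0 a1 b1; have := schwarz_pick g a b dg g0 a1 b1.
have t1 := pdist_lt1 a b a1 b1; have t0 := pdist_ge0 a b.
set t := pdist a b in t0 t1 *.
have h1 : nm (g b) - nm (g a) <= nm (g b - g a).
  by have := nmD (g b - g a) (g a); rewrite subrK; lra.
have := nmD (g b) (conjc (g a)); rewrite nmJ => h2 h3.
have h4 := ler_wpM2l t0 h2.
rewrite mulrA ler_pdivlMr; last by lra.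
nra.
Qed.

Lemma nm_real_smul (s : R) (z : Cplx R) : nm (s%:C%C * z) = `|s| * nm z.
Proof. by rewrite normcM nmC. Qed.

(* On the geodesic from a to b some point has |G1| = c < |G2|, and the Poincare
   distances from it to a and b add up to that of a and b. *)
Lemma disc_crossing (G1 G2 : Cplx R -> Cplx R) (c : R) (a b : Cplx R) :
  (forall z, nm z < 1 -> cdiff G1 z) -> (forall z, nm z < 1 -> cdiff G2 z) ->
  (forall z, nm z < 1 -> 0 < complex.Re (G1 z)) ->
  (forall z, nm z < 1 -> 0 < complex.Re (G2 z)) ->
  (forall z, nm z < 1 -> c < nm (G1 z) \/ c < nm (G2 z)) ->
  nm a < 1 -> nm b < 1 -> 0 < c -> nm (G1 a) <= c -> c < nm (G1 b) ->
  c ^+ 2 <= nm (G1 a) * nm (G2 b) * expR (2 * poincare a b).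
Proof.
move=> dG1 dG2 p1 p2 alt a1 b1 c0 ac cb.
have na : nm (- a) < 1 by rewrite nmN.
set z1 := mob (- a) b; have z11 : nm z1 < 1 by exact: mob_lt1.
have m0 : mob a 0 = a by rewrite /mob add0r mulr0 addr0 divr1.
have m1 : mob a z1 = b by exact: mobN.
pose H1 := G1 \o mob a; pose H2 := G2 \o mob a.
have dH1 z : nm z < 1 -> cdiff H1 z.
  by move=> zl; apply: cdiff_comp; [exact: cdiff_mob | apply: dG1; exact: mob_lt1].
have dH2 z : nm z < 1 -> cdiff H2 z.
  by move=> zl; apply: cdiff_comp; [exact: cdiff_mob | apply: dG2; exact: mob_lt1].
have pH1 z : nm z < 1 -> 0 < complex.Re (H1 z) by move=> zl; apply: p1; exact: mob_lt1.
have pH2 z : nm z < 1 -> 0 < complex.Re (H2 z) by move=> zl; apply: p2; exact: mob_lt1.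
have sz s : 0 <= s <= 1 -> nm (s%:C%C * z1) < 1.
  move=> /andP[s0 s1]; rewrite nm_real_smul ger0_norm //; apply: le_lt_trans z11.
  by rewrite ler_piMl ?nm_ge0.
pose F (s : R) := nm (H1 (s%:C%C * z1)).
have cF : {within `[0, 1], continuous F}.
  apply: continuous_in_subspaceT => s; rewrite inE /= in_itv /= => s01.
  apply: (continuous_comp (f := fun s : R => H1 (s%:C%C * z1) : Cplx R)); last exact: continuous_nm.
  apply: (continuous_comp (f := fun s : R => s%:C%C * z1 : Cplx R)).
    apply/continuous_cplxP => e e0.
    have K0 : 0 < nm z1 + 1 by rewrite ltr_wpDl // nm_ge0.
    have eK : 0 < e / (nm z1 + 1) by rewrite divr_gt0.
    have := near_dist_lt s _ eK; apply: filterS => y ys.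
    rewrite -mulrBl -rmorphB nm_real_smul; move: ys; rewrite ltr_pdivlMr //.
    by apply: le_lt_trans; apply: ler_wpM2l => //; rewrite lerDl.
  exact: (cdiff_continuous _ _ (dH1 _ (sz _ s01))).
have F0 : F 0 = nm (G1 a) by rewrite /F /H1 /= mul0r m0.
have F1 : F 1 = nm (G1 b) by rewrite /F /H1 /= mul1r m1.
(* After [mob a] the geodesic is the radius from 0 to [z1], and |H1| takes the value [c] on it. *)
have [||s s01 Fs] := IVT (v := c) _ cF; first exact: ler01.
  by rewrite F0 F1 ge_min le_max ac (ltW cb) orbT.
rewrite in_itv /= in s01; have szl := sz _ s01.
have [s0 s1] : 0 <= s /\ s <= 1 by case/andP: s01.
set r := nm z1; have r0 : 0 <= r by exact: nm_ge0.
have r1 : r < 1 by [].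
have rE : r = pdist a b by rewrite /r /z1 nm_mobN.
have nm0' : nm (0 : Cplx R) < 1 by rewrite nm0.
have E1 : pdist 0 (s%:C%C * z1) = s * r.
  by rewrite /pdist mul0r subr0 divr1 sub0r nmN nm_real_smul ger0_norm.
have sr2 : 0 < 1 - s * r ^+ 2.
  by rewrite subr_gt0; apply: (@le_lt_trans _ _ (1 * r ^+ 2));
    [apply: ler_wpM2r => //; exact: sqr_ge0 | rewrite mul1r expr_lt1].
have E2 : pdist z1 (s%:C%C * z1) = (1 - s) * r / (1 - s * r ^+ 2).
  rewrite /pdist normcM normcV; congr (_ / _).
    have -> : z1 - s%:C%C * z1 = (1 - s)%:C%C * z1 by rewrite rmorphB rmorph1 mulrBl mul1r.
    by rewrite nm_real_smul ger0_norm // subr_ge0.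
  have -> : 1 - z1 * conjc (s%:C%C * z1) = (1 - s * r ^+ 2)%:C%C.
    rewrite /r nm_sq; case: (z1) => x y; apply/eqP; rewrite eq_complex /=.
    by apply/andP; split; apply/eqP; ring.
  by rewrite nmC ger0_norm // ltW.
have := harnack_modulus H1 0 _ dH1 pH1 nm0' szl.
rewrite E1 -/(F s) Fs {1}/H1 /= m0 => h1.
have := harnack_modulus H2 _ _ dH2 pH2 szl z11 .
have := harnack_modulus H2 _ _ dH2 pH2 z11 szl.
rewrite E2 {2}/H2 /= m1 => h2 _.
(* At the crossing point |H1| is exactly [c], so the alternative forces |H2| above [c]. *)
have c2 : c <= nm (H2 (s%:C%C * z1)).
  by have [|/ltW //] := alt _ (mob_lt1 _ _ a1 szl); rewrite -[nm _]/(F s) Fs ltxx.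
have h3 := le_trans c2 h2.
rewrite expR_poincare // -rE.
have sr : s * r < 1 by apply: le_lt_trans r1; rewrite ler_piMl.
have srr : 0 < 1 - s * r ^+ 2 - (1 - s) * r.
  have -> : 1 - s * r ^+ 2 - (1 - s) * r = (1 - r) * (1 + s * r) by ring.
  by rewrite mulr_gt0 ?subr_gt0 // ltr_pwDl // mulr_ge0.
(* The two Harnack factors, for s r and (1 - s) r / (1 - s r^2), multiply to (1 + r) / (1 - r): this
   is the additivity of the Poincare distance along the radius. *)
rewrite expr2; apply: le_trans (ler_pM (ltW c0) (ltW c0) h1 h3) _.
rewrite le_eqVlt; apply/orP; left; apply/eqP.
field.
by rewrite !gt_eqF // ?subr_gt0 //; apply: ltr_pwDl => //; exact: mulr_ge0.
Qed.

(** Endpoints are written as values of the discs, so that induction carries no equations. The empty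
    chain exists at every point, also outside [Omega], which is why [chain_crossing] asks for
    [Omega q]. *)
Inductive chain Omega : V -> V -> R -> Prop :=
| chain_nil p : chain Omega p p 0
| chain_cons phi (a b : Cplx R) q L : holomorphic_disc Omega phi ->
    nm a < 1 -> nm b < 1 -> chain Omega (phi b) q L ->
    chain Omega (phi a) q (poincare a b + L).

Lemma disc_chain_lengthP Omega p q L : disc_chain_length Omega p q L <-> chain Omega p q L.
Proof.
split.
  move=> [n [x [phi [a [b [xp xq H ->]]]]]].
  elim: n p x phi a b xp xq H => [|n IH] p x phi a b xp xq H.
    by rewrite big_ord0 -xp -xq; exact: chain_nil.
  have [hphi a1 b1 pa pb] := H 0%N isT.
  rewrite big_ord_recl /= -xp -pa; apply: chain_cons => //; try exact/unit_disc_nm.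
  apply: (IH _ (fun i => x i.+1) (fun i => phi i.+1) (fun i => a i.+1) (fun i => b i.+1)) => //.
  by move=> i in'; exact: H.
elim=> [{}p|phi a b {}q {}L hphi a1 b1 _ [n [x [psi [a' [b' [xp xq H ->]]]]]]].
  exists 0%N, (fun=> p), (fun _ _ => p), (fun=> 0), (fun=> 0).
  by split => //; rewrite big_ord0.
exists n.+1, (fun i => if i is j.+1 then x j else phi a),
  (fun i => if i is j.+1 then psi j else phi),
  (fun i => if i is j.+1 then a' j else a), (fun i => if i is j.+1 then b' j else b).
split => //; last by rewrite big_ord_recl.
move=> [_|i]; last exact: H.
by split=> //; exact/unit_disc_nm.
Qed.

Lemma chain_cat Omega p q r L L' :
  chain Omega p q L -> chain Omega q r L' -> chain Omega p r (L + L').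
Proof.
elim=> [{}p|phi a b {}q {}L hphi a1 b1 _ IH] Hq; first by rewrite add0r.
by rewrite -addrA; apply: chain_cons => //; exact: IH.
Qed.

Lemma chain_sym Omega p q L : chain Omega p q L -> chain Omega q p L.
Proof.
elim=> [{}p|phi a b {}q {}L hphi a1 b1 _ IH]; first exact: chain_nil.
rewrite addrC; apply: chain_cat IH _; rewrite -[poincare a b]addr0 poincareC.
by apply: chain_cons => //; exact: chain_nil.
Qed.

Lemma chain_length_ge0 Omega p q L : chain Omega p q L -> 0 <= L.
Proof.
elim=> [//|phi a b {}q {}L hphi a1 b1 _ IH]; apply: addr_ge0 => //.
exact: poincare_ge0.
Qed.

Lemma holomorphic_disc_app Omega phi (u : 'cV[Cplx R]_d) (k : Cplx R) :
  holomorphic_disc Omega phi -> forall z, nm z < 1 ->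
  @cdiff R[i] (fun w : Cplx R => app u (phi w) + k) z.
Proof.
by move=> [hphi _] z z1; apply: derivable_app_cdiff; apply: hphi; exact/unit_disc_nm.
Qed.

Lemma holomorphic_disc_mem Omega phi z : holomorphic_disc Omega phi -> nm z < 1 -> Omega (phi z).
Proof. by move=> [_ hphi] z1; apply: hphi; exact/unit_disc_nm. Qed.

Lemma chain_modulus Omega (u : 'cV[Cplx R]_d) (k : Cplx R) p q L :
  (forall v, Omega v -> 0 < complex.Re (app u v + k)) -> chain Omega p q L ->
  nm (app u q + k) <= nm (app u p + k) * expR (2 * L).
Proof.
move=> pos; elim=> [{}p|phi a b {}q {}L hphi a1 b1 _ IH].
  by rewrite mulr0 expR0 mulr1.
rewrite mulrDr expRD mulrA; apply: le_trans IH _; apply: ler_wpM2r; first exact: expR_ge0.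
rewrite expR_poincare //.
apply: (harnack_modulus (fun w => app u (phi w) + k)) => //.
  exact: (holomorphic_disc_app _ _ _ _ hphi).
by move=> z z1; apply: pos; exact: (holomorphic_disc_mem _ _ _ hphi).
Qed.

(** In Schwarz-Pick the factor |g b + conj (g a)| is at most 2B and [pdist] is at most twice
    [poincare], whence 4B. Applied to shifted coordinates, this bounds the norm by the length of a
    chain. *)
Lemma chain_lipschitz Omega (u : 'cV[Cplx R]_d) (k : Cplx R) (B : R) p q L :
  (forall v, Omega v -> 0 < complex.Re (app u v + k)) ->
  (forall v, Omega v -> nm (app u v + k) <= B) -> chain Omega p q L ->
  nm (app u q - app u p) <= 4 * B * L.
Proof.
move=> pos bd; elim=> [{}p|phi a b {}q {}L hphi a1 b1 _ IH].
  by rewrite subrr nm0 mulr0.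
have Oa := holomorphic_disc_mem _ _ _ hphi a1.
have Ob := holomorphic_disc_mem _ _ _ hphi b1.
have := schwarz_pick (fun w => app u (phi w) + k) a b
  (holomorphic_disc_app _ _ _ _ hphi) (fun z z1 => pos _ (holomorphic_disc_mem _ _ _ hphi z1)) a1 b1.
have -> : app u (phi b) + k - (app u (phi a) + k) = app u (phi b) - app u (phi a) by ring.
move=> h1.
have B0 : 0 <= B by apply: le_trans (bd _ Oa); exact: nm_ge0.
have h2 : nm (app u (phi b) + k + conjc (app u (phi a) + k)) <= B + B.
  by apply: le_trans (nmD _ _) _; rewrite nmJ; apply: lerD; exact: bd.
have h3 : nm (app u (phi b) - app u (phi a)) <= 2 * poincare a b * (B + B).
  apply: le_trans h1 _; apply: ler_pM => //; [exact: pdist_ge0 | exact: nm_ge0 |].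
  exact: pdist_le_poincare.
have -> : app u q - app u (phi a) = (app u q - app u (phi b)) + (app u (phi b) - app u (phi a)) by ring.
apply: le_trans (nmD _ _) _; apply: le_trans (lerD IH h3) _.
by rewrite le_eqVlt; apply/orP; left; apply/eqP; ring.
Qed.

(** The chain is followed up to the first disc whose far end has first modulus above [c]. Before it
    the first functional obeys [chain_modulus], on it [disc_crossing] exchanges the functionals, and
    after it the second obeys [chain_modulus] on the reversed chain. Without such a disc both moduli
    would be at most [c] at [q]. *)
Lemma chain_crossing Omega (u1 u2 : 'cV[Cplx R]_d) (k1 k2 : Cplx R) (c : R) p q L :
  (forall v, Omega v -> 0 < complex.Re (app u1 v + k1)) ->
  (forall v, Omega v -> 0 < complex.Re (app u2 v + k2)) ->
  (forall v, Omega v -> c < nm (app u1 v + k1) \/ c < nm (app u2 v + k2)) ->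
  0 < c -> chain Omega p q L -> Omega q ->
  nm (app u1 p + k1) <= c -> nm (app u2 q + k2) <= c ->
  c ^+ 2 <= nm (app u1 p + k1) * nm (app u2 q + k2) * expR (2 * L).
Proof.
move=> pos1 pos2 alt c0; elim=> [{}p Op p1 p2|phi a b {}q {}L hphi a1 b1 Hc IH Oq pc qc].
  by case: (alt _ Op); rewrite ltNge ?p1 ?p2.
rewrite mulrDr expRD.
have [bc|bc] := leP (nm (app u1 (phi b) + k1)) c.
  apply: le_trans (IH Oq bc qc) _.
  have := chain_modulus Omega u1 k1 (phi a) (phi b) (poincare a b) pos1.
  rewrite -{1}[poincare a b]addr0 => /(_ _) h.
  have {}h := h (chain_cons _ _ _ _ _ _ hphi a1 b1 (chain_nil _ _)).
  rewrite [leRHS](_ : _ = nm (app u1 (phi a) + k1) * expR (2 * poincare a b) *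
    (nm (app u2 q + k2) * expR (2 * L))); last by ring.
  by rewrite -[leLHS]mulrA; apply: ler_wpM2r h; rewrite mulr_ge0 ?nm_ge0 ?expR_ge0.
have h1 := disc_crossing (fun w => app u1 (phi w) + k1) (fun w => app u2 (phi w) + k2) c a b
  (holomorphic_disc_app _ _ _ _ hphi) (holomorphic_disc_app _ _ _ _ hphi)
  (fun z z1 => pos1 _ (holomorphic_disc_mem _ _ _ hphi z1))
  (fun z z1 => pos2 _ (holomorphic_disc_mem _ _ _ hphi z1))
  (fun z z1 => alt _ (holomorphic_disc_mem _ _ _ hphi z1)) a1 b1 c0 pc bc.
have h2 := chain_modulus Omega u2 k2 _ _ _ pos2 (chain_sym _ _ _ _ Hc).
apply: le_trans h1 _.
rewrite [leRHS](_ : _ = nm (app u1 (phi a) + k1) * expR (2 * poincare a b) *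
  (nm (app u2 q + k2) * expR (2 * L))); last by ring.
by rewrite mulrAC; apply: ler_wpM2l h2; rewrite mulr_ge0 ?nm_ge0 ?expR_ge0.
Qed.

End Chains.

(** * Convex domains with C^{1,alpha} boundary *)

Section ConvexDomains.
Context {R : realType} {d : nat}.
Local Notation nm := (@normc R).
Local Notation V := (Cvec R d).
Implicit Types (p q o x y z v w h : V) (Omega : set V) (s t : R).

Lemma vnorm_rscale t v : vnorm (t%:C%C *: v) = `|t| * vnorm v.
Proof. by rewrite vnormZ nmC. Qed.

Lemma convex_segment Omega p q t : convex_set Omega -> Omega p -> Omega q ->
  0 <= t <= 1 -> Omega ((1 - t)%:C%C *: p + t%:C%C *: q).
Proof.
move=> cO Op Oq /andP[t0 t1].
have l0 : 0 <= ((1 - t)%:C%C : R[i]) by rewrite ler0c subr_ge0.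
have l1 : ((1 - t)%:C%C : R[i]) <= 1 by rewrite -(rmorph1 (real_complex R)) lecR; lra.
have := cO p q (Itv01 l0 l1); rewrite !inE => /(_ Op Oq).
rewrite /conv /= [X in _ + X *: q](_ : _ = t%:C%C) //.
by rewrite -[LHS]/(1 - (1 - t)%:C%C) rmorphB rmorph1; ring.
Qed.

Lemma bounded_vnorm Omega : bounded_set Omega ->
  exists2 D, 0 < D & forall v, Omega v -> vnorm v <= D.
Proof.
move=> [M [Mr HM]]; exists (nm M + 1); first by rewrite ltr_wpDl // nm_ge0.
move=> v Ov; rewrite -lecR -normvC; apply: HM => //.
have -> : M = (complex.Re M)%:C%C by rewrite RRe_real.
by rewrite ltcR nmC; apply: le_lt_trans (ler_norm _) _; rewrite ltrDl.
Qed.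

(** The cone with apex [x] over a ball inside a convex set is inside, even for an apex in the
    closure: [x] is replaced by a point [y] of [Omega] so close that the slack
    [t * D - vnorm (v - u)] pays for it. *)
Lemma convex_ball_closure Omega x z t (D : R) : convex_set Omega -> closure Omega x ->
  (forall v, vnorm (v - z) < D -> Omega v) -> 0 < t <= 1 ->
  forall v, vnorm (v - (x + t%:C%C *: (z - x))) < t * D -> Omega v.
Proof.
move=> cO /closure_vecP clx bz /andP[t0 t1] v; set u := x + _ => vu.
have e0 : 0 < t * D - vnorm (v - u) by rewrite subr_gt0.
have [y Oy yx] := clx _ e0.
have tn : t%:C%C != 0 :> R[i] by rewrite -nm_eq0 nmC gt_eqF // normr_gt0 gt_eqF.
(* Solves v = (1 - t) y + t w for [w]. *)
pose w := z + t^-1%:C%C *: ((v - u) + (1 - t)%:C%C *: (x - y)).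
have Ow : Omega w.
  apply: bz; rewrite /w addrAC subrr add0r vnorm_rscale ger0_norm ?invr_ge0 ?(ltW t0) //.
  rewrite mulrC ltr_pdivrMr // [D * t]mulrC.
  apply: le_lt_trans (vnormD _ _) _; rewrite vnorm_rscale ger0_norm ?subr_ge0 //.
  have : (1 - t) * vnorm (x - y) <= vnorm (x - y).
    by rewrite ler_piMl ?vnorm_ge0 // gerBl ltW.
  by rewrite (vnorm_distC x y); lra.
have -> : v = (1 - t)%:C%C *: y + t%:C%C *: w.
  rewrite /w scalerDr scalerA -rmorphM mulfV ?gt_eqF // rmorph1 scale1r /u.
  by rewrite rmorphB rmorph1; apply/rowP => i; rewrite !mxE; ring.
by apply: convex_segment => //; rewrite (ltW t0).
Qed.

Lemma convex_ball_segment Omega p q s (D : R) : convex_set Omega ->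
  (forall v, vnorm (v - p) < D -> Omega v) -> (forall v, vnorm (v - q) < D -> Omega v) ->
  0 <= s <= 1 ->
  forall v, vnorm (v - (p + s%:C%C *: (q - p))) < D -> Omega v.
Proof.
move=> cO bp bq s01 v; set u := p + _ => vu.
have -> : v = (1 - s)%:C%C *: (p + (v - u)) + s%:C%C *: (q + (v - u)).
  by rewrite /u rmorphB rmorph1; apply/rowP => i; rewrite !mxE; ring.
by apply: convex_segment => //; [apply: bp | apply: bq]; rewrite addrAC subrr add0r.
Qed.

Lemma derivable_affine x h (z : Cplx R) : derivable (fun w : Cplx R => x + w *: h) z 1.
Proof.
apply: (@is_cvg_near_cst _ _ h).
have : \forall k \near (0 : Cplx R)^', k != 0 by exact: nbhs_dnbhs_neq.
apply: filterS => k k0.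
have -> : x + (k *: (1 : Cplx R) + z) *: h - (x + z *: h) = k *: h.
  rewrite [k *: 1](_ : _ = k); last by rewrite /GRing.scale /= mulr1.
  by apply/rowP => i; rewrite !mxE; ring.
by rewrite scalerA mulVf // scale1r.
Qed.

Lemma holomorphic_affine Omega x h :
  (forall z : Cplx R, nm z < 1 -> Omega (x + z *: h)) ->
  holomorphic_disc Omega (fun z : Cplx R => x + z *: h).
Proof.
move=> H; split=> [z _|z /unit_disc_nm z1]; last exact: H.
exact: derivable_affine.
Qed.

(** Bounds the cost of moving from the centre of a ball by at most half of its radius. *)
Definition half_step : R := poincare 0 (2^-1)%:C%C.

Lemma half_step_ge0 : 0 <= half_step.
Proof.
by apply: poincare_ge0; rewrite ?nm0 // nmC ger0_norm ?invr_ge0 // invf_lt1 // ltr1n.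
Qed.

Lemma chain_half_step Omega x h (D : R) : 0 < D ->
  (forall v, vnorm (v - x) < D -> Omega v) -> vnorm h <= D / 2 ->
  chain Omega x (x + h) half_step.
Proof.
move=> D0 bx hD.
have hd : holomorphic_disc Omega (fun z : Cplx R => x + z *: (2%:C%C *: h)).
  apply: holomorphic_affine => z z1; apply: bx.
  rewrite addrAC subrr add0r vnormZ vnorm_rscale ger0_norm //.
  have [->|n0] := eqVneq (vnorm h) 0; first by rewrite !mulr0.
  have hp : 0 < vnorm h by rewrite lt_def n0 vnorm_ge0.
  have : nm z * (2 * vnorm h) < 1 * (2 * vnorm h) by rewrite ltr_pM2r // mulr_gt0.
  lra.
have n2 : nm (2^-1)%:C%C < 1.
  by rewrite nmC ger0_norm ?invr_ge0 // invf_lt1 // ltr1n.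
have n0 : nm (0 : Cplx R) < 1 by rewrite nm0.
have := chain_cons _ _ 0 (2^-1)%:C%C _ 0 hd n0 n2 (chain_nil _ _).
rewrite scale0r !addr0 scalerA -rmorphM mulVf ?pnatr_eq0 // rmorph1 scale1r.
exact.
Qed.

(** The cost depends only on the ratio of the distance to the radius. Near the boundary both are
    proportional to the depth, so the bound is uniform there. *)
Lemma chain_between_balls Omega p q (D : R) (m : nat) : convex_set Omega -> 0 < D ->
  (forall v, vnorm (v - p) < D -> Omega v) -> (forall v, vnorm (v - q) < D -> Omega v) ->
  vnorm (q - p) <= m%:R * D -> chain Omega p q ((2 * m)%N.+1%:R * half_step).
Proof.
(* With 2m + 1 equal steps each has length at most D/2, and the number of steps is positive also for
   m = 0. *)
move=> cO D0 bp bq qp; set M := (2 * m)%N.+1.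
have M0 : 0 < M%:R :> R by rewrite ltr0n.
have Mn : M%:R != 0 :> R by rewrite gt_eqF.
pose x (k : nat) := p + (k%:R / M%:R)%:C%C *: (q - p).
have K k : (k <= M)%N -> chain Omega p (x k) (k%:R * half_step).
  elim: k => [_|k IH kM].
    by rewrite /x !mul0r rmorph0 scale0r addr0; exact: chain_nil.
  rewrite -natr1 mulrDl mul1r; apply: chain_cat (IH (ltnW kM)) _.
  have -> : x k.+1 = x k + (M%:R^-1)%:C%C *: (q - p).
    by rewrite /x -natr1 mulrDl mul1r rmorphD scalerDl addrA.
  apply: (chain_half_step _ _ _ D) => //.
    apply: convex_ball_segment => //.
    by rewrite divr_ge0 ?ler0n // ler_pdivrMr // mul1r ler_nat ltnW.
  rewrite vnorm_rscale ger0_norm ?invr_ge0 ?ler0n // mulrC ler_pdivrMr //.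
  apply: le_trans qp _; have -> : M%:R = 2 * m%:R + 1 :> R by rewrite /M -natr1 natrM.
  by have := ltW D0; nra.
have := K M (leqnn M); rewrite /x divff // rmorph1 scale1r addrC subrK; exact.
Qed.

Lemma boundaryP Omega x : open Omega ->
  boundary Omega x <-> closure Omega x /\ ~ Omega x.
Proof. by rewrite /boundary => /interior_id ->. Qed.

Lemma radial_boundary_point Omega o p : open Omega -> bounded_set Omega ->
  Omega o -> Omega p -> p != o ->
  exists x t, [/\ boundary Omega x, 0 < t <= 1 & p = x + t%:C%C *: (o - x)].
Proof.
move=> oO /bounded_vnorm[D D0 bD] Oo Op po.
have n0 : 0 < vnorm (p - o) by apply: vnorm_gt0; rewrite subr_eq0.
pose g s := o + s%:C%C *: (p - o).
pose S := [set s : R | 0 <= s /\ Omega (g s)].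
have g1 : g 1 = p by rewrite /g rmorph1 scale1r addrC subrK.
have S1 : S 1 by split => //; rewrite g1.
have ubS : has_ubound S.
  exists ((D + D) / vnorm (p - o)) => s [s0 Os].
  rewrite ler_pdivlMr // -[s]ger0_norm // -vnorm_rscale.
  have -> : s%:C%C *: (p - o) = g s - o by rewrite /g addrAC subrr add0r.
  by apply: le_trans (vnormB _ _) _; apply: lerD; exact: bD.
have hS : has_sup S by split => //; exists 1.
pose s1 := sup S; have s11 : 1 <= s1 by apply: ub_le_sup.
have gB s s' : g s - g s' = (s - s')%:C%C *: (p - o).
  by rewrite /g rmorphB scalerBl; apply/rowP => i; rewrite !mxE; ring.
have clx : closure Omega (g s1).
  apply/closure_vecP => e e0.
  have [s Ss ss] := sup_adherent (divr_gt0 e0 n0) hS.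
  exists (g s); first by case: Ss.
  rewrite gB vnorm_rscale distrC ger0_norm ?subr_ge0 ?ub_le_sup //.
  by rewrite -ltr_pdivlMr //; rewrite -/s1 in ss; lra.
have nx : ~ Omega (g s1).
  move=> /((open_vecP _).1 oO) [e e0 He].
  have e2 : 0 < e / 2 / vnorm (p - o) by rewrite !divr_gt0.
  have : S (s1 + e / 2 / vnorm (p - o)).
    split; first lra.
    apply: He; rewrite gB vnorm_rscale addrAC subrr add0r ger0_norm ?(ltW e2) //.
    rewrite divfK ?gt_eqF //; lra.
  by move=> /(ub_le_sup ubS); rewrite -/s1; lra.
have s1n : s1 != 1 by apply/eqP => E; apply: nx; rewrite E g1.
have s1g : 1 < s1 by rewrite lt_def s1n.
have s1p : 0 < s1 by lra.
(* [s1] is the last parameter of the ray from [o] through p = g 1. Thus [p] lies at the fraction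
   1/s1 of the way from [o] to [g s1], and [t] is the complement. *)
exists (g s1), (1 - s1^-1); split; first by apply/boundaryP.
  by rewrite subr_gt0 invf_lt1 // s1g gerBl invr_ge0 ltW.
have e1 : o - g s1 = - (s1%:C%C *: (p - o)) by rewrite /g opprD addrA subrr sub0r.
rewrite e1 scalerN scalerA -rmorphM mulrBl mul1r mulVf ?gt_eqF //.
rewrite rmorphB rmorph1 scalerBl scale1r /g.
by apply/rowP => i; rewrite !mxE; ring.
Qed.

Lemma closure_dist_le Omega o x (D : R) : (forall v, Omega v -> vnorm v <= D) ->
  Omega o -> closure Omega x -> vnorm (o - x) <= 2 * D + 1.
Proof.
move=> bD Oo clx; have [y Oy yx] := (closure_vecP _ _).1 clx 1 ltr01.
apply: le_trans (vnorm_distD y _ _) _; apply: lerD; last exact: ltW.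
by apply: le_trans (vnormB _ _) _; have := bD _ Oo; have := bD _ Oy; lra.
Qed.

(** The ball of radius t r0 around [p] lies in [Omega] and so misses [x0]. Hence [t] is small when
    [p] is near [x0], and then [x] is near [p]. *)
Lemma radial_boundary_near Omega o p x t x0 (r0 D : R) : convex_set Omega ->
  (forall v, Omega v -> vnorm v <= D) ->
  (forall v, vnorm (v - o) < r0 -> Omega v) -> 0 < r0 -> closure Omega x ->
  0 < t <= 1 -> p = x + t%:C%C *: (o - x) -> ~ Omega x0 ->
  t <= vnorm (p - x0) / r0 /\ vnorm (x - x0) <= (1 + (2 * D + 1) / r0) * vnorm (p - x0).
Proof.
move=> cO bD bo r00 clx t01 pE nx0.
have tb : t <= vnorm (p - x0) / r0.
  rewrite ler_pdivlMr // leNgt; apply/negP => H; apply: nx0.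
  apply: (convex_ball_closure _ _ _ _ _ cO clx bo t01).
  by rewrite -pE vnorm_distC.
split => //; apply: le_trans (vnorm_distD p _ _) _; rewrite mulrDl mul1r addrC lerD2l.
have -> : x - p = - (t%:C%C *: (o - x)) by rewrite pE opprD addrA subrr sub0r.
rewrite vnormN vnorm_rscale ger0_norm; last by case/andP: t01 => /ltW.
have Oo : Omega o by apply: bo; rewrite subrr vnorm0.
have ox := closure_dist_le _ _ _ _ bD Oo clx.
have t0 : 0 <= t by case/andP: t01 => /ltW.
apply: le_trans (ler_pM t0 (vnorm_ge0 _) tb ox) _.
by rewrite le_eqVlt; apply/orP; left; apply/eqP; ring.
Qed.

Lemma kobayashi_le Omega p q L : chain Omega p q L -> (kobayashi Omega p q <= L%:E)%E.
Proof.
move=> /disc_chain_lengthP H; apply: ereal_inf_lbound; by exists L.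
Qed.

Lemma kobayashi_ge Omega p q M : (forall L, chain Omega p q L -> M <= L) ->
  (M%:E <= kobayashi Omega p q)%E.
Proof.
move=> H; apply: le_ereal_inf_tmp => _ [L /disc_chain_lengthP HL <-].
by rewrite lee_fin; exact: H.
Qed.

End ConvexDomains.

(** * First-order Taylor expansion with Hoelder remainder *)

Section DerivativeOnSegment.
Context {R : realType} {V : normedModType R}.
Implicit Types (r : V -> R^o) (x h : V).

Lemma is_derive_segment r x h (t : R) : differentiable r (x + t *: h) ->
  is_derive t 1 (fun s : R => r (x + s *: h) : R) ('d r (x + t *: h) h).
Proof.
move=> dr; have E : (fun k : R => k^-1 *: ((r (x + (k *: (1 : R) + t) *: h) : R) - r (x + t *: h))) =
    (fun k : R => k^-1 *: (r (k *: h + (x + t *: h)) - r (x + t *: h))).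
  apply/funext => k; congr (_ *: (r _ - _)).
  by rewrite [k *: 1](_ : _ = k) ?scalerDl 1?addrCA // /GRing.scale /= mulr1.
split; last by rewrite -deriveE // /derive E.
by rewrite /derivable E; exact: diff_derivable.
Qed.

Lemma taylor_hoelder r x h (alpha M : R) : 0 <= alpha -> 0 <= M ->
  (forall t : R, 0 <= t <= 1 -> differentiable r (x + t *: h)) ->
  (forall t : R, 0 <= t <= 1 ->
     `|'d r (x + t *: h) h - 'd r x h| <= M * `|t *: h| `^ alpha * `|h|) ->
  `|r (x + h) - r x - 'd r x h| <= M * `|h| `^ alpha * `|h|.
Proof.
move=> al0 M0 dr Hr; pose phi (s : R) : R := r (x + s *: h).
have dphi (t : R) : 0 <= t <= 1 -> is_derive t 1 phi ('d r (x + t *: h) h).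
  by move=> t01; apply: is_derive_segment; exact: dr.
have [||c c01] := MVT_segment (f := phi) (df := fun t : R => 'd r (x + t *: h) h) (a := 0) (b := 1) ler01.
- by move=> t; rewrite in_itv /= => /andP[t0 t1]; apply: dphi; rewrite !ltW.
- apply: derivable_within_continuous => t; rewrite in_itv /= => t01.
  by have [] := dphi t t01.
rewrite in_itv /= in c01.
rewrite /phi scale1r scale0r addr0 subr0 mulr1 => ->.
apply: le_trans (Hr c c01) _; apply: ler_wpM2r => //; apply: ler_wpM2l => //.
apply: ge0_ler_powR; rewrite ?nnegrE ?normr_ge0 // normrZ ler_piMl //.
by case/andP: c01 => c0 c1; rewrite ger0_norm.
Qed.

End DerivativeOnSegment.

(** * Supporting functionals from defining functions *)

Section BoundaryFunctionals.
Context {R : realType} {d : nat}.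
Local Notation nm := (@normc R).
Local Notation V := (Cvec R d).
Local Notation W := ('rV[R]_d * 'rV[R]_d)%type.
Implicit Types (x y z h : V) (X Y H : W) (Omega : set V) (r : W -> R^o).

Definition realify z : W :=
  (\row_j complex.Re (z ord0 j), \row_j complex.Im (z ord0 j)).

Lemma realifyK : cancel realify (@complexify R d).
Proof. by move=> z; apply/rowP => j; rewrite !mxE /=; case: (z ord0 j). Qed.

Lemma complexifyK : cancel (@complexify R d) realify.
Proof. by move=> [u v]; congr pair; apply/rowP => j; rewrite !mxE. Qed.

Lemma realifyD y z : realify (y + z) = realify y + realify z.
Proof. by congr pair; apply/rowP => j; rewrite !mxE ReImE. Qed.

Lemma realifyN z : realify (- z) = - realify z.
Proof. by congr pair; apply/rowP => j; rewrite !mxE ReImE. Qed.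

Lemma realifyB y z : realify (y - z) = realify y - realify z.
Proof. by rewrite realifyD realifyN. Qed.

Lemma realifyZ (t : R) z : realify (t%:C%C *: z) = t *: realify z.
Proof. by congr pair; apply/rowP => j; rewrite !mxE ReImE /= ?mul0r ?subr0 ?addr0. Qed.

Lemma rV_norm_le (v : 'rV[R]_d) (e : R) : 0 <= e -> (forall i, `|v ord0 i| <= e) -> `|v| <= e.
Proof.
move=> e0 H; rewrite [leLHS]/Num.norm /=.
by have [->//|/mx_norm_neq0 [[i j] ->]] := eqVneq (mx_norm v) 0; rewrite /= ord1.
Qed.

Lemma norm_realify z : `|realify z| <= vnorm z.
Proof.
rewrite prod_normE ge_max; apply/andP; split; apply: rV_norm_le => [|i];
  rewrite ?vnorm_ge0 // mxE; apply: le_trans (nm_entry z i); by [exact: Re_nm | exact: Im_nm].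
Qed.

(** The complex linear functional with real part -dr: its j-th coefficient is minus the
    x_j-derivative of r plus i times the y_j-derivative. The sign makes it positive towards the
    inside. *)
Definition tangent_functional r X : 'cV[Cplx R]_d :=
  \col_j Complex (- 'd r X (delta_mx ord0 j, 0)) ('d r X (0, delta_mx ord0 j)).

Lemma Re_sum (I : finType) (F : I -> R[i]) :
  complex.Re (\sum_i F i) = \sum_i complex.Re (F i).
Proof. by apply: (big_morph (@complex.Re R)) => [u v|]; [exact: cReD|]. Qed.

Lemma Re_tangent_functional r X h :
  complex.Re (app (tangent_functional r X) h) = - 'd r X (realify h).
Proof.
rewrite /app mxE Re_sum.
have -> : realify h = \sum_j (complex.Re (h ord0 j) *: ((delta_mx ord0 j, 0) : W) +
   complex.Im (h ord0 j) *: ((0, delta_mx ord0 j) : W)).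
  rewrite big_split /= {1}/realify.
  have e1 (F : 'I_d -> R) : \sum_j F j *: ((delta_mx ord0 j, 0) : W) = (\row_j F j, 0).
    rewrite [in RHS](row_sum_delta (\row_j F j)).
    elim/big_rec2: _ => // j y1 y2 _ ->; rewrite mxE.
    by congr pair; rewrite /= ?scaler0 ?addr0.
  have e2 (F : 'I_d -> R) : \sum_j F j *: ((0, delta_mx ord0 j) : W) = (0, \row_j F j).
    rewrite [in RHS](row_sum_delta (\row_j F j)).
    elim/big_rec2: _ => // j y1 y2 _ ->; rewrite mxE.
    by congr pair; rewrite /= ?scaler0 ?addr0.
  by rewrite e1 e2; congr pair; rewrite /= ?addr0 ?add0r.
rewrite linear_sum -sumrN; apply: eq_bigr => j _.
have -> (a b : R) (v w : W) : 'd r X (a *: v + b *: w) = a * 'd r X v + b * 'd r X w :> R.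
  by rewrite linearD !linearZ.
by rewrite cReM mxE /= mulrN opprD.
Qed.

Lemma app_mulN1i (u : 'cV[Cplx R]_d) h :
  complex.Im (app u h) = complex.Re (app u (Complex 0 (-1) *: h)).
Proof. by rewrite appZ cReM /= mul0r sub0r mulN1r opprK. Qed.

Lemma dist_opp_le (c c' a b e : R) : c = - a -> c' = - b -> `|a - b| <= e ->
  `|c - c'| <= e.
Proof. by move=> -> -> H; rewrite opprK addrC distrC. Qed.

Lemma dist_eq_le (c c' a b e : R) : c = a -> c' = b -> `|a - b| <= e -> `|c - c'| <= e.
Proof. by move=> -> ->. Qed.

Lemma nm_dist_ReIm (a b : R[i]) (e1 e2 : R) :
  `|complex.Re a - complex.Re b| <= e1 -> `|complex.Im a - complex.Im b| <= e2 ->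
  nm (a - b) <= e1 + e2.
Proof.
by move=> h1 h2; apply: le_trans (nm_ReIm _) _; rewrite !ReImE; exact: lerD.
Qed.

(* u x is minus the complexified differential at x of a defining function r.
   It is positive on Omega - x because r cannot increase from x towards Omega. *)
Lemma boundary_functionals Omega (alpha : R) x0 : 0 < alpha -> open Omega ->
  convex_set Omega -> Omega !=set0 -> has_C1alpha_boundary alpha Omega ->
  boundary Omega x0 ->
  exists rho A : R, exists u : V -> 'cV[Cplx R]_d, [/\ 0 < rho, 0 < A &
  forall x, boundary Omega x -> vnorm (x - x0) < rho ->
  [/\ (forall z, Omega z -> 0 < complex.Re (app (u x) (z - x))),
      (forall h, vnorm h < rho ->
         A * (vnorm h `^ alpha * vnorm h) < complex.Re (app (u x) h) -> Omega (x + h)) &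
      forall h, nm (app (u x) h - app (u x0) h) <=
         A * (vnorm (x - x0) `^ alpha * vnorm h)]].
Proof.
move=> al0 oO cO [z1 Oz1] bC bx0.
set O' := @complexify R d @^-1` Omega.
have bO' x : boundary Omega x -> boundary O' (realify x).
  move=> /boundaryP[//|clx nx]; split; last first.
    by move=> /interior_subset; rewrite /O' /= realifyK.
  move=> B /nbhs_normP[e /= e0 He].
  have [y Oy yx] := (closure_vecP _ _).1 clx e e0.
  exists (realify y); split; first by rewrite /O' /= realifyK.
  apply: He; rewrite /= -realifyB; apply: le_lt_trans (norm_realify _) _.
  by rewrite vnorm_distC.
have [U [r [[oU UX0] [dr [M HM]] ndr OU]]] := bC _ (bO' _ bx0).
set X0 := realify x0 in UX0.
have /nbhs_normP[e /= e0 He] : nbhs X0 U by exact: open_nbhs_nbhs.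
pose M1 := `|M| + 1; have M10 : 0 < M1 by rewrite ltr_wpDl.
have HM1 X Y H : U X -> U Y -> `|'d r X H - 'd r Y H| <= M1 * `|X - Y| `^ alpha * `|H|.
  move=> UX UY; apply: le_trans (HM _ _ _ UX UY) _; apply: ler_wpM2r => //.
  apply: ler_wpM2r; first exact: powR_ge0.
  by apply: le_trans (ler_norm _) _; rewrite lerDl.
(* Half of [e], so that a point within [rho] of [x0] plus a vector shorter than [rho] stays in
   [U]. *)
pose rho := e / 2; have rho0 : 0 < rho by rewrite divr_gt0.
have inU x : vnorm (x - x0) < rho -> U (realify x).
  move=> xx; apply: He; rewrite /= -realifyB; apply: le_lt_trans (norm_realify _) _.
  by rewrite vnorm_distC /rho in xx *; lra.
have inU2 x h (t : R) : vnorm (x - x0) < rho -> vnorm h < rho -> 0 <= t <= 1 ->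
    U (realify x + t *: realify h).
  move=> xx hr /andP[t0 t1]; apply: He; rewrite /= -realifyZ -realifyD -realifyB.
  apply: le_lt_trans (norm_realify _) _.
  rewrite opprD addrA; apply: le_lt_trans (vnormB _ _) _; rewrite vnorm_rscale ger0_norm //.
  have : t * vnorm h <= vnorm h by rewrite ler_piMl ?vnorm_ge0.
  by rewrite vnorm_distC /rho in xx hr *; lra.
have tay x h : vnorm (x - x0) < rho -> vnorm h < rho ->
    `|r (realify x + realify h) - r (realify x) - 'd r (realify x) (realify h)| <=
    M1 * (vnorm h `^ alpha * vnorm h).
  move=> xx hr.
  have := @taylor_hoelder _ _ r (realify x) (realify h) alpha M1 (ltW al0) (ltW M10).
  move=> /(_ _ _)/le_trans; apply.
  - by move=> t t01; apply: dr; exact: inU2.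
  - move=> t t01; have := HM1 _ _ (realify h) (inU2 x h t xx hr t01) (inU x xx).
    have -> : realify x + t *: realify h - realify x = t *: realify h by rewrite addrAC subrr add0r.
    exact.
  - rewrite -mulrA; apply: ler_wpM2l; first exact: ltW.
    apply: ler_pM; rewrite ?powR_ge0 ?normr_ge0 ?norm_realify //.
    by apply: ge0_ler_powR; rewrite ?nnegrE ?(ltW al0) ?normr_ge0 ?vnorm_ge0 // norm_realify.
have memU x : U (realify x) -> Omega x <-> r (realify x) < 0.
  move=> Ux; have : (O' `&` U) (realify x) <-> ([set y | r y < 0] `&` U) (realify x) by rewrite OU.
  rewrite /O' /= realifyK => H; split=> Hx; first by have [] := H.1 (conj Hx Ux).
  by have [] := H.2 (conj Hx Ux).
(* A negative value would put [x] in [Omega]; a positive one would persist near [x], where points of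
   [Omega] accumulate. *)
have r_bd x : boundary Omega x -> vnorm (x - x0) < rho -> r (realify x) = 0.
  move=> /boundaryP[//|clx nx] xx; apply/eqP; rewrite eq_le; apply/andP; split; last first.
    by rewrite leNgt; apply/negP => /(memU _ (inU _ xx)).
  rewrite leNgt; apply/negP => rp.
  have /cvgrPdist_lt /(_ _ rp) := differentiable_continuous (dr _ (inU _ xx)).
  move=> /nbhs_normP[e1 /= e10 He1].
  have e20 : 0 < Num.min e1 (rho - vnorm (x - x0)) by rewrite lt_min e10 subr_gt0.
  have [y Oy yx] := (closure_vecP _ _).1 clx _ e20.
  move: yx; rewrite lt_min => /andP[yx1 yx2].
  have yx0 : vnorm (y - x0) < rho.
    by apply: le_lt_trans (vnorm_distD x _ _) _; lra.
  have := (memU _ (inU _ yx0)).1 Oy.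
  have := He1 (realify y); rewrite /= -realifyB => /(_ _).
  have h1 : `|realify (x - y)| < e1 by apply: le_lt_trans (norm_realify _) _; rewrite vnorm_distC.
  by move=> /(_ h1); rewrite ltr_norml; lra.
pose u x := tangent_functional r (realify x).
(* The factor 2 pays for estimating real and imaginary parts separately in the third clause. *)
exists rho, (2 * M1), u; split => //; first by rewrite mulr_gt0.
move=> x bx xx.
have rx0 := r_bd x bx xx.
(* If dr were positive towards [z], the point at a small parameter [t] on the segment would have r
   >= t D - t (t^alpha K) > 0, although convexity places it in [Omega]. *)
have weak z : Omega z -> 'd r (realify x) (realify (z - x)) <= 0.
  move=> Oz; rewrite leNgt; apply/negP; set D := 'd r _ _ => D0.
  set n := vnorm (z - x).
  pose K := M1 * (n `^ alpha * n).
  have K0 : 0 <= K by rewrite !mulr_ge0 ?(ltW M10) ?powR_ge0 ?vnorm_ge0.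
  have [clx nx] := (boundaryP _ _ oO).1 bx.
  have [e2 e20 He2] := (open_vecP _).1 oO z Oz.
  have [t [t0 t1 tn tK]] : exists t : R, [/\ 0 < t, t <= 1, t * n < rho & t `^ alpha * K < D].
    have n1 : 0 < n + 1 by rewrite ltr_wpDl // vnorm_ge0.
    have K1 : 0 < K + 1 by rewrite ltr_wpDl.
    pose t1 := (D / (K + 1)) `^ (alpha^-1); have t10 : 0 < t1 by rewrite powR_gt0 // divr_gt0.
    pose t := Num.min 1 (Num.min (rho / (n + 1)) t1).
    have t0 : 0 < t by rewrite !lt_min ltr01 t10 divr_gt0.
    have tr : t <= rho / (n + 1) by rewrite !ge_min lexx orbT.
    have tt : t <= t1 by rewrite !ge_min lexx !orbT.
    exists t; split=> //; first by rewrite ge_min lexx.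
    - move: tr; rewrite ler_pdivlMr // mulrDr mulr1; lra.
    - have : t `^ alpha <= D / (K + 1).
        have -> : D / (K + 1) = t1 `^ alpha.
          by rewrite /t1 -powRrM mulVf ?gt_eqF // powRr1 // divr_ge0 // ltW.
        by apply: ge0_ler_powR; rewrite ?nnegrE ?(ltW al0) ?(ltW t0) ?(ltW t10).
      rewrite ler_pdivlMr // mulrDr mulr1; have : 0 < t `^ alpha by exact: powR_gt0.
      lra.
  have Ot : Omega (x + t%:C%C *: (z - x)).
    apply: (convex_ball_closure _ _ _ t _ cO clx He2); first by rewrite t0.
    by rewrite subrr vnorm0 mulr_gt0.
  have hr : vnorm (t%:C%C *: (z - x)) < rho by rewrite vnorm_rscale gtr0_norm.
  have Ut : U (realify (x + t%:C%C *: (z - x))).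
    rewrite realifyD -[X in _ + X]scale1r; apply: inU2 => //.
    by rewrite ler01 lexx.
  have := (memU _ Ut).1 Ot; have := tay x _ xx hr.
  rewrite -realifyD rx0 subr0 realifyZ linearZ /= -/D vnorm_rscale (gtr0_norm t0) -/n.
  have -> : M1 * ((t * n) `^ alpha * (t * n)) = t * (t `^ alpha * K).
    by rewrite powRM ?(ltW t0) ?vnorm_ge0 // /K; ring.
  rewrite ler_norml /GRing.scale /= => /andP[h1 _] h2.
  have : t * (t `^ alpha * K) < t * D by rewrite ltr_pM2l.
  lra.
split.
- move=> z Oz; rewrite Re_tangent_functional oppr_gt0 lt_def weak // andbT.
  (* Strictness: if dr vanished towards [z], moving [z] slightly inside the open set [Omega] in a
     direction where dr is positive would contradict [weak]. *)
  apply/eqP => D0; have [H HD] := ndr _ (inU _ xx).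
  wlog Hp : H HD / 0 < 'd r (realify x) H.
    move: (HD); rewrite neq_lt => /orP[Hn|Hp] G; last exact: (G H).
    by apply: (G (- H)); rewrite linearN ?oppr_eq0 ?oppr_gt0.
  have [e2 e20 He2] := (open_vecP _).1 oO z Oz.
  set h := complexify H.
  have n1 : 0 < vnorm h + 1 by rewrite ltr_wpDl // vnorm_ge0.
  pose t := e2 / (vnorm h + 1).
  have t0 : 0 < t by rewrite divr_gt0.
  have : Omega (z + t%:C%C *: h).
    apply: He2; rewrite addrAC subrr add0r vnorm_rscale gtr0_norm // /t.
    by rewrite mulrAC ltr_pdivrMr // ltr_pM2l // ltrDl.
  have E : 'd r (realify x) (realify (z + t%:C%C *: h - x)) = t * 'd r (realify x) H :> R.
    by rewrite addrAC realifyD linearD realifyZ linearZ /= complexifyK -D0; exact: add0r.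
  by move=> /weak; rewrite E leNgt mulr_gt0.
- move=> h hr; rewrite Re_tangent_functional => Hh.
  have Ut : U (realify (x + h)).
    rewrite realifyD -[X in _ + X]scale1r; apply: inU2 => //.
    by rewrite ler01 lexx.
  apply/(memU _ Ut); rewrite realifyD.
  have := tay x h xx hr; rewrite rx0 subr0 ler_norml => /andP[_ h1].
  have : 0 <= M1 * (vnorm h `^ alpha * vnorm h).
    by rewrite !mulr_ge0 ?(ltW M10) ?powR_ge0 ?vnorm_ge0.
  lra.
- move=> h.
  have key k : `|complex.Re (app (u x) k) - complex.Re (app (u x0) k)| <=
      M1 * (vnorm (x - x0) `^ alpha * vnorm k).
    have hm : `|'d r (realify x) (realify k) - 'd r X0 (realify k)| <=
        M1 * (vnorm (x - x0) `^ alpha * vnorm k).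
      apply: le_trans (HM1 _ _ _ (inU _ xx) UX0) _; rewrite -mulrA.
      apply: ler_wpM2l; first exact: ltW.
      apply: ler_pM; rewrite ?powR_ge0 ?normr_ge0 ?norm_realify // -realifyB.
      by apply: ge0_ler_powR; rewrite ?nnegrE ?(ltW al0) ?normr_ge0 ?vnorm_ge0 // norm_realify.
    exact (dist_opp_le _ _ _ _ _ (Re_tangent_functional r (realify x) k)
      (Re_tangent_functional r X0 k) hm).
  have nmi : nm (Complex 0 (-1)) = 1 by rewrite /= expr0n add0r sqrrN expr1n sqrtr1.
  have k1 := key (Complex 0 (-1) *: h); rewrite vnormZ nmi mul1r in k1.
  have k2 := dist_eq_le _ _ _ _ _ (app_mulN1i (u x) h) (app_mulN1i (u x0) h) k1.
  apply: le_trans (nm_dist_ReIm _ _ _ _ (key h) k2) _.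
  by rewrite -mulrDl [2 * M1]mulr_natl mulr2n.
Qed.

End BoundaryFunctionals.

(** * Descent to the boundary in a complex slice *)

Section Approach.
Context {R : realType} {d : nat}.
Local Notation nm := (@normc R).
Local Notation V := (Cvec R d).
Implicit Types (p q o x y z v w h n : V) (Omega : set V) (s t : R).

Definition chain_le Omega p q (M : R) := exists2 L, chain Omega p q L & L <= M.

Lemma chain_le_trans Omega p q z (M M' : R) :
  chain_le Omega p q M -> chain_le Omega q z M' -> chain_le Omega p z (M + M').
Proof.
move=> [L HL LM] [L' HL' LM']; exists (L + L'); last exact: lerD.
exact: chain_cat HL HL'.
Qed.

Lemma chain_le_sym Omega p q (M : R) : chain_le Omega p q M -> chain_le Omega q p M.
Proof. by move=> [L HL LM]; exists L => //; exact: chain_sym. Qed.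

Lemma chain_leW Omega p q (M M' : R) : M <= M' -> chain_le Omega p q M -> chain_le Omega p q M'.
Proof. by move=> MM [L HL LM]; exists L => //; exact: le_trans LM MM. Qed.

Lemma powR_small (beta c : R) : 0 < beta -> 0 < c ->
  exists2 e, 0 < e & forall s, 0 <= s -> s <= e -> s `^ beta <= c.
Proof.
move=> b0 c0; exists (c `^ (beta^-1)); first exact: powR_gt0.
move=> s s0 se; have -> : c = (c `^ (beta^-1)) `^ beta.
  by rewrite -powRrM mulVf ?gt_eqF // powRr1 // ltW.
by apply: ge0_ler_powR; rewrite ?nnegrE ?powR_ge0 ?(ltW b0).
Qed.

Lemma poincare_real (a b : R) : -1 < b -> b <= a -> a < 1 ->
  poincare a%:C%C b%:C%C = ln ((1 + a) * (1 - b) / ((1 - a) * (1 + b))) / 2.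
Proof.
move=> b1 ba a1; have ab : 0 < 1 - a * b by nra.
have pE : pdist a%:C%C b%:C%C = (a - b) / (1 - a * b).
  rewrite /pdist conjc_real normcM normcV -rmorphB -rmorphM.
  have -> : 1 - (a * b)%:C%C = (1 - a * b)%:C%C by rewrite rmorphB rmorph1.
  by rewrite !nmC (ger0_norm (ltW ab)) ger0_norm ?subr_ge0.
rewrite poincareE pE; congr (ln _ / 2); field.
have h1 : 0 < 1 - a by lra.
have h2 : 0 < 1 + b by lra.
have h3 : 0 < 1 - a * b - (a - b).
  have -> : 1 - a * b - (a - b) = (1 - a) * (1 + b) by ring.
  exact: mulr_gt0.
by rewrite !gt_eqF.
Qed.

(** The quotient is the cross ratio of [w], [w / 2] and the ends s, s + 2 rho of a diameter. Its
    factor from the left end is 2 up to a relative error of order s / w, that from the right end is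
    1 up to an error w / rho; both errors are of order [e]. *)
Lemma halving_ratio (s w rho e A : R) : 0 < w -> 0 <= A -> 0 < e -> e <= 1 -> 4 * (A * e) <= 1 ->
  w = e * rho -> s = A * (w * e) ->
  ln ((w - s) * (2 * rho - w / 2 + s) / ((2 * rho - w + s) * (w / 2 - s))) <=
  ln 2 + 2 * (A + 1) * e.
Proof.
move=> w0 A0 e0 e1 Ae wE sE.
have rho0 : 0 < rho by rewrite -(pmulr_rgt0 _ e0) -wE.
have wr : w <= rho by rewrite wE ler_piMl // ltW.
pose y := A * e; have y0 : 0 <= y by rewrite mulr_ge0 // ltW.
have sy : s = y * w by rewrite sE /y; ring.
have s0 : 0 <= s by rewrite sy mulr_ge0 // ltW.
have ws : 0 < w / 2 - s by rewrite sy; nra.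
have ws1 : 0 < w - s by lra.
have rw : 0 < 2 * rho - w + s by lra.
have rw1 : 0 < 2 * rho - w / 2 + s by lra.
have q1 : (w - s) / (w / 2 - s) <= 2 * (1 + 2 * y).
  rewrite ler_pdivrMr // sy.
  have -> : w - y * w = w * (1 - y) by ring.
  have -> : 2 * (1 + 2 * y) * (w / 2 - y * w) = w * (1 - 4 * (y * y)) by field.
  rewrite ler_pM2l //; have : y * y <= y * (1 / 4) by apply: ler_wpM2l => //; rewrite /y; lra.
  lra.
have q2 : (2 * rho - w / 2 + s) / (2 * rho - w + s) <= 1 + e.
  rewrite ler_pdivrMr //; have : e * rho <= e * (2 * rho - w + s).
    by apply: ler_wpM2l; lra.
  by rewrite -wE; lra.
have -> : (w - s) * (2 * rho - w / 2 + s) / ((2 * rho - w + s) * (w / 2 - s)) =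
   ((w - s) / (w / 2 - s)) * ((2 * rho - w / 2 + s) / (2 * rho - w + s)).
  by field; rewrite !gt_eqF //; lra.
have p1 : 0 < (w - s) / (w / 2 - s) by rewrite divr_gt0.
have p2 : 0 < (2 * rho - w / 2 + s) / (2 * rho - w + s) by rewrite divr_gt0.
rewrite lnM // ?posrE //.
have l1 : ln ((w - s) / (w / 2 - s)) <= ln 2 + 2 * y.
  have y2 : 0 < 1 + 2 * y by lra.
  apply: (@le_trans _ _ (ln (2 * (1 + 2 * y)))); first by rewrite ler_ln ?posrE // mulr_gt0.
  rewrite lnM ?posrE // lerD2l; apply: le_ln1Dx; lra.
have l2 : ln ((2 * rho - w / 2 + s) / (2 * rho - w + s)) <= e.
  apply: (@le_trans _ _ (ln (1 + e))); first by rewrite ler_ln ?posrE //; lra.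
  by apply: le_ln1Dx; lra.
by move: l1 l2; rewrite /y => l1 l2; lra.
Qed.

(* The disc used is centred on the real axis, with left end s = O(w^(1+g)) and
   radius w^(1-g), where g = alpha / (2 + alpha): the two exponents balance the
   errors s / w and w / radius, and both are summable along w = 2^-k. *)
Lemma slice_halving (alpha A rho : R) : 0 < alpha -> 0 < A -> 0 < rho ->
  exists e1 B : R, [/\ 0 < e1, 0 < B & forall Omega x n,
    (forall w : Cplx R, nm w < rho -> A * (nm w `^ alpha * nm w) < complex.Re w ->
       Omega (x + w *: n)) ->
    forall s, 0 < s -> s <= e1 ->
    chain_le Omega (x + s%:C%C *: n) (x + (s / 2)%:C%C *: n)
      (ln 2 / 2 + B * s `^ (alpha / (2 + alpha)))].
Proof.
move=> al0 A0 rho0; set g := alpha / (2 + alpha).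
have a2 : 0 < 2 + alpha by lra.
have g0 : 0 < g by rewrite divr_gt0.
have g1 : 0 < 1 - g by rewrite subr_gt0 ltr_pdivrMr //; lra.
(* Points of the disc have modulus below 3r; [A2] is [A] with this factor pulled out. *)
pose A2 := A * (3 `^ alpha * 3).
have A20 : 0 < A2 by rewrite !mulr_gt0 // powR_gt0.
have c0 : 0 < Num.min 1 (4 * A2)^-1 by rewrite lt_min ltr01 invr_gt0 mulr_gt0.
have [e2 e20 H2] := powR_small _ _ g0 c0.
have r3 : 0 < rho / 3 by rewrite divr_gt0.
have [e3 e30 H3] := powR_small _ _ g1 r3.
exists (Num.min e2 e3), (A2 + 1); split; first by rewrite lt_min e20.
  by rewrite addr_gt0.
move=> Omega x n HO w w0; rewrite le_min => /andP[we2 we3].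
set e := w `^ g; have e0 : 0 < e by exact: powR_gt0.
have := H2 w (ltW w0) we2; rewrite le_min => /andP[e1 eA].
have Ae : 4 * (A2 * e) <= 1.
  by move: eA; rewrite -/e -[(_ * _)^-1]mul1r ler_pdivlMr ?mulr_gt0 //; lra.
set r := w `^ (1 - g); have r0 : 0 < r by exact: powR_gt0.
have rr : r <= rho / 3 by exact: H3 (ltW w0) we3.
have wE : w = e * r.
  rewrite /e /r -powRD; last by rewrite (gt_eqF w0) implybT.
  by rewrite addrC subrK powRr1 // ltW.
pose s := A2 * (w * e).
have s0 : 0 < s by rewrite !mulr_gt0.
have wr : w <= r by rewrite wE ler_piMl // ltW.
have sr : s <= r.
  have -> : s = (A2 * e) * w by rewrite /s; ring.
  apply: (@le_trans _ _ (1 * w)); last by rewrite mul1r.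
  apply: ler_wpM2r; first exact: ltW.
  have : 0 < A2 * e by rewrite mulr_gt0.
  lra.
have sE : A * ((3 * r) `^ alpha * (3 * r)) = s.
  rewrite powRM ?(ltW r0) // /s /A2.
  (* This is the equation 1 + g = (1 - g)(1 + alpha), which determines g. *)
  have -> : w * e = r `^ alpha * r.
    rewrite /r /e -powRrM -{1}[w]powRr1 ?(ltW w0) //.
    rewrite -powRD; last by rewrite (gt_eqF w0) implybT.
    rewrite -powRD; last by rewrite (gt_eqF w0) implybT.
    congr (_ `^ _); rewrite /g; field; rewrite gt_eqF //.
  by ring.
have hd : holomorphic_disc Omega
    (fun z : Cplx R => x + (s + r)%:C%C *: n + z *: (r%:C%C *: n)).
  apply: holomorphic_affine => z z1.
  have -> : x + (s + r)%:C%C *: n + z *: (r%:C%C *: n) = x + ((s + r)%:C%C + z * r%:C%C) *: n.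
    by rewrite scalerDl scalerA addrA.
  set W := (_ + _ * _).
  have zr : nm (z * r%:C%C) < r.
    by rewrite normcM nmC gtr0_norm // -[ltRHS]mul1r ltr_pM2r.
  have nW : nm W < 3 * r.
    by apply: le_lt_trans (nmD _ _) _; rewrite nmC gtr0_norm ?addr_gt0 //; lra.
  apply: HO; first by lra.
  apply: (@le_lt_trans _ _ s).
    rewrite -sE; apply: ler_wpM2l; first exact: ltW.
    apply: ler_pM; [exact: powR_ge0 | exact: nm_ge0 | | exact: ltW].
    by apply: ge0_ler_powR; rewrite ?nnegrE ?nm_ge0 ?(ltW al0) ?(ltW nW) // mulr_ge0 // ltW.
  have : `|complex.Re (z * r%:C%C)| < r by apply: le_lt_trans (Re_nm _) zr.
  by rewrite ltr_norml /W cReD /=; lra.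
(* The coordinates of [w] and [w / 2] in the disc of centre s + r and radius r. *)
pose z1 : R := (w - s) / r - 1; pose z2 : R := (w / 2 - s) / r - 1.
have sw : s < w / 2.
  have -> : s = (A2 * e) * w by rewrite /s; ring.
  nra.
have b1 : -1 < z2 by rewrite /z2 ltrBrDl subrr divr_gt0 // subr_gt0.
have b12 : z2 <= z1 by rewrite /z1 /z2 lerD2r ler_pM2r ?invr_gt0 //; lra.
have b2 : z1 < 1.
  by rewrite /z1 ltrBlDr ltr_pdivrMr //; lra.
have n1 : nm z1%:C%C < 1 by rewrite nmC ltr_norml b2 andbT (lt_le_trans b1).
have n2 : nm z2%:C%C < 1 by rewrite nmC ltr_norml b1 (le_lt_trans b12).
have := chain_cons _ _ z1%:C%C z2%:C%C _ 0 hd n1 n2 (chain_nil _ _).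
have pt (a b : R) : b = (a - s) / r - 1 ->
    x + (s + r)%:C%C *: n + b%:C%C *: (r%:C%C *: n) = x + a%:C%C *: n.
  move=> bE; rewrite scalerA -rmorphM -addrA -scalerDl -rmorphD.
  congr (_ + _%:C%C *: _); rewrite bE mulrBl mul1r divfK ?gt_eqF //; ring.
rewrite (pt w) // (pt (w / 2)) // addr0 => Hc.
exists (poincare z1%:C%C z2%:C%C) => //.
rewrite poincare_real //.
have -> : (1 + z1) * (1 - z2) / ((1 - z1) * (1 + z2)) =
   (w - s) * (2 * r - w / 2 + s) / ((2 * r - w + s) * (w / 2 - s)).
  rewrite /z1 /z2; field; rewrite ?gt_eqF //; lra.
have := halving_ratio s w r e A2 w0 (ltW A20) e0 e1 Ae wE (erefl s); lra.
Qed.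

Lemma slice_descent (alpha A rho : R) : 0 < alpha -> 0 < A -> 0 < rho ->
  exists e1 B : R, [/\ 0 < e1, 0 < B & forall Omega x n,
    (forall w : Cplx R, nm w < rho -> A * (nm w `^ alpha * nm w) < complex.Re w ->
       Omega (x + w *: n)) ->
    forall s (k : nat), 0 < s -> s <= e1 ->
    chain_le Omega (x + s%:C%C *: n) (x + (s / 2 ^+ k)%:C%C *: n)
      (k%:R * (ln 2 / 2) + B)].
Proof.
move=> al0 A0 rho0; have [e1 [B [e10 B0 H]]] := slice_halving alpha A rho al0 A0 rho0.
set g := alpha / (2 + alpha) in H.
have g0 : 0 < g by rewrite divr_gt0 //; lra.
pose th := (2^-1 : R) `^ g.
have th1 : th < 1.
  have -> : (1 : R) = 1 `^ g by rewrite powR1.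
  rewrite /th; apply: gt0_ltr_powR; rewrite ?nnegrE ?invr_ge0 //.
  by rewrite invf_lt1 // ltr1n.
pose B1 := B / (1 - th); have B10 : 0 < B1 by rewrite divr_gt0 // subr_gt0.
exists (Num.min e1 1), B1; split => //; first by rewrite lt_min e10 ltr01.
move=> Omega x n HO s k s0; rewrite le_min => /andP[se1 s1].
have p2 j : 0 < (2 : R) ^+ j by rewrite exprn_gt0.
(* The errors B (s / 2^j)^g form a geometric series of ratio [th]; their partial sums are written as
   a telescoping difference, which is at most [B1] because s <= 1. *)
suff : chain_le Omega (x + s%:C%C *: n) (x + (s / 2 ^+ k)%:C%C *: n)
    (k%:R * (ln 2 / 2) + B1 * (s `^ g - (s / 2 ^+ k) `^ g)).
  apply: chain_leW; rewrite lerD2l -[leRHS]mulr1; apply: ler_wpM2l; first exact: ltW.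
  have : s `^ g <= 1 `^ g by apply: ge0_ler_powR; rewrite ?nnegrE ?(ltW g0) ?(ltW s0).
  have := powR_ge0 (s / 2 ^+ k) g; rewrite powR1; lra.
elim: k => [|k IH].
  by rewrite expr0 divr1 subrr mulr0 mul0r addr0; exists 0 => //; exact: chain_nil.
have sk0 : 0 < s / 2 ^+ k by rewrite divr_gt0.
have sk1 : s / 2 ^+ k <= e1.
  apply: le_trans se1; rewrite ler_pdivrMr // ler_peMr ?(ltW s0) //.
  by rewrite exprn_ege1 // ler1n.
have := chain_le_trans _ _ _ _ _ _ IH (H Omega x n HO _ sk0 sk1).
have -> : s / 2 ^+ k / 2 = s / 2 ^+ k.+1 by rewrite exprSr invfM mulrA.
apply: chain_leW.
have -> : (s / 2 ^+ k.+1) `^ g = (s / 2 ^+ k) `^ g * th.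
  by rewrite exprSr invfM mulrA powRM ?invr_ge0 // ltW.
have -> : B = B1 * (1 - th) by rewrite /B1 divfK // gt_eqF // subr_gt0.
by rewrite -natr1 le_eqVlt; apply/orP; left; apply/eqP; ring.
Qed.

End Approach.

(** * Estimates uniform near a boundary point *)

Section BoundaryChart.
Context {R : realType} {d : nat}.
Local Notation nm := (@normc R).
Local Notation V := (Cvec R d).
Implicit Types (p q o x y z v w h n : V) (Omega : set V) (s t : R).

Lemma dyadic_between t (e : R) : 0 < t -> t <= e ->
  exists k : nat, t <= e / 2 ^+ k /\ e / 2 ^+ k <= 2 * t.
Proof.
move=> t0 te.
have p2 j : 0 < (2 : R) ^+ j by rewrite exprn_gt0.
have ex : exists j, e / 2 ^+ j < t.
  have [j Hj] : exists j : nat, e / t < j%:R.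
    by exists (Num.bound (e / t)); apply: archi_boundP; rewrite divr_ge0 //; lra.
  exists j; rewrite ltr_pdivrMr // mulrC -ltr_pdivrMr //; apply: lt_trans Hj _.
  by rewrite -natrX ltr_nat ltn_expl.
have [j Hj jmin] := ex_minnP ex.
case: j Hj jmin => [|k] Hj jmin; first by move: Hj; rewrite expr0 divr1 ltNge te.
exists k; split.
  by rewrite leNgt; apply/negP => /jmin; rewrite ltnn.
move: Hj; rewrite exprSr invfM mulrA; lra.
Qed.

Lemma add_telescope (G : zmodType) (a b0 b1 b2 : G) : b0 + b2 = b1 ->
  a = b0 + ((a - b1) + b2).
Proof. by move=> <-; rewrite addrCA subrK. Qed.

(* The descent is sharp only along the complex direction n = (o - x) / u(o - x), on
   which u n = 1 is real; leaving the ray o - x for n and coming back costs O(1). *)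
Lemma boundary_chart Omega (alpha : R) o x0 : 0 < alpha -> open Omega ->
  bounded_set Omega -> convex_set Omega -> has_C1alpha_boundary alpha Omega ->
  Omega o -> boundary Omega x0 ->
  exists eta C : R, exists u : V -> 'cV[Cplx R]_d, [/\ 0 < eta, 0 < C &
  forall x, boundary Omega x -> vnorm (x - x0) < eta ->
  [/\ forall z, Omega z -> 0 < complex.Re (app (u x) (z - x)),
      forall h, nm (app (u x) h - app (u x0) h) <= C * (vnorm (x - x0) `^ alpha * vnorm h),
      nm (app (u x) (o - x)) <= C &
      forall t e, 0 < t -> t <= e -> e <= eta ->
        chain_le Omega (x + t%:C%C *: (o - x)) (x + e%:C%C *: (o - x)) (ln (e / t) / 2 + C)]].
Proof.
move=> al0 oO bO cO bC Oo bx0.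
have [rho [A [u [rho0 A0 Hu]]]] := boundary_functionals Omega alpha x0 al0 oO cO (ex_intro _ o Oo) bC bx0.
have [D D0 bD] := bounded_vnorm _ bO.
have [r0 r00 Hr0] := (open_vecP _).1 oO o Oo.
have clB x : boundary Omega x -> closure Omega x by move=> /(boundaryP _ _ oO)[].
pose E := 2 * D + 1; have E0 : 0 < E by rewrite /E; lra.
have ox x : boundary Omega x -> vnorm (o - x) <= E.
  by move=> /clB; exact: closure_dist_le.
pose S0 := \sum_i nm (u x0 i ord0).
have S00 : 0 <= S0 by apply: sumr_ge0 => i _; exact: nm_ge0.
have u0S v : nm (app (u x0) v) <= S0 * vnorm v by exact: nm_app.
have u0pos z : Omega z -> 0 < complex.Re (app (u x0) (z - x0)).
  by have [|H _ _] := Hu x0 bx0; [rewrite subrr vnorm0 | exact: H].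
(* Half of the value at [x0], so that Re (u x (o - x)) >= c0 survives for nearby [x]: the change of
   functional and the change of base point each cost at most c0/2. *)
pose c0 := complex.Re (app (u x0) (o - x0)) / 2.
have c00 : 0 < c0 by rewrite divr_gt0 // u0pos.
have c02 : 0 < c0 / 2 by rewrite divr_gt0.
have AE0 : 0 < A * E by rewrite mulr_gt0.
have cAE : 0 < Num.min 1 (c0 / 2 / (A * E)) by rewrite lt_min ltr01 (divr_gt0 c02 AE0).
have [e1 e10 He1] := powR_small _ _ al0 cAE.
have S1 : 0 < S0 + 1 by rewrite ltr_wpDl.
have [eta1 eta1E] : exists eta1, eta1 = Num.min rho (Num.min e1 (c0 / 2 / (S0 + 1))).
  by eexists.
have eta10 : 0 < eta1 by rewrite eta1E !lt_min rho0 e10 (divr_gt0 c02 S1).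
pose S := S0 + A; have S_0 : 0 < S by rewrite ltr_wpDl.
have near x : boundary Omega x -> vnorm (x - x0) < eta1 ->
    [/\ vnorm (x - x0) < rho, vnorm (x - x0) `^ alpha <= 1,
      A * vnorm (x - x0) `^ alpha * E <= c0 / 2 & S0 * vnorm (x - x0) <= c0 / 2].
  move=> bx; rewrite eta1E !lt_min => /andP[xr /andP[xe xc]].
  have := He1 _ (vnorm_ge0 _) (ltW xe); rewrite le_min => /andP[p1 p2]; split => //.
  - by move: p2; rewrite ler_pdivlMr ?mulr_gt0 //; lra.
  - move: xc; rewrite ltr_pdivlMr //; have := vnorm_ge0 (x - x0); lra.
have uS x v : boundary Omega x -> vnorm (x - x0) < eta1 -> nm (app (u x) v) <= S * vnorm v.
  move=> bx xx; have [xr p1 _ _] := near x bx xx; have [_ _ H] := Hu x bx xr.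
  have -> : app (u x) v = app (u x0) v + (app (u x) v - app (u x0) v) by rewrite addrC subrK.
  apply: le_trans (nmD _ _) _; rewrite mulrDl; apply: lerD; first exact: u0S.
  apply: le_trans (H v) _; apply: ler_wpM2l; first exact: ltW.
  by rewrite ler_piMl ?vnorm_ge0.
have kap x : boundary Omega x -> vnorm (x - x0) < eta1 -> c0 <= complex.Re (app (u x) (o - x)).
  move=> bx xx; have [xr p1 p2 p3] := near x bx xx; have [_ _ H] := Hu x bx xr.
  have eq : app (u x) (o - x) = app (u x0) (o - x0) +
      ((app (u x) (o - x) - app (u x0) (o - x)) + app (u x0) (x0 - x)).
    have b : app (u x0) (o - x0) + app (u x0) (x0 - x) = app (u x0) (o - x).
      by rewrite -appD addrA subrK.
    exact: add_telescope b.
  have h1 : nm ((app (u x) (o - x) - app (u x0) (o - x)) + app (u x0) (x0 - x)) <= c0.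
    apply: le_trans (nmD _ _) _.
    have h2 : nm (app (u x) (o - x) - app (u x0) (o - x)) <= c0 / 2.
      apply: le_trans (H _) _; rewrite mulrA; apply: le_trans p2.
      apply: ler_wpM2l (ox x bx); rewrite mulr_ge0 ?powR_ge0 // ltW //.
    have h3 : nm (app (u x0) (x0 - x)) <= c0 / 2.
      by apply: le_trans (u0S _) _; rewrite vnorm_distC.
    lra.
  rewrite eq cReD.
  have := le_trans (Re_nm _) h1; rewrite ler_norml => /andP[h2 _].
  have -> : complex.Re (app (u x0) (o - x0)) = c0 + c0 by rewrite /c0 -splitr.
  by rewrite -[leLHS]addr0 -addrA lerD2l -lerBlDl sub0r.
(* [Nn] bounds the norm of [n x]; [A1] and [rho1] are [A] and [rho] rescaled from the vector
   [w *: n x] to the parameter [w]. *)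
have [Nn NnE] : exists Nn, Nn = E / c0 by exists (E / c0).
have Nn0 : 0 < Nn by rewrite NnE divr_gt0.
pose A1 := A * (Nn `^ alpha * Nn); have A10 : 0 < A1 := mulr_gt0 A0 (mulr_gt0 (powR_gt0 alpha Nn0) Nn0).
pose rho1 := rho / Nn; have rho10 : 0 < rho1 by rewrite divr_gt0.
have [e2 [B [e20 B0 desc]]] := @slice_descent R d alpha A1 rho1 al0 A10 rho10.
pose n x := (app (u x) (o - x))^-1 *: (o - x).
have nmk x : boundary Omega x -> vnorm (x - x0) < eta1 -> c0 <= nm (app (u x) (o - x)).
  move=> bx xx; apply: le_trans (kap x bx xx) _.
  by apply: le_trans (ler_norm _) (Re_nm _).
have appn x : boundary Omega x -> vnorm (x - x0) < eta1 -> app (u x) (n x) = 1.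
  move=> bx xx; rewrite /n appZ mulVf // -nm_gt0.
  exact: lt_le_trans c00 (nmk x bx xx).
have nN x : boundary Omega x -> vnorm (x - x0) < eta1 -> vnorm (n x) <= Nn.
  move=> bx xx; rewrite NnE vnormZ normcV mulrC; apply: ler_pM; rewrite ?vnorm_ge0 ?ox //.
    by rewrite invr_ge0 nm_ge0.
  by rewrite lef_pV2 ?posrE ?nmk // (lt_le_trans c00) // nmk.
have slice x : boundary Omega x -> vnorm (x - x0) < eta1 ->
    forall w : Cplx R, nm w < rho1 -> A1 * (nm w `^ alpha * nm w) < complex.Re w ->
    Omega (x + w *: n x).
  move=> bx xx w; rewrite ltr_pdivlMr // => wr wA.
  have [xr _ _ _] := near x bx xx; have [_ H _] := Hu x bx xr.
  have hN : vnorm (w *: n x) <= nm w * Nn.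
    by rewrite vnormZ; apply: ler_wpM2l; [exact: nm_ge0 | exact: nN].
  apply: H; first exact: le_lt_trans hN wr.
  rewrite appZ appn // mulr1; apply: le_lt_trans wA; rewrite /A1 -mulrA.
  apply: ler_wpM2l; first exact: ltW.
  rewrite [leRHS](_ : _ = (nm w * Nn) `^ alpha * (nm w * Nn)); last first.
    by rewrite powRM ?nm_ge0 ?(ltW Nn0) //; ring.
  apply: ler_pM; rewrite ?powR_ge0 ?vnorm_ge0 //.
  by apply: ge0_ler_powR; rewrite ?nnegrE ?vnorm_ge0 ?(ltW al0) // mulr_ge0 ?nm_ge0 // ltW.
(* Relative radius of the balls around the points to be joined: moving by s del changes the
   functional by at most s/2. *)
pose del := Num.min r0 (1 / (2 * S)).
have S2 : 0 < 2 * S by rewrite (mulr_gt0 _ S_0).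
have del0 : 0 < del by rewrite lt_min r00 (divr_gt0 _ S2).
have delS : S * del <= 1 / 2.
  have : del <= 1 / (2 * S) by rewrite ge_min lexx orbT.
  by rewrite (ler_pdivlMr _ _ S2); lra.
have delr : del <= r0 by rewrite ge_min lexx.
pose N' := Nn + del; have N'0 : 0 < N' by rewrite addr_gt0.
have AN : 0 < A * (N' `^ alpha * N') := mulr_gt0 A0 (mulr_gt0 (powR_gt0 alpha N'0) N'0).
(* The constant 1/4 makes the Hoelder remainder at depth s at most s/4, below the remaining real
   part s - s/2. *)
have cN : 0 < 1 / 4 / (A * (N' `^ alpha * N')) by rewrite (divr_gt0 _ AN) // divr_gt0.
have [e3 e30 He3] := powR_small _ _ al0 cN.
pose eta := Num.min (Num.min eta1 e2) (Num.min e3 (Num.min (rho / 2 / N') 1)).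
have rN : 0 < rho / 2 / N' by do 2 rewrite divr_gt0 //.
have eta0 : 0 < eta by rewrite !lt_min eta10 e20 e30 ltr01 rN.
pose K := 2 * Nn + E; have K0 : 0 < K by rewrite addr_gt0 // (mulr_gt0 _ Nn0).
pose m := Num.bound (K / del).
have Km : K <= m%:R * del.
  by rewrite -ler_pdivrMr // ltW // archi_boundP // divr_ge0 // ltW.
pose Cg := (2 * m)%N.+1%:R * (half_step : R).
have Cg0 : 0 <= Cg by rewrite mulr_ge0 ?ler0n // half_step_ge0.
(* Passing between the ray and the slice at comparable depths costs [Cg] at every depth: the
   distance is at most t K and the inner balls have radius t del. *)
have step x t s : boundary Omega x -> vnorm (x - x0) < eta1 -> 0 < t -> t <= s -> s <= 2 * t ->
    s <= eta -> chain_le Omega (x + t%:C%C *: (o - x)) (x + s%:C%C *: n x) Cg.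
  move=> bx xx t0 ts st; rewrite !le_min => /andP[/andP[_ _] /andP[se3 /andP[sr s1]]].
  have s0 : 0 < s by exact: lt_le_trans t0 ts.
  have [xr _ _ _] := near x bx xx; have [_ H _] := Hu x bx xr.
  exists Cg => //; apply: (chain_between_balls _ _ _ (t * del) m) => //.
  - by rewrite mulr_gt0.
  - move=> v Hv; apply: (convex_ball_closure _ _ _ t r0 cO (clB x bx) Hr0).
      by rewrite t0 (le_trans ts s1).
    by apply: lt_le_trans Hv _; rewrite ler_pM2l.
  - move=> v Hv; have -> : v = x + (s%:C%C *: n x + (v - (x + s%:C%C *: n x))).
      by rewrite addrA [_ + (v - _)]addrC subrK.
    set v' := v - _ in Hv *.
    have nv' : vnorm v' <= s * del.
      by apply: le_trans (ltW Hv) _; rewrite ler_pM2r.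
    have nh : vnorm (s%:C%C *: n x + v') <= s * N'.
      apply: le_trans (vnormD _ _) _; rewrite vnorm_rscale gtr0_norm // /N' mulrDr.
      by apply: lerD => //; rewrite ler_pM2l // nN.
    apply: H.
      apply: le_lt_trans nh _; move: sr; rewrite ler_pdivlMr // => sr.
      by move: sr rho0; clear -d; lra.
    rewrite appD appZ appn // mulr1 cReD /=.
    have av' : `|complex.Re (app (u x) v')| <= s / 2.
      apply: le_trans (Re_nm _) _; apply: le_trans (uS x v' bx xx) _.
      apply: (@le_trans _ _ (S * (s * del))); first by rewrite ler_pM2l.
      by move: (ler_wpM2l (ltW s0) delS); clear -d; lra.
    have hA : A * (vnorm (s%:C%C *: n x + v') `^ alpha * vnorm (s%:C%C *: n x + v')) <= s / 4.
      apply: (@le_trans _ _ (A * ((s * N') `^ alpha * (s * N')))).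
        apply: ler_wpM2l; first exact: ltW.
        apply: ler_pM; rewrite ?powR_ge0 ?vnorm_ge0 //.
        by apply: ge0_ler_powR; rewrite ?nnegrE ?vnorm_ge0 ?(ltW al0) // mulr_ge0 // ltW.
      rewrite powRM ?(ltW s0) ?(ltW N'0) //.
      have := He3 s (ltW s0) se3; rewrite (ler_pdivlMr _ _ AN).
      by move=> h; move: (ler_wpM2l (ltW s0) h); clear -d; lra.
    by move: av' hA s0; rewrite ler_norml; clear -d; lra.
  - have -> : x + s%:C%C *: n x - (x + t%:C%C *: (o - x)) = s%:C%C *: n x - t%:C%C *: (o - x).
      by rewrite opprD addrACA subrr add0r.
    apply: le_trans (vnormB _ _) _; rewrite !vnorm_rscale !gtr0_norm //.
    have h1 : s * vnorm (n x) <= 2 * t * Nn.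
      by apply: ler_pM; rewrite ?vnorm_ge0 ?nN // ltW.
    have h2 : t * vnorm (o - x) <= t * E by rewrite ler_pM2l // ox.
    have h3 : t * K <= t * (m%:R * del) by rewrite ler_pM2l.
    by move: h1 h2 h3; rewrite /K; clear -d; lra.
pose C := A + S * E + (Cg + Cg + B) + 1.
have SE : 0 <= S * E by rewrite mulr_ge0 // ltW.
have C0 : 0 < C by move: A0 SE Cg0 B0; rewrite /C; clear -d; lra.
have CA : A <= C by move: A0 SE Cg0 B0; rewrite /C; clear -d; lra.
have CSE : S * E <= C by move: A0 SE Cg0 B0; rewrite /C; clear -d; lra.
have CB : Cg + Cg + B <= C by move: A0 SE Cg0 B0; rewrite /C; clear -d; lra.
exists eta, C, u; split; [exact: eta0 | exact: C0 |] => x bx.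
rewrite !lt_min => /andP[/andP[xx _] _].
have [xr _ _ _] := near x bx xx; have [H1 H2 H3] := Hu x bx xr.
split.
- exact: H1.
- move=> h; apply: le_trans (H3 h) _; apply: ler_wpM2r; last exact: CA.
  by rewrite mulr_ge0 ?powR_ge0 ?vnorm_ge0.
- apply: le_trans (uS x _ bx xx) _; apply: (@le_trans _ _ (S * E)); last exact: CSE.
  by rewrite ler_pM2l // ox.
- move=> t e t0 te ee; have e0 : 0 < e by exact: lt_le_trans t0 te.
  (* The path goes from the ray to the slice at the dyadic level e / 2^k in [t, 2t], along the slice
     to depth e, and back to the ray. As e / 2^k >= t, the k halvings cost at most ln (e / t) / 2
     plus a constant. *)
  have [k [k1 k2]] := dyadic_between t e t0 te.
  have p2 : 0 < (2 : R) ^+ k by rewrite exprn_gt0.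
  have se : e / 2 ^+ k <= eta.
    by apply: le_trans ee; rewrite ler_pdivrMr // ler_peMr ?(ltW e0) // exprn_ege1 // ler1n.
  have ee2 : e <= e2 by move: ee; rewrite !le_min => /andP[/andP[_ ?] _].
  have c1 := step x t _ bx xx t0 k1 k2 se.
  have c2 := chain_le_sym _ _ _ _ (desc Omega x (n x) (slice x bx xx) e k e0 ee2).
  have e2e : e <= 2 * e by rewrite ler_peMl ?(ltW e0) // ler1n.
  have c3 := chain_le_sym _ _ _ _ (step x e e bx xx e0 (lexx e) e2e ee).
  apply: chain_leW (chain_le_trans _ _ _ _ _ _ (chain_le_trans _ _ _ _ _ _ c1 c2) c3).
  have : k%:R * ln 2 <= ln (e / t).
    have -> : k%:R * ln 2 = ln (2 ^+ k) :> R by rewrite lnXn // mulr_natl.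
    rewrite ler_ln ?posrE ?divr_gt0 // ler_pdivlMr // mulrC -ler_pdivlMr //.
  by move: CB; clear -d; lra.
Qed.

End BoundaryChart.

(** * Gromov products near the boundary *)

Section GromovProducts.
Context {R : realType} {d : nat}.
Local Notation nm := (@normc R).
Local Notation V := (Cvec R d).
Implicit Types (p q o x y z v w h n : V) (Omega : set V) (s t : R).

Lemma chain_le_interior Omega (D : R) : convex_set Omega -> bounded_set Omega ->
  0 < D -> exists C : R, forall p q, Omega q -> Omega p ->
  (forall v, vnorm (v - p) < D -> Omega v) -> (forall v, vnorm (v - q) < D -> Omega v) ->
  chain_le Omega p q C.
Proof.
move=> cO /bounded_vnorm[B B0 bB] D0.
pose m := Num.bound ((B + B) / D).
exists ((2 * m)%N.+1%:R * half_step) => p q Oq Op bp bq.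
eexists; last exact: lexx.
apply: (chain_between_balls _ _ _ D m) => //.
apply: (@le_trans _ _ (B + B)); first by apply: le_trans (vnormB _ _) (lerD (bB _ Oq) (bB _ Op)).
by rewrite -ler_pdivrMr // ltW // archi_boundP // divr_ge0 ?addr_ge0 // ltW.
Qed.

Lemma chain_le_small Omega p (e : R) : open Omega -> Omega p -> 0 < e ->
  exists2 r, 0 < r & forall q, vnorm (q - p) < r -> chain_le Omega p q e.
Proof.
move=> oO Op e0; have [D D0 HD] := (open_vecP _).1 oO p Op.
(* For t <= 1/2 the Poincare distance from 0 to t is at most 2t, hence at most e. *)
pose t : R := Num.min (1 / 2) (e / 2).
have t0 : 0 < t by rewrite lt_min; apply/andP; split; lra.
have t12 : t <= 1 / 2 by rewrite ge_min lexx.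
have te : t <= e / 2 by rewrite ge_min lexx orbT.
exists (t * D); first by rewrite mulr_gt0.
move=> q qp; pose h := (t^-1)%:C%C *: (q - p).
have hd : holomorphic_disc Omega (fun z : Cplx R => p + z *: h).
  apply: holomorphic_affine => z z1; apply: HD; rewrite addrAC subrr add0r vnormZ.
  have hD : vnorm h < D.
    by rewrite vnorm_rscale gtr0_norm ?invr_gt0 // mulrC ltr_pdivrMr // mulrC.
  apply: le_lt_trans hD; by rewrite ler_piMl ?vnorm_ge0 // ltW.
have n0 : nm (0 : Cplx R) < 1 by rewrite nm0.
have nt : nm t%:C%C < 1 by rewrite nmC gtr0_norm //; lra.
have := chain_cons _ _ t%:C%C 0 _ 0 hd nt n0 (chain_nil _ _).
rewrite scale0r !addr0 /h scalerA -rmorphM divff ?gt_eqF // rmorph1 scale1r addrC subrK.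
move=> /chain_sym H; eexists; first exact: H.
rewrite -[0]/(0%:C%C : R[i]) poincare_real; [|lra|exact: ltW|lra].
rewrite subr0 addr0 !mulr1 ler_pdivrMr //.
have -> : (1 + t) / (1 - t) = 1 + 2 * t / (1 - t) by field; lra.
have h1 : 2 * t / (1 - t) <= 4 * t by rewrite ler_pdivrMr; nra.
have h0 : 0 < 2 * t / (1 - t) by rewrite divr_gt0 ?mulr_gt0 //; lra.
by apply: le_trans (le_ln1Dx _) _; lra.
Qed.

(** Each coordinate plus [D + 1] maps [Omega] into the right half-plane with modulus at most 2D + 1,
    so [chain_lipschitz] applies to it. *)
Lemma chain_norm_le Omega : bounded_set Omega -> exists2 C, 0 < C &
  forall p q L, Omega q -> chain Omega p q L -> vnorm (q - p) <= C * L.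
Proof.
move=> /bounded_vnorm[D D0 bD]; pose B := 2 * D + 1.
exists (4 * B); first by rewrite /B; lra.
move=> p q L Oq HL; have L0 := chain_length_ge0 _ _ _ _ HL.
have appE i v : app (delta_mx i ord0) v = v ord0 i.
  rewrite /app mxE (bigD1 i) //= big1 ?addr0 => [|j ji]; rewrite !mxE ?eqxx ?mulr1 //.
  by rewrite (negPf ji) mulr0.
apply/vnorm_le => [|i]; first by rewrite mulr_ge0 // /B; lra.
have := chain_lipschitz Omega (delta_mx i ord0) (D + 1)%:C%C B p q L _ _ HL.
rewrite !appE !mxE; apply.
- move=> v Ov; rewrite appE cReD /=.
  have : `|complex.Re (v ord0 i)| <= D.
    by apply: le_trans (Re_nm _) (le_trans (nm_entry v i) (bD v Ov)).
  by rewrite ler_norml; lra.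
- move=> v Ov; rewrite appE; apply: le_trans (nmD _ _) _.
  rewrite nmC ger0_norm; last by lra.
  by have := le_trans (nm_entry v i) (bD v Ov); rewrite /B; lra.
Qed.

(** The functional at [p] is exactly t times its value at [o], and [chain_modulus] limits the growth
    from [p] to [o] to the factor exp (2L). *)
Lemma chain_modulus_ratio Omega (u : 'cV[Cplx R]_d) x o p t L :
  (forall z, Omega z -> 0 < complex.Re (app u (z - x))) -> Omega o ->
  p = x + t%:C%C *: (o - x) -> 0 < t -> chain Omega p o L -> ln (t^-1) / 2 <= L.
Proof.
move=> pos Oo pE t0 HL.
have appE v : app u v + - app u x = app u (v - x) by rewrite appB.
have := chain_modulus Omega u (- app u x) p o L _ HL.
rewrite !appE => H.
have {H} : nm (app u (o - x)) <= nm (app u (p - x)) * expR (2 * L).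
  by apply: H => v Ov; rewrite appE; exact: pos.
have -> : p - x = t%:C%C *: (o - x) by rewrite pE addrAC subrr add0r.
rewrite appZ normcM nmC gtr0_norm // => H.
have k0 : 0 < nm (app u (o - x)).
  by apply: lt_le_trans (pos o Oo) _; apply: le_trans (ler_norm _) (Re_nm _).
have h1 : t^-1 <= expR (2 * L).
  rewrite -[t^-1]mul1r ler_pdivrMr //.
  rewrite -(ler_pM2l k0) mulr1; apply: le_trans H _.
  by rewrite le_eqVlt; apply/orP; left; apply/eqP; ring.
have : ln (t^-1) <= 2 * L by rewrite -ler_expR lnK // posrE invr_gt0.
lra.
Qed.

Lemma small_ln (M : R) : exists2 e : R, 0 < e & ln e < - M.
Proof. by exists (expR (- M - 1)); [exact: expR_gt0 | rewrite expRK; lra]. Qed.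

Lemma radial_representation Omega o x0 (e : R) : open Omega -> bounded_set Omega ->
  convex_set Omega -> Omega o -> boundary Omega x0 -> 0 < e ->
  exists2 r, 0 < r & forall p, Omega p -> vnorm (p - x0) < r ->
  exists x t, [/\ boundary Omega x, vnorm (x - x0) < e, 0 < t <= 1, t < e &
     p = x + t%:C%C *: (o - x)].
Proof.
move=> oO bO cO Oo bx0 e0; have [clx0 nx0] := (boundaryP _ _ oO).1 bx0.
have [D D0 bD] := bounded_vnorm _ bO.
have [r0 r00 Hr0] := (open_vecP _).1 oO o Oo.
have ox0 : 0 < vnorm (o - x0).
  by apply: vnorm_gt0; apply/eqP => /eqP; rewrite subr_eq0 => /eqP E; apply: nx0; rewrite -E.
have K0 : 0 < 1 + (2 * D + 1) / r0.
  by rewrite addr_gt0 // divr_gt0 // addr_gt0 // mulr_gt0.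
(* The first bound excludes p = o, which has no radial direction. *)
exists (Num.min (vnorm (o - x0)) (Num.min (e * r0) (e / (1 + (2 * D + 1) / r0)))).
  by rewrite !lt_min ox0 mulr_gt0 //= divr_gt0.
move=> p Op; rewrite !lt_min => /andP[p1 /andP[p2 p3]].
have po : p != o by apply: contraTneq p1 => ->; rewrite ltxx.
have [x [t [bx t01 pE]]] := radial_boundary_point _ _ _ oO bO Oo Op po.
have [clx _] := (boundaryP _ _ oO).1 bx.
have [h1 h2] := radial_boundary_near _ _ _ _ _ _ _ _ cO bD Hr0 r00 clx t01 pE nx0.
exists x, t; split => //.
- by apply: le_lt_trans h2 _; rewrite mulrC -ltr_pdivlMr.
- by apply: le_lt_trans h1 _; rewrite ltr_pdivrMr.
Qed.

(* a and b are half the logarithms of 1/t and 1/s, where p = x + t(o - x) and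
   q = y + s(o - y): the Gromov product of p and q based at o is at least M / 2. *)
Lemma same_boundary_point Omega (alpha M : R) o x0 : 0 < alpha -> open Omega ->
  bounded_set Omega -> convex_set Omega -> has_C1alpha_boundary alpha Omega ->
  Omega o -> boundary Omega x0 -> exists2 r, 0 < r & forall p q, Omega p -> Omega q ->
  vnorm (p - x0) < r -> vnorm (q - x0) < r -> exists a b : R,
  [/\ chain_le Omega p q (a + b - M), M <= a,
      (forall L, chain Omega p o L -> a <= L) & forall L, chain Omega q o L -> b <= L].
Proof.
move=> al0 oO bO cO bC Oo bx0.
have [eta [C [u [eta0 C0 H]]]] := boundary_chart Omega alpha o x0 al0 oO bO cO bC Oo bx0.
have [D D0 bD] := bounded_vnorm _ bO.
have [r0 r00 Hr0] := (open_vecP _).1 oO o Oo.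
pose m := Num.bound (2 / r0); pose Cg := (2 * m)%N.+1%:R * (half_step : R).
have mr : 2 <= m%:R * r0 by rewrite -ler_pdivrMr // ltW // archi_boundP // divr_ge0 // ltW.
(* Going up to depth e from both points and crossing there costs a + b + ln e + 2C + Cg, so [e1]
   gives the gain M; [e2] gives M <= a because t < e. *)
have [e1 e10 He1] := small_ln (M + 2 * C + Cg).
have [e2 e20 He2] := small_ln (2 * M).
pose e := Num.min (Num.min e1 e2) (Num.min eta 1).
have e0 : 0 < e by rewrite !lt_min e10 e20 eta0 ltr01.
have ee1 : e <= e1 by rewrite !ge_min lexx.
have ee2 : e <= e2 by rewrite !ge_min lexx orbT.
have eeta : e <= eta by rewrite !ge_min lexx !orbT.
have le1 : e <= 1 by rewrite !ge_min lexx !orbT.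
have [r r_0 Hr] := radial_representation Omega o x0 e oO bO cO Oo bx0 e0.
exists r => // p q Op Oq pr qr.
have [x [t [bx xx /andP[t0 t1] te pE]]] := Hr p Op pr.
have [y [s [by_ yy /andP[s0 s1] se qE]]] := Hr q Oq qr.
have [Hx _ _ Ux] := H x bx (lt_le_trans xx eeta).
have [Hy _ _ Uy] := H y by_ (lt_le_trans yy eeta).
exists (ln (t^-1) / 2), (ln (s^-1) / 2); split.
- have c1 := Ux t e t0 (ltW te) eeta; rewrite -pE in c1.
  have c3 := chain_le_sym _ _ _ _ (Uy s e s0 (ltW se) eeta); rewrite -qE in c3.
  have c2 : chain_le Omega (x + e%:C%C *: (o - x)) (y + e%:C%C *: (o - y)) Cg.
    exists Cg => //; apply: (chain_between_balls _ _ _ (e * r0) m) => //.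
    + by rewrite mulr_gt0.
    + move=> v; apply: convex_ball_closure => //; last by rewrite e0.
      by have [] := (boundaryP _ _ oO).1 bx.
    + move=> v; apply: convex_ball_closure => //; last by rewrite e0.
      by have [] := (boundaryP _ _ oO).1 by_.
    + have -> : y + e%:C%C *: (o - y) - (x + e%:C%C *: (o - x)) = (1 - e)%:C%C *: (y - x).
        by rewrite rmorphB rmorph1; apply/rowP => i; rewrite !mxE; ring.
      rewrite vnorm_rscale ger0_norm ?subr_ge0 //.
      apply: (@le_trans _ _ (1 * vnorm (y - x))).
        by apply: ler_wpM2r; [exact: vnorm_ge0 | lra].
      rewrite mul1r; apply: le_trans (vnorm_distD x0 _ _) _.
      rewrite [vnorm (x0 - x)]vnorm_distC.
      have := ler_wpM2l (ltW e0) mr; lra.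
  apply: chain_leW (chain_le_trans _ _ _ _ _ _ (chain_le_trans _ _ _ _ _ _ c1 c2) c3).
  rewrite !lnM ?posrE ?invr_gt0 //.
  have : ln e <= ln e1 by rewrite ler_ln ?posrE.
  lra.
- have : ln t < - (2 * M).
    by apply: le_lt_trans He2; rewrite ler_ln ?posrE // (le_trans (ltW te)).
  rewrite lnV ?posrE //; lra.
- by move=> L; exact: (chain_modulus_ratio _ _ _ _ _ _ _ Hx Oo pE t0).
- by move=> L; exact: (chain_modulus_ratio _ _ _ _ _ _ _ Hy Oo qE s0).
Qed.

Lemma compact_closure_bounded Omega : bounded_set Omega -> compact (closure Omega).
Proof.
move=> /bounded_vnorm[D D0 bD].
have cK : compact [set v : V | forall i, [set z : Cplx R | nm z <= D + 1] (v ord0 i)].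
  by apply: (@rV_compact (Cplx R) d (fun=> [set z : Cplx R | nm z <= D + 1])) => i; exact: compact_disc.
apply: subclosed_compact cK _; first exact: closed_closure.
move=> v /closure_vecP /(_ 1 ltr01)[y Oy yv] i /=.
apply: le_trans (nm_entry v i) _.
rewrite -(subrK y v); apply: le_trans (vnormD _ _) _.
by rewrite addrC vnorm_distC; apply: lerD; [exact: bD | exact: ltW].
Qed.

Lemma continuous_nm_app (u : 'cV[Cplx R]_d) x :
  continuous (fun z : V => nm (app u (z - x)) : R).
Proof.
move=> z; apply/continuous_realP => e e0.
pose S := \sum_i nm (u i ord0) + 1.
have S0 : 0 < S by rewrite ltr_wpDl // sumr_ge0 // => i _; exact: nm_ge0.
apply/nbhs_vecP; exists (e / S); first by rewrite divr_gt0.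
move=> y; rewrite ltr_pdivlMr // => yz.
have h (a b : R[i]) : `|nm a - nm b| <= nm (a - b).
  rewrite ler_norml; have := nmD (a - b) b; have := nmD (b - a) a.
  by rewrite !subrK (nm_distC b a); lra.
apply: le_lt_trans (h _ _) _; rewrite -appB opprB addrA subrK.
apply: le_lt_trans (nm_app _ _) _; apply: le_lt_trans yz; rewrite mulrC.
by apply: ler_wpM2l; [exact: vnorm_ge0 | rewrite /S lerDl].
Qed.

Lemma one_of_two_large (a1 a2 h1 h2 c : R) : 0 < c -> 8 * c <= a1 + a2 ->
  a1 - h1 <= c -> a2 - h2 <= c -> c < h1 \/ c < h2.
Proof. by move=> c0 aa e1 e2; have [h|h] := ltP c h1; [left | right; lra]. Qed.

Lemma log_end_bound (lk lt C1 C2 Ci l1 l2 l3 : R) : lk <= 0 -> 0 < C2 ->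
  (lk + lt) / 2 + C1 + Ci <= lt / 2 + (C1 + C2 + `|Ci| + `|l1| + `|l2| + `|l3|).
Proof.
move=> lk0 C20; have := ler_norm Ci; have := normr_ge0 l1; have := normr_ge0 l2.
have := normr_ge0 l3; lra.
Qed.

Lemma log_length_bound (lt ls lc l1 l2 C1 C2 Ci L : R) : 0 < C1 -> 0 < C2 ->
  lc + lc <= lt + l1 + (ls + l2) + 2 * L ->
  - lt / 2 + - ls / 2 - (C1 + C2 + `|Ci| + `|lc| + `|l1| + `|l2|) <= L.
Proof.
move=> C10 C20 h; have := normr_ge0 Ci; have := ler_norm (- lc); rewrite normrN.
have := normr_ge0 lc; have := ler_norm l1; have := normr_ge0 l1.
have := ler_norm l2; have := normr_ge0 l2; lra.
Qed.

(* The Gromov product stays bounded: every chain from p to q has to leave both zones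
   where one of the two supporting functionals is small, and C-strict convexity makes
   these zones disjoint. *)
Lemma distinct_boundary_points Omega (alpha : R) o x0 y0 : 0 < alpha -> open Omega ->
  bounded_set Omega -> C_strictly_convex Omega -> has_C1alpha_boundary alpha Omega ->
  Omega o -> boundary Omega x0 -> boundary Omega y0 -> x0 != y0 ->
  exists2 r, 0 < r & exists C : R, forall p q, Omega p -> Omega q ->
  vnorm (p - x0) < r -> vnorm (q - y0) < r -> exists a b : R,
  [/\ chain_le Omega p o (a + C), chain_le Omega q o (b + C) &
      forall L, chain Omega p q L -> a + b - C <= L].
Proof.
move=> al0 oO bO [cO sO] bC Oo bx0 by0 xy0.
have [eta1 [C1 [u1 [eta10 C10 H1]]]] := boundary_chart Omega alpha o x0 al0 oO bO cO bC Oo bx0.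
have [eta2 [C2 [u2 [eta20 C20 H2]]]] := boundary_chart Omega alpha o y0 al0 oO bO cO bC Oo by0.
have [D D0 bD] := bounded_vnorm _ bO.
have [r0 r00 Hr0] := (open_vecP _).1 oO o Oo.
(* The complex hyperplane where the functional vanishes avoids [Omega] and passes through [z0], so
   C-strict convexity leaves [z0] as its only point in the closure. *)
have supp (u : V -> 'cV[Cplx R]_d) z0 : boundary Omega z0 ->
    (forall z, Omega z -> 0 < complex.Re (app (u z0) (z - z0))) ->
    forall z, closure Omega z -> app (u z0) (z - z0) = 0 -> z = z0.
  move=> bz0 pos z clz Ez.
  have bz : boundary Omega z.
    by apply/boundaryP => //; split => // /pos; rewrite Ez ltxx.
  have [|w Hw] := sO [set v | (v *m u z0) ord0 ord0 = app (u z0) z0].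
    split.
    - exists (u z0), (app (u z0) z0); split => //.
      apply/eqP => u0; have := pos o Oo; rewrite /app u0 mulmx0 mxE ltxx //.
    - by exists z0; split.
    - rewrite -subset0 => v [/= Hv Ov]; have := pos v Ov.
      by rewrite appB {1}/app Hv subrr ltxx.
  have E v : boundary Omega v -> app (u z0) (v - z0) = 0 -> v = w.
    move=> bv Ev; suff : [set w] v by [].
    rewrite -Hw; split => //=; apply/eqP; rewrite -subr_eq0 -/(app (u z0) v) -appB Ev //.
  by rewrite (E z) // (E z0) // subrr app0.
have n1 : vnorm (x0 - x0) < eta1 by rewrite subrr vnorm0.
have n2 : vnorm (y0 - y0) < eta2 by rewrite subrr vnorm0.
have [P1 _ _ _] := H1 x0 bx0 n1; have [P2 _ _ _] := H2 y0 by0 n2.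
(* A zero of [F] in the closure would equal both [x0] and [y0]; by compactness [F] has a positive
   minimum. *)
pose F z : R := nm (app (u1 x0) (z - x0)) + nm (app (u2 y0) (z - y0)).
have [z0 z0K zmin] : exists2 c, c \in closure Omega & forall v, v \in closure Omega -> F c <= F v.
  apply: compact_EVT_min.
  - by exists o; exact: subset_closure.
  - exact: compact_closure_bounded.
  - apply: continuous_subspaceT => z.
    exact: (@ctsD R _ _ _ _ (continuous_nm_app (u1 x0) x0 z) (continuous_nm_app (u2 y0) y0 z)).
rewrite inE in z0K.
have F0 : 0 < F z0.
  rewrite lt_def; apply/andP; split; last by rewrite addr_ge0 ?nm_ge0.
  apply/eqP => FE; move/eqP: xy0; apply.
  have /andP[/eqP E1 /eqP E2] : (nm (app (u1 x0) (z0 - x0)) == 0) && (nm (app (u2 y0) (z0 - y0)) == 0).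
    by rewrite -paddr_eq0 ?nm_ge0 //; apply/eqP.
  rewrite -(supp u1 x0 bx0 P1 z0 z0K (eq0_normc E1)).
  by rewrite -(supp u2 y0 by0 P2 z0 z0K (eq0_normc E2)).
(* The sum of the moduli is at least 8c. Changing both base points costs at most 2c in all, so one
   modulus still exceeds c. *)
pose c := F z0 / 8; have c0 : 0 < c by rewrite divr_gt0.
pose E := 2 * D + 1; have E0 : 0 < E by rewrite /E; lra.
(* Replacing [w0] by a nearby [x] costs c/2 for the Hoelder dependence of the functional and c/2 for
   the displacement of its zero. *)
have move_base (u : V -> 'cV[Cplx R]_d) w0 (C : R) (eta : R) : boundary Omega w0 -> 0 < C -> 0 < eta ->
    (forall x, boundary Omega x -> vnorm (x - w0) < eta ->
      forall h, nm (app (u x) h - app (u w0) h) <= C * (vnorm (x - w0) `^ alpha * vnorm h)) ->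
    exists2 r, 0 < r & forall x z, boundary Omega x -> vnorm (x - w0) < r -> Omega z ->
      nm (app (u w0) (z - w0)) - nm (app (u x) (z - x)) <= c.
  move=> bw0 C0 eta0 Hu.
  have c2 : 0 < c / 2 / (C * E) by rewrite !divr_gt0 // mulr_gt0.
  have [e1 e10 He1] := powR_small _ _ al0 c2.
  pose S := \sum_i nm (u w0 i ord0) + 1.
  have S0 : 0 < S by rewrite ltr_wpDl // sumr_ge0 // => i _; exact: nm_ge0.
  exists (Num.min eta (Num.min e1 (c / 2 / S))).
    by rewrite !lt_min eta0 e10 !divr_gt0.
  move=> x z bx; rewrite !lt_min => /andP[x1 /andP[x2 x3]] Oz.
  have hz : vnorm (z - x) <= E.
    have [clx _] := (boundaryP _ _ oO).1 bx.
    exact (closure_dist_le _ _ _ _ bD Oz clx).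
  have h1 : nm (app (u x) (z - x) - app (u w0) (z - x)) <= c / 2.
    apply: le_trans (Hu x bx x1 _) _.
    have := He1 _ (vnorm_ge0 _) (ltW x2); rewrite ler_pdivlMr ?mulr_gt0 // => h.
    have : C * (vnorm (x - w0) `^ alpha * vnorm (z - x)) <= C * (vnorm (x - w0) `^ alpha * E).
      by rewrite ler_pM2l // ler_wpM2l ?powR_ge0.
    lra.
  have h2 : nm (app (u w0) (x - w0)) <= c / 2.
    apply: le_trans (nm_app _ _) _; apply: (@le_trans _ _ (S * vnorm (x - w0))).
      by apply: ler_wpM2r; [exact: vnorm_ge0 | rewrite /S lerDl].
    by move: x3; rewrite ltr_pdivlMr //; lra.
  have -> : app (u w0) (z - w0) = app (u x) (z - x) +
      ((app (u w0) (z - x) - app (u x) (z - x)) + app (u w0) (x - w0)).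
    have b : app (u w0) (z - x) + app (u w0) (x - w0) = app (u w0) (z - w0).
      by rewrite -appD addrA subrK.
    by rewrite -b [RHS]addrA; congr (_ + _); rewrite addrC subrK.
  have := nmD (app (u x) (z - x)) ((app (u w0) (z - x) - app (u x) (z - x)) + app (u w0) (x - w0)).
  have := nmD (app (u w0) (z - x) - app (u x) (z - x)) (app (u w0) (x - w0)).
  by rewrite (nm_distC (app (u w0) (z - x))) => l1 l2; rewrite lerBlDl (le_trans l2) // lerD2l
    (le_trans l1) // [c]splitr lerD.
have [s1 s10 Hs1] := move_base u1 x0 C1 eta1 bx0 C10 eta10
  (fun x bx xx => let: And4 _ h _ _ := H1 x bx xx in h).
have [s2 s20 Hs2] := move_base u2 y0 C2 eta2 by0 C20 eta20
  (fun x bx xx => let: And4 _ h _ _ := H2 x bx xx in h).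
pose Ct := Num.max C1 C2; have Ct0 : 0 < Ct by rewrite lt_max C10.
(* A depth fixed independently of [p] and [q]: both charts are valid up to it, and from it [o] is
   reached at bounded cost. *)
have [k [k0 k1 k2 k11]] : exists k, [/\ 0 < k, k <= eta1, k <= eta2 & k <= 1].
  exists (Num.min (Num.min eta1 eta2) 1).
  by rewrite !lt_min eta10 eta20 ltr01 !ge_min !lexx !orbT.
have lk : ln k <= 0 by rewrite -ln1 ler_ln ?posrE.
have [Ci HCi] := chain_le_interior Omega (k * r0) cO bO (mulr_gt0 k0 r00).
(* The bound c / Ct starts [p] and [q] in the zones where their own functional is at most c, as
   [chain_crossing] requires. *)
pose e := Num.min (Num.min k (Num.min s1 s2)) (c / Ct).
have cCt : 0 < c / Ct by rewrite divr_gt0.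
have e0 : 0 < e by rewrite /e !lt_min k0 s10 s20 cCt.
have ek : e <= k by rewrite /e !ge_min lexx.
have es1 : e <= s1 by rewrite /e !ge_min lexx !orbT.
have es2 : e <= s2 by rewrite /e !ge_min lexx !orbT.
have ec : e <= c / Ct by rewrite /e !ge_min lexx !orbT.
have [r1 r10 R1] := radial_representation Omega o x0 e oO bO cO Oo bx0 e0.
have [r2 r20 R2] := radial_representation Omega o y0 e oO bO cO Oo by0 e0.
have to_o x : boundary Omega x -> chain_le Omega (x + k%:C%C *: (o - x)) o Ci.
  move=> bx; have [clx _] := (boundaryP _ _ oO).1 bx.
  have bk : forall v, vnorm (v - (x + k%:C%C *: (o - x))) < k * r0 -> Omega v.
    by apply: convex_ball_closure => //; rewrite k0.
  apply: HCi => //.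
    by apply: bk; rewrite subrr vnorm0 mulr_gt0.
  by move=> v Hv; apply: Hr0; apply: lt_le_trans Hv _; rewrite ler_piMl // ltW.
have small u x p t (K : R) : p = x + t%:C%C *: (o - x) -> 0 < t -> t < e -> K <= Ct ->
    nm (app u (o - x)) <= K -> nm (app u (p - x)) <= t * K /\ nm (app u (p - x)) <= c.
  move=> pE t0 te KC uK.
  have -> : p - x = t%:C%C *: (o - x) by rewrite pE addrAC subrr add0r.
  rewrite appZ normcM nmC gtr0_norm //; split; first by rewrite ler_pM2l.
  apply: (@le_trans _ _ (t * Ct)); first by rewrite ler_pM2l // (le_trans uK).
  by rewrite -ler_pdivlMr // (le_trans (ltW te)).
exists (Num.min r1 r2); first by rewrite lt_min r10.
exists (C1 + C2 + `|Ci| + `|ln c| + `|ln C1| + `|ln C2|) => p q Op Oq.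
rewrite !lt_min => /andP[p1 _] /andP[_ q2].
have [x [t [bx xx /andP[t0 t1] te pE]]] := R1 p Op p1.
have [y [s [by_ yy /andP[s0 s1'] se qE]]] := R2 q Oq q2.
have [Px _ Kx Ux] := H1 x bx (lt_le_trans xx (le_trans ek k1)).
have [Py _ Ky Uy] := H2 y by_ (lt_le_trans yy (le_trans ek k2)).
exists (ln (t^-1) / 2), (ln (s^-1) / 2); split.
- have c1 := Ux t k t0 (ltW (lt_le_trans te ek)) k1; rewrite -pE in c1.
  apply: chain_leW (chain_le_trans _ _ _ _ _ _ c1 (to_o x bx)).
  by rewrite lnM ?posrE ?invr_gt0 // log_end_bound.
- have c1 := Uy s k s0 (ltW (lt_le_trans se ek)) k2; rewrite -qE in c1.
  apply: chain_leW (chain_le_trans _ _ _ _ _ _ c1 (to_o y by_)).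
  rewrite lnM ?posrE ?invr_gt0 // [C1 + C2]addrC log_end_bound //.
- move=> L HL.
  have C1t : C1 <= Ct by rewrite le_max lexx.
  have C2t : C2 <= Ct by rewrite le_max lexx orbT.
  have [g1 g1c] := small (u1 x) x p t C1 pE t0 te C1t Kx.
  have [g2 g2c] := small (u2 y) y q s C2 qE s0 se C2t Ky.
  have appE (u : 'cV[Cplx R]_d) w v : app u v + - app u w = app u (v - w) by rewrite appB.
  have := chain_crossing Omega (u1 x) (u2 y) (- app (u1 x) x) (- app (u2 y) y) c p q L.
  rewrite !appE => /(_ _ _ _ c0 HL Oq g1c g2c) H.
  have {H} : c ^+ 2 <= nm (app (u1 x) (p - x)) * nm (app (u2 y) (q - y)) * expR (2 * L).
    apply: H => v Ov; rewrite !appE; [exact: Px | exact: Py |].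
    have m1 := Hs1 x v bx (lt_le_trans xx es1) Ov.
    have m2 := Hs2 y v by_ (lt_le_trans yy es2) Ov.
    have := zmin v; rewrite inE => /(_ (subset_closure Ov)).
    have FE : F z0 = 8 * c by rewrite /c mulrC divfK.
    rewrite FE /F => Fv.
    exact (one_of_two_large _ _ _ _ _ c0 Fv m1 m2).
  have gt : nm (app (u1 x) (p - x)) * nm (app (u2 y) (q - y)) <= t * C1 * (s * C2).
    by apply: ler_pM; rewrite ?nm_ge0.
  move=> h; have {h gt} h : c ^+ 2 <= t * C1 * (s * C2) * expR (2 * L).
    by apply: le_trans h _; rewrite ler_pM2r // expR_gt0.
  have tC : 0 < t * C1 by rewrite mulr_gt0.
  have sC : 0 < s * C2 by rewrite mulr_gt0.
  have : ln (c ^+ 2) <= ln (t * C1 * (s * C2) * expR (2 * L)).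
    by rewrite ler_ln ?posrE ?exprn_gt0 // !mulr_gt0 // expR_gt0.
  rewrite lnXn // lnM ?posrE ?expR_gt0 ?mulr_gt0 // expRK (lnM tC sC).
  rewrite (lnM t0 C10) (lnM s0 C20) (lnV t0) (lnV s0) mulr2n.
  exact: log_length_bound.
Qed.

End GromovProducts.

(** * Extension of isometric embeddings *)

Section IsometricEmbedding.
Context {R : realType} {d1 d2 : nat}.
Variables (Omega1 : set (Cvec R d1)) (Omega2 : set (Cvec R d2)).
Variable f : Cvec R d1 -> Cvec R d2.
Hypothesis fK : kobayashi_isometric_embedding Omega1 Omega2 f.

(** A single chain upstairs bounds one infimum from above and a bound for all chains downstairs
    bounds the other from below; equality of the two extended reals compares them. *)
Lemma isometry_lower p q (L M : R) : Omega1 p -> Omega1 q -> chain_le Omega1 p q L ->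
  (forall L', chain Omega2 (f p) (f q) L' -> M <= L') -> M <= L.
Proof.
move=> Op Oq [L0 HL0 LL] H; apply: le_trans LL; rewrite -lee_fin.
apply: le_trans (kobayashi_ge _ _ _ _ H) _; rewrite fK.2 //.
exact: kobayashi_le.
Qed.

Lemma isometry_upper p q (L M : R) : Omega1 p -> Omega1 q ->
  chain_le Omega2 (f p) (f q) L ->
  (forall L', chain Omega1 p q L' -> M <= L') -> M <= L.
Proof.
move=> Op Oq [L0 HL0 LL] H; apply: le_trans LL; rewrite -lee_fin.
apply: le_trans (kobayashi_ge _ _ _ _ H) _; rewrite -fK.2 //.
exact: kobayashi_le.
Qed.

End IsometricEmbedding.

(** * Extension by continuity and cluster values *)

Section Extension.
Context {R : realType} {d1 d2 : nat}.

Lemma extension_by_continuity (Omega1 : set (Cvec R d1)) (Omega2 : set (Cvec R d2))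
    (f : Cvec R d1 -> Cvec R d2) :
  (forall p, Omega1 p -> Omega2 (f p)) ->
  (forall x, closure Omega1 x -> exists y, (Omega1 x -> y = f x) /\
    forall e : R, 0 < e -> exists2 r : R, 0 < r &
      forall p, Omega1 p -> vnorm (p - x) < r -> vnorm (f p - y) < e) ->
  exists fbar : Cvec R d1 -> Cvec R d2,
    [/\ {within closure Omega1, continuous fbar},
        forall z, closure Omega1 z -> closure Omega2 (fbar z) &
        forall z, Omega1 z -> fbar z = f z].
Proof.
move=> fO lim.
(* The value 0 off the closure makes the choice total. *)
have /choice [g Hg] x : exists y, closure Omega1 x -> (Omega1 x -> y = f x) /\
    forall e : R, 0 < e -> exists2 r : R, 0 < r &
      forall p, Omega1 p -> vnorm (p - x) < r -> vnorm (f p - y) < e.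
  by have [/lim[y Hy]|nx] := pselect (closure Omega1 x); [exists y | exists 0].
exists g; split.
- apply/subspace_continuousP => x clx P /nbhs_vecP[e e0 HP].
  have [_ Hx] := Hg x clx; have e2 : 0 < e / 2 by rewrite divr_gt0.
  have [r r0 Hr] := Hx _ e2; have r2 : 0 < r / 2 by rewrite divr_gt0.
  apply/nbhs_vecP; exists (r / 2) => // y yx cly; apply: HP.
  have [_ Hy] := Hg y cly; have [s s0 Hs] := Hy _ e2.
  have rs : 0 < Num.min (r / 2) s by rewrite lt_min r2.
  (* A point p of [Omega1] close to both [x] and [y] links the two limits, which are only taken
     through [Omega1]. *)
  have [p Op] := (closure_vecP _ _).1 cly _ rs; rewrite lt_min => /andP[p1 p2].
  apply: le_lt_trans (vnorm_distD (f p) _ _) _; rewrite [e]splitr; apply: ltrD.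
    by rewrite vnorm_distC; exact: Hs.
  apply: Hr => //; apply: le_lt_trans (vnorm_distD y _ _) _.
  by rewrite [r]splitr; exact: ltrD.
- move=> z clz; apply/closure_vecP => e e0; have [_ H] := Hg z clz.
  have [r r0 Hr] := H e e0; have [p Op pz] := (closure_vecP _ _).1 clz r r0.
  by exists (f p); [exact: fO | exact: Hr].
- by move=> z Oz; have [H _] := Hg z (subset_closure Oz); exact: H.
Qed.

(** The closure of [Omega2] is compact, so the image filter clusters. The set [A] is free so that
    the approach to [x] can be restricted to points whose images avoid a given value. *)
Lemma cluster_value (A : set (Cvec R d1)) (Omega2 : set (Cvec R d2))
    (f : Cvec R d1 -> Cvec R d2) x : bounded_set Omega2 ->
  (forall p, A p -> Omega2 (f p)) -> closure A x ->
  exists y, closure Omega2 y /\ forall r s : R, 0 < r -> 0 < s ->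
    exists p, [/\ A p, vnorm (p - x) < r & vnorm (f p - y) < s].
Proof.
move=> bO fA clx.
have FF : ProperFilter (f @ within A (nbhs x)).
  by apply: fmap_proper_filter; exact: within_nbhs_proper.
have [|y [cly Hy]] := compact_closure_bounded _ bO (f @ within A (nbhs x)) FF.
  by apply/nbhs_vecP; exists 1 => // p _ /fA; exact: subset_closure.
exists y; split => // r s r0 s0.
have [||v [[p [Ap px <-]] vs]] := Hy [set v | exists p, [/\ A p, vnorm (p - x) < r & f p = v]]
    [set v | vnorm (v - y) < s].
- by apply/nbhs_vecP; exists r => // p px Ap; exists p.
- by apply/nbhs_vecP; exists s.
- by exists p.
Qed.

End Extension.

Theorem theorem2p18 (R : realType) (d1 d2 : nat) (alpha : R)
    (Omega1 : set (Cvec R d1)) (Omega2 : set (Cvec R d2))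
    (f : Cvec R d1 -> Cvec R d2) :
  (0 < d1)%N -> (0 < d2)%N ->
  0 < alpha -> alpha <= 1 ->
  bounded_convex_domain Omega1 -> bounded_convex_domain Omega2 ->
  has_C1alpha_boundary alpha Omega1 -> has_C1alpha_boundary alpha Omega2 ->
  C_strictly_convex Omega2 ->
  kobayashi_isometric_embedding Omega1 Omega2 f ->
  exists fbar : Cvec R d1 -> Cvec R d2,
    [/\ {within closure Omega1, continuous fbar},
        forall z, closure Omega1 z -> closure Omega2 (fbar z) &
        forall z, Omega1 z -> fbar z = f z].
Proof.
move=> _ _ al0 _ [[oO1 _ [ o Oo]] bO1 cO1] [[oO2 _ _] bO2 cO2] bC1 bC2 sO2 fK.
have fO := fK.1; have Oo2 := fO o Oo.
apply: (extension_by_continuity Omega1 Omega2 f fO) => x clx.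
have [Ox|nx] := pselect (Omega1 x).
  (* In the interior [f] is continuous: short chains exist near [x], and in [Omega2] the distance
     dominates the norm. *)
  exists (f x); split => // e e0.
  have [C C0 HC] := chain_norm_le Omega2 bO2.
  have eC : 0 < e / 2 / C by rewrite divr_gt0 // divr_gt0.
  have [r r0 Hr] := chain_le_small Omega1 x _ oO1 Ox eC.
  exists r => // p Op px.
  have : vnorm (f p - f x) / C <= e / 2 / C.
    apply: (isometry_lower _ _ _ fK x p) (Hr p px) _ => // L HL.
    by rewrite ler_pdivrMr // mulrC; apply: HC HL; exact: fO.
  rewrite ler_pM2r ?invr_gt0 //; lra.
have bx : boundary Omega1 x by apply/boundaryP.
have [y [cly Hy]] := cluster_value Omega1 Omega2 f x bO2 fO clx.
(* If [z] were interior, points p near [x] would have f p at distance at most C from f o, while p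
   itself is at distance at least C + 1 from [o]. *)
have escape z : closure Omega2 z -> (forall r s : R, 0 < r -> 0 < s ->
    exists p, [/\ Omega1 p, vnorm (p - x) < r & vnorm (f p - z) < s]) -> boundary Omega2 z.
  move=> clz Hz; apply/boundaryP => //; split => // Oz.
  have [D1 D10 HD1] := (open_vecP _).1 oO2 z Oz.
  have [D2 D20 HD2] := (open_vecP _).1 oO2 _ Oo2.
  pose D := Num.min (D1 / 2) D2.
  have D12 : 0 < D1 / 2 by rewrite divr_gt0.
  have D0 : 0 < D by rewrite lt_min D12.
  have [C HC] := chain_le_interior Omega2 D cO2 bO2 D0.
  have [r r0 Hr] := same_boundary_point Omega1 alpha (C + 1) o x al0 oO1 bO1 cO1 bC1 Oo bx.
  have [p [Op px pz]] := Hz _ _ r0 D12.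
  have [a [b [_ Ma Ha _]]] := Hr p p Op Op px px.
  have : chain_le Omega2 (f p) (f o) C.
    apply: HC => //; first exact: fO.
    - move=> v; rewrite lt_min => /andP[vp _]; apply: HD1.
      by apply: le_lt_trans (vnorm_distD (f p) _ _) _; rewrite [D1]splitr; exact: ltrD.
    - by move=> v; rewrite lt_min => /andP[_]; exact: HD2.
  move=> /(isometry_upper _ _ _ fK p o _ a Op Oo)/(_ Ha); lra.
have by_ := escape y cly Hy.
(* If [y] is not the limit, the points whose images stay at distance at least e from [y] accumulate
   at [x] and yield a second cluster value. *)
exists y; split => [//|e e0]; apply: contrapT => Hn.
pose A := [set p | Omega1 p /\ e <= vnorm (f p - y)].
have clA : closure A x.
  apply/closure_vecP => r r0; apply: contrapT => HA; apply: Hn; exists r => // p Op px.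
  by rewrite ltNge; apply/negP => ep; apply: HA; exists p.
have [z [clz Hz]] := cluster_value A Omega2 f x bO2 (fun p Ap => fO p Ap.1) clA.
have bz : boundary Omega2 z.
  apply: escape => // r s r0 s0; have [p [[Op _] px pz]] := Hz r s r0 s0.
  by exists p.
have yz : y != z.
  apply/eqP => yz; have [p [[_ ep] _ pz]] := Hz _ _ e0 e0.
  by move: ep; rewrite yz leNgt pz.
have [r2 r20 [C H2]] := distinct_boundary_points Omega2 alpha (f o) y z al0 oO2 bO2 sO2 bC2 Oo2 by_ bz yz.
(* The constant exceeds the total loss: a + b <= a' + b' + 2C and a' + b' - C <= a + b - (3C + 1)
   are incompatible. *)
have [r1 r10 H1] := same_boundary_point Omega1 alpha (3 * C + 1) o x al0 oO1 bO1 cO1 bC1 Oo bx.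
have [p [Op px py]] := Hy _ _ r10 r20; have [q [[Oq _] qx qz]] := Hz _ _ r10 r20.
have [a [b [c1 _ Ha Hb]]] := H1 p q Op Oq px qx.
have [a' [b' [c2 c3 H3]]] := H2 _ _ (fO p Op) (fO q Oq) py qz.
have e1 := isometry_lower _ _ _ fK p q _ _ Op Oq c1 H3.
have e2 := isometry_upper _ _ _ fK p o _ _ Op Oo c2 Ha.
have e3 := isometry_upper _ _ _ fK q o _ _ Oq Oo c3 Hb.
lra.
Qed.
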